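(* The limit $m_\infty=\lim_{i\to\infty}m_i$ exists and coincides with $1/\tilde q$, where $\tilde q>0$ is the maximal positive number $q$ for which the series $\Psi(q,u)$ belongs to $\mathcal{L\text{-}P}^+$ as a function of $u$. Moreover, the sequence $\{\widetilde P_i\}$ of scaled reverted polynomials converges, uniformly on compact subsets of $\mathbb{C}$, to the function $x\mapsto\Psi(\tilde q,-\tilde u x)$, where $\tilde u$ is the unique real double root of $\Psi(\tilde q,u)$ as a function of $u$.
   Context: A real polynomial is called hyperbolic if all its roots are real. For $n\ge 1$ let $\Delta_n$ be the set of polynomials $p(x)=1+a_1x+\dots+a_nx^n$ with $a_1,\dots,a_n>0$ such that for every $i=1,\dots,n$ the section $1+a_1x+\dots+a_ix^i$ is hyperbolic. Put $a_0=1$ and $\Delta=\bigcup_{n\ge1}\Delta_n$. For a positive integer $i$ set $m_i=\inf_{p\in\Delta} \frac{a_i^2}{a_{i-1}a_{i+1}}$, where the infimum is over those $p\in\Delta$ of degree at least $i+1$ and $a_j$ denotes the coefficient of $x^j$ in $p$. The partial theta function is $\Psi(q,u)=\sum_{j=0}^\infty q^{\binom{j+1}{2}}u^j$; for $|q|<1$ it is an entire function of $u$. $\mathcal{L\text{-}P}^+$ denotes the Laguerre-Pólya class of entire functions that are limits, uniform on compact sets, of real polynomials with all roots real and negative; for $0<q<1$, $\Psi(q,\cdot)\in\mathcal{L\text{-}P}^+$ means that all its roots are real and negative. The polynomials $p_n$ are defined inductively by $p_1(x)=1+x$ and, for $n\ge2$, $p_n(x)=p_{n-1}(x)+A_nx^n$,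 where $A_n$ is the maximal positive number such that $p_n(x)$ is hyperbolic. The reverted polynomial is $P_i(x)=x^ip_i(1/x)$, which is monic of degree $i$. For $i\ge2$ all roots of $P_i$ are negative, exactly one of them, denoted $\zeta_i$, is a double root, and the others are simple. The scaled reverted polynomial is $\widetilde P_i(x)=P_i(-\zeta_ix)/P_i(0)$, so that its double root is at $-1$ and its constant term is $1$. *)

(* Defs.v *)
From HB Require Import structures.
From mathcomp Require Export all_boot all_order all_algebra.
From mathcomp Require Export all_classical all_reals all_analysis.
From mathcomp Require Export complex.
Export Order.TTheory GRing.Theory Num.Theory.
Export numFieldNormedType.Exports.

Set Implicit Arguments.
Unset Strict Implicit.
Unset Printing Implicit Defensive.

Local Open Scope classical_set_scope.
Local Open Scope ring_scope.

(* Presenting R[i] as a numClosedFieldType is what gives it the canonical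
   topological and normed structures of MathComp-Analysis (as a module over
   itself; derivatives [f^`()] below are therefore complex derivatives). *)
Definition cplx (R : realType) : numClosedFieldType := R[i].

Definition toC (R : realType) (x : R) : cplx R := real_complex R x.
HB.instance Definition _ (R : realType) :=
  GRing.RMorphism.copy (@toC R) (real_complex R).

Definition ceval (R : realType) (p : {poly R}) (z : cplx R) : cplx R :=
  (map_poly (@toC R) p).[z].

Definition is_maximum (R : realType) (A : set R) (x : R) : Prop :=
  A x /\ ubound A x.

(* 0 when A has no maximum *)
Definition maximum (R : realType) (A : set R) : R := xget 0 (is_maximum A).

Definition hyperbolic (R : realType) (p : {poly R}) : Prop :=
  forall z : cplx R, ceval p z = 0 -> z \is Num.real.

(* In the partial order of the complex numbers, [z < 0] says that z is real and
   negative.  The zero polynomial is excluded, since z = 0 is a root of it. *)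
Definition negative_rooted (R : realType) (p : {poly R}) : Prop :=
  forall z : cplx R, ceval p z = 0 -> z < 0.

Definition Delta_n (R : realType) (n : nat) : set {poly R} :=
  [set p : {poly R} | [/\ size p = n.+1, p`_0 = 1,
               forall i, (1 <= i <= n)%N -> 0 < p`_i &
               forall i, (1 <= i <= n)%N -> hyperbolic (take_poly i.+1 p)]].

Definition Delta (R : realType) : set {poly R} :=
  \bigcup_(n in [set n | (1 <= n)%N]) @Delta_n R n.

(* Meaningful for i >= 1 only ([0.-1] is 0).  The infimum is a genuine one: the
   ratios are positive, and they exist for every i. *)
Definition m_ (R : realType) (i : nat) : R :=
  inf [set p`_i ^+ 2 / (p`_i.-1 * p`_i.+1) |
        p in [set p : {poly R} | @Delta R p /\ (i.+1 < size p)%N]].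

Definition Psi (R : realType) (q : R) (u : cplx R) : cplx R :=
  limn (series (fun j : nat => toC (q ^+ 'C(j.+1, 2)) * u ^+ j)).

(* The class L-P^+; such a limit is automatically entire. *)
Definition LPplus (R : realType) (f : cplx R -> cplx R) : Prop :=
  exists p : nat -> {poly R},
    (forall n, negative_rooted (p n)) /\
    {family compact, (fun n => ceval (p n)) @ \oo --> f}.

Definition double_zero (R : realType) (f : cplx R -> cplx R) (z : cplx R) :
    Prop :=
  [/\ f z = 0, (f^`())%classic z = 0 & (f^`(2))%classic z <> 0].

(* [p_ R 0 = 1] is only a placeholder: the sequence starts at n = 1. *)
Fixpoint p_ (R : realType) (n : nat) : {poly R} :=
  match n with
  | 0 => 1
  | 1 => 1 + 'X
  | n'.+1 =>
      p_ R n' +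
      maximum [set A : R | 0 < A /\ hyperbolic (p_ R n' + A *: 'X^n)] *: 'X^n
  end.

(* x^i p_i(1/x) *)
Definition P_ (R : realType) (i : nat) : {poly R} :=
  \poly_(j < i.+1) (p_ R i)`_(i - j).

(* the double root of P_i, for i >= 2; 0 by default if there is none *)
Definition zeta_ (R : realType) (i : nat) : R :=
  xget 0 [set z : R | mup z (P_ R i) = 2%N].

Definition Ptilde_ (R : realType) (i : nat) : {poly R} :=
  (P_ R i).[0]^-1 *: (P_ R i \Po (- zeta_ R i *: 'X)).

(* Main.v *)
Require Import Defs.
From mathcomp Require Import ring lra zify.
Local Open Scope classical_set_scope.
Local Open Scope ring_scope.
Set Implicit Arguments.
Unset Strict Implicit.
Unset Printing Implicit Defensive.

(** Reversal.  Let a_0, a_1, ... be positive and lam_k = a_(k-1) a_(k+1) / a_k^2.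
    Reverting 1 + a_1 x + ... + a_k x^k and rescaling the variable gives the
    polynomial R_k, where R_0 = 1 and R_(k+1)(x) = 1 - x R_k(lam_k x)
    ([ratio_reverse]).  Hence m_i is governed by how large lam_i can be while all
    R_k stay real-rooted.  When all ratios equal q, the R_k tend to the entire
    function theta_q(x) = sum_m (-1)^m q^(m(m-1)/2) x^m = Psi(q, - x / q).

    The extremal parameter.  If R_(k+2) is real-rooted, the first three power sums
    of the reciprocals of its roots show that lam_(k+1) <= 1/3 and that the
    smallest root x satisfies lam_(k+1) x <= 1, so that with t = lam_(k+1) x the
    ratio lam_(k+1) equals t R_(k+1)(t) for some t in [0, 1] ([hyperbolic_ratio]).
    The same computation on the approximating polynomials shows that Psi(q, .) in
    the Laguerre-Polya class forces q <= 1/3 and q <= t theta_q(t) for some t in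
    [0, 1] ([LPplus_touching]).  Let l be the largest q with these two properties;
    then 17/55 <= l <= 13/42 and max t theta_l(t) = l over [0, 1].

    Comparison.  Whenever lam_(k+1) <= max t R_(k+1)(t) for all k, no ratio exceeds
    l ([comparison]).  The induction carries along that consecutive deficits
    d_k = l - lam_k satisfy d_k <= 6 d_(k+1): the maximum of t R_(k+2)(t) is
    compared with that of t theta_l(t) by moving t a little to the right by a
    fixed multiple of the deficit, which leaves a deficit of at least d_(k+1) / 6 ([step_max]).  So
    m_i >= 1 / l.

    The greedy sequence.  Choosing every lam_(k+1) equal to max t R_(k+1)(t) gives
    polynomials whose roots are located by explicit points of alternating sign
    and a double root at the maximum ([greedy_factor]); they are real-rooted, so
    these ratios are attained, the corresponding polynomials are exactly the p_n
    ([p_E]), and the ratios tend to l geometrically ([glam_close]).  Hence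
    m_i tends to 1 / l.

    The limit function.  By dominated convergence of coefficients ([tannery])
    the greedy R_k converge to theta_l uniformly on disks; this puts Psi(l, .) in
    the Laguerre-Polya class.  Their double roots rho_k converge to a double zero
    xstar of theta_l because the maximum of t theta_l(t) is attained at one point
    only; here, and in the proof that theta_l has no other real double zero, the
    tool is that the logarithm of a real-rooted polynomial is concave between its
    roots ([hyperbolic_log_concave]).  Finally the scaled reverted polynomial of
    p_k is R_k(- rho_k x) ([ceval_Ptilde]), which converges to
    theta_l(- xstar x) = Psi(l, - ustar x). *)

(** * The recursive polynomials R_k and the function theta *)

(** The polynomials R_k attached to a sequence of ratios: R_0 = 1 and
    R_(k+1)(x) = 1 - x R_k(lam_k x).  Only lam_1, ..., lam_(k-1) matter, since lam_0
    multiplies the variable of the constant polynomial R_0. *)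
Fixpoint Rp {R : realType} (lam : nat -> R) (k : nat) : {poly R} :=
  if k is k'.+1 then 1 - 'X * (Rp lam k' \Po (lam k' *: 'X)) else 1.

Section Finite.
Variable R : realType.
Implicit Types (lam : nat -> R) (x s q : R).

Lemma Rp0 lam x : (Rp lam 0).[x] = 1.
Proof. by rewrite hornerC. Qed.

Lemma RpS lam k x : (Rp lam k.+1).[x] = 1 - x * (Rp lam k).[lam k * x].
Proof. by rewrite /= !(hornerE, horner_comp). Qed.

Lemma Rp_bound lam k x : (forall j, 0 <= lam j <= 1/3) -> 0 <= x <= 1 ->
  1 - x <= (Rp lam k).[x] <= 1.
Proof.
move=> hl; elim: k x => [|k IH] x hx; first by rewrite Rp0; lra.
have hlk := hl k.
have hy : 0 <= lam k * x <= 1 by nra.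
have := IH _ hy; rewrite RpS; nra.
Qed.

(** R_k is nonincreasing on [0, 1], with a slope controlled by the value of
    R_(k-1) at the image lam_(k-1) s' of the right end of the interval. *)
Lemma Rp_lip lam k s s' : (forall j, 0 <= lam j <= 1/3) ->
  0 <= s -> s <= s' -> s' <= 1 ->
  0 <= (Rp lam k).[s] - (Rp lam k).[s'] <=
     (s' - s) * (if k is k'.+1 then (Rp lam k').[lam k' * s'] else 0).
Proof.
move=> hl; elim: k s s' => [|k IH] s s' h0 h1 h2; first by rewrite !Rp0; lra.
have hlk := hl k.
have a1 : 0 <= lam k * s by nra.
have a2 : lam k * s <= lam k * s' by nra.
have a3 : lam k * s' <= 1/3 by nra.
have := IH _ _ a1 a2 ltac:(lra); rewrite !RpS.
have := @Rp_bound lam k (lam k * s') hl ltac:(lra).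
case: k IH hlk a1 a2 a3 => [|k] IH hlk a1 a2 a3.
  rewrite !Rp0; nra.
have a4 : 0 <= lam k * (lam k.+1 * s') <= 1 by have := hl k; nra.
have := @Rp_bound lam k (lam k * (lam k.+1 * s')) hl a4.
set A := (Rp lam k.+1).[_]; set B := (Rp lam k.+1).[_]; set C := (Rp lam k).[_].
move=> c1 c2 c3.
have d1 : B - A <= lam k.+1 * s' - lam k.+1 * s by nra.
have d2 : B - A <= (s' - s) * (1/3) by nra.
by apply/andP; split; nra.
Qed.

Lemma Rp_lip1 lam k s s' : (forall j, 0 <= lam j <= 1/3) ->
  0 <= s -> s <= s' -> s' <= 1 ->
  0 <= (Rp lam k).[s] - (Rp lam k).[s'] <= s' - s.
Proof.
move=> hl h0 h1 h2; have /andP[-> e2] := Rp_lip k hl h0 h1 h2.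
apply: le_trans e2 _; case: k => [|k]; first by rewrite mulr0; lra.
rewrite ler_piMr; [by []|lra|].
have hlk := hl k; have hy : 0 <= lam k * s' <= 1 by nra.
by have /andP[] := Rp_bound k hl hy.
Qed.

Lemma coef_comp_scale (p : {poly R}) (a : R) m : (p \Po (a *: 'X))`_m = a ^+ m * p`_m.
Proof.
rewrite comp_polyE coef_sum.
under eq_bigr => i _ do rewrite exprZn !coefZ coefXn.
have [hm|hm] := ltnP m (size p).
  rewrite (bigD1 (Ordinal hm)) //= eqxx big1 ?addr0 ?mulr1; first by rewrite mulrC.
  by move=> i hi; rewrite [m == i]eq_sym (negbTE (hi : nat_of_ord i != m)) !mulr0.
rewrite [p`_m]nth_default // mulr0 big1 // => i _.
by rewrite gtn_eqF ?mulr0 // (leq_trans (ltn_ord i) hm).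
Qed.

Lemma coef_Rp0 lam k : (Rp lam k)`_0 = 1.
Proof. by case: k => [|k]; rewrite /= ?coefB ?coefXM ?coef1 ?subr0 //=. Qed.

Lemma coef_RpS lam k m : (Rp lam k.+1)`_m.+1 = - (lam k ^+ m * (Rp lam k)`_m).
Proof. by rewrite /= coefB coef1 coefXM /= sub0r coef_comp_scale. Qed.

(** A bound on the coefficients which does not depend on k; it is what makes the
    passage to the limit in k possible. *)
Lemma coef_Rp_bound lam k m : (forall j, 0 <= lam j <= 1/3) ->
  `|(Rp lam k)`_m| <= (1/3) ^+ 'C(m, 2).
Proof.
move=> hl; elim: k m => [|k IH] [|m].
- by rewrite coef1 normr1 expr0.
- by rewrite coef1 normr0 exprn_ge0 //; lra.
- by rewrite coef_Rp0 normr1 expr0.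
rewrite coef_RpS normrN normrM binS bin1 exprD mulrC.
have /andP[h0 h1] := hl k.
apply: ler_pM => //.
by rewrite normrX (ger0_norm h0) lerXn2r // nnegrE; lra.
Qed.

Lemma coef_Rp_cst q k m :
  (Rp (fun=> q) k)`_m = if (m <= k)%N then (-1) ^+ m * q ^+ 'C(m, 2) else 0.
Proof.
elim: k m => [|k IH] [|m]; rewrite ?coef_Rp0 ?expr0 ?mulr1 ?coef1 //.
rewrite coef_RpS IH ltnS binS bin1 exprD exprS; case: ifP => _; ring.
Qed.

Lemma size_Rp_le lam k : (size (Rp lam k) <= k.+1)%N.
Proof.
apply/leq_sizeP; elim: k => [|k IH] [|j] // hj; first by rewrite coef1.
by rewrite coef_RpS IH // mulr0 oppr0.
Qed.

End Finite.

Section GeometricLimit.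
Variable R : realType.
Implicit Types (C x q : R) (u : R^nat).

Lemma cvg_geo0 C : (fun k => C * (2^-1) ^+ k) @ \oo --> (0 : R).
Proof.
rewrite -(mulr0 C); apply: cvgMr; apply: cvg_expr.
by rewrite ger0_norm ?invr_ge0 // invf_lt1 // ltr1n.
Qed.

Lemma le_cvg u v (l m : R) : u @ \oo --> l -> v @ \oo --> m ->
  (forall k, u k <= v k) -> l <= m.
Proof.
move=> cu cv h; rewrite -(cvg_lim _ cu) // -(cvg_lim _ cv) //.
by apply: ler_lim; [apply/cvg_ex; exists l|apply/cvg_ex; exists m|exact: nearW].
Qed.

Lemma cvg_pow (v : nat -> R) (a : R) k : v @ \oo --> a -> (fun n => v n ^+ k) @ \oo --> a ^+ k.
Proof.
move=> cu; elim: k => [|k IH]; first by under eq_fun do rewrite expr0; exact: cvg_cst.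
by under eq_fun do rewrite exprS; rewrite exprS; exact: cvgM.
Qed.

Lemma geo_step C k : C * (2^-1) ^+ k = 2 * (C * (2^-1) ^+ k.+1) :> R.
Proof. by rewrite exprS; field. Qed.

(** A sequence whose increments are dominated by a geometric sequence converges:
    it is squeezed between the monotone sequences u_k - 2 C / 2^k and
    u_k + 2 C / 2^k. *)
Lemma geo_cauchy u C : (forall k, `|u k.+1 - u k| <= C * (2^-1) ^+ k) ->
  cvgn u /\ forall k, `|limn u - u k| <= 2 * C * (2^-1) ^+ k.
Proof.
move=> hu.
pose g k : R := C * (2^-1) ^+ k.
have hg k : g k = 2 * g k.+1 by exact: geo_step.
have g0 k : 0 <= g k by apply: le_trans (hu k).
pose w k := u k - 2 * g k.
pose v k := u k + 2 * g k.
have hw : nondecreasing_seq w.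
  apply/nondecreasing_seqP => k; rewrite /w; have := hu k; rewrite -/(g k) ler_norml.
  have := hg k; lra.
have hv : nonincreasing_seq v.
  apply/nonincreasing_seqP => k; rewrite /v; have := hu k; rewrite -/(g k) ler_norml.
  have := hg k; lra.
have wv k : w k <= v k by rewrite /w /v; have := g0 k; lra.
have bw : has_ubound (range w).
  exists (v 0); move=> _ [k _ <-]; apply: le_trans (wv k) _; exact: hv.
have bv : has_lbound (range v).
  exists (w 0); move=> _ [k _ <-]; apply: le_trans (wv k); exact: hw.
have cw := nondecreasing_is_cvgn hw bw.
have cv := nonincreasing_is_cvgn hv bv.
have c0 : (fun k => 2 * g k) @ \oo --> (0 : R).
  by rewrite -(mulr0 2); apply: cvgMr; exact: cvg_geo0.
have eu : u = (fun k => w k + 2 * g k) by apply/funext => k; rewrite /w subrK.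
have cu : u @ \oo --> limn w by rewrite {1}eu -[limn w]addr0; apply: cvgD.
split; first by apply/cvg_ex; exists (limn w).
move=> k; rewrite (cvg_lim _ cu) //.
have h1 : w k <= limn w := nondecreasing_cvgn_le hw cw k.
have h2 : limn v <= v k := nonincreasing_cvgn_ge hv cv k.
have h3 : limn v = limn w.
  apply: cvg_lim => //; rewrite (_ : v = fun k => u k + 2 * g k) // -[limn w]addr0.
  exact: cvgD.
rewrite -h3 in h2 *; move: h1 h2; rewrite /w /v ler_norml -h3 /g; lra.
Qed.

Lemma superexp_dominated (M : R) : 0 <= M ->
  exists2 C : R, 0 <= C & forall m, (1/3) ^+ 'C(m, 2) * M ^+ m <= C * (2^-1) ^+ m.
Proof.
move=> M0; pose a m : R := (1/3) ^+ 'C(m, 2) * (2 * M) ^+ m.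
have a0 m : 0 <= a m by rewrite mulr_ge0 // exprn_ge0 //; lra.
have aS m : a m.+1 = a m * ((1/3) ^+ m * (2 * M)).
  by rewrite /a binS bin1 exprD exprS; ring.
(* from some index on the terms a m decrease *)
have [N hN] : exists N, forall m, (N <= m)%N -> (1/3) ^+ m * (2 * M) <= 1.
  have c : (fun m => (1/3 : R) ^+ m * (2 * M)) @ \oo --> (0 : R).
    rewrite -(mul0r (2 * M)); apply: cvgMl; apply: cvg_expr.
    by rewrite ger0_norm; lra.
  have /cvgrPdist_le/(_ 1 ltr01)[N _ hN] := c.
  exists N => m hm; have := hN m hm; rewrite /= sub0r normrN; apply: le_trans.
  exact: ler_norm.
exists (\sum_(i < N.+1) a i); first by rewrite sumr_ge0.
have le_a m : a m <= \sum_(i < N.+1) a i.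
  have [hm|hm] := leqP m N.
    rewrite (bigD1 (Ordinal (hm : (m < N.+1)%N))) //= lerDl sumr_ge0 //.
  have : a m <= a N.
    rewrite -(subnK (ltnW hm)); elim: (m - N)%N => // k IH.
    by rewrite addSn aS (le_trans _ IH) // ler_piMr // hN // leq_addl.
  move=> /le_trans; apply; rewrite (bigD1 ord_max) //= lerDl sumr_ge0 //.
move=> m.
have -> : (1/3) ^+ 'C(m, 2) * M ^+ m = a m * (2^-1) ^+ m.
  have e : 2 ^+ m * (2^-1) ^+ m = 1 :> R by rewrite -exprMn divff ?expr1n.
  transitivity ((1/3) ^+ 'C(m, 2) * M ^+ m * (2 ^+ m * (2^-1) ^+ m)); first by rewrite e mulr1.
    by rewrite /a [(2 * M) ^+ m]exprMn -!mulrA; congr (_ * _); rewrite mulrCA.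
by rewrite ler_wpM2r // exprn_ge0 // invr_ge0.
Qed.

Lemma Rp_cst_diff q k x :
  (Rp (fun=> q) k.+1).[x] - (Rp (fun=> q) k).[x] = (- x) ^+ k.+1 * q ^+ 'C(k.+1, 2).
Proof.
elim: k x => [|k IH] x; first by rewrite RpS !Rp0 /= bin_small // expr0 expr1; ring.
rewrite RpS [in X in _ - X]RpS binS bin1 exprD exprS -[X in _ - X]opprK.
transitivity (- x * ((Rp (fun=> q) k.+1).[q * x] - (Rp (fun=> q) k).[q * x])); first by ring.
by rewrite IH -mulrN exprMn; ring.
Qed.

End GeometricLimit.

(** theta_q(x) = sum_m (-1)^m q^(m(m-1)/2) x^m, as the limit of its partial sums,
    which are the R_k with all ratios equal to q.  The function is used for
    0 <= q <= 1/3 only. *)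
Definition theta {R : realType} (q x : R) : R := limn (fun k => (Rp (fun=> q) k).[x]).

Section Theta.
Variable R : realType.
Implicit Types (C x q s t : R).

Lemma theta_cvg q x : 0 <= q <= 1/3 -> (fun k => (Rp (fun=> q) k).[x]) @ \oo --> theta q x.
Proof.
move=> hq; have [C C0 hC] := superexp_dominated (normr_ge0 x).
apply: (geo_cauchy (C := C) _).1 => k; rewrite Rp_cst_diff.
have {hC} := hC k.+1; set D := (1/3) ^+ _ => hC.
rewrite normrM !normrX normrN mulrC.
have h : `|q| ^+ 'C(k.+1, 2) <= D.
  have /andP[q0 q1] := hq.
  by rewrite /D (ger0_norm q0) lerXn2r // ?nnegrE; lra.
apply: le_trans (_ : D * `|x| ^+ k.+1 <= _).
  by rewrite ler_wpM2r // exprn_ge0.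
apply: le_trans hC _; rewrite ler_wpM2l // exprS ler_piMl ?exprn_ge0 ?invr_ge0 //.
by rewrite invf_le1 // ler1n.
Qed.

Arguments theta_cvg {q} x _.

Lemma theta_rec q x : 0 <= q <= 1/3 -> theta q x = 1 - x * theta q (q * x).
Proof.
move=> hq; apply: cvg_lim => //.
rewrite -(cvg_shiftS (fun k => (Rp (fun=> q) k).[x])).
under eq_fun do rewrite RpS.
by apply: cvgB; [exact: cvg_cst | apply: cvgMr; exact: theta_cvg].
Qed.

Lemma theta_bound q x : 0 <= q <= 1/3 -> 0 <= x <= 1 -> 1 - x <= theta q x <= 1.
Proof.
move=> hq hx; have c := theta_cvg x hq.
by apply/andP; split; [apply: limr_ge|apply: limr_le]; try (by apply/cvg_ex; exists (theta q x));
  apply: nearW => k; have /andP[] := @Rp_bound R (fun=> q) k x (fun=> hq) hx.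
Qed.

Lemma theta_lip q s s' : 0 <= q <= 1/3 -> 0 <= s -> s <= s' -> s' <= 1 ->
  0 <= theta q s - theta q s' <= (s' - s) * theta q (q * s').
Proof.
move=> hq h0 h1 h2.
have c1 := theta_cvg s hq; have c2 := theta_cvg s' hq; have c3 := theta_cvg (q * s') hq.
have L k := @Rp_lip R (fun=> q) k.+1 s s' (fun=> hq) h0 h1 h2.
have c4 : (fun k => (Rp (fun=> q) k.+1).[s] - (Rp (fun=> q) k.+1).[s']) @ \oo -->
    theta q s - theta q s'.
  apply: cvgB; first by rewrite (cvg_shiftS (fun k => (Rp (fun=> q) k).[s])).
  by rewrite (cvg_shiftS (fun k => (Rp (fun=> q) k).[s'])).
apply/andP; split.
  by apply: (le_cvg (cvg_cst 0) c4) => k; have /andP[] := L k.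
have c5 : (fun k => (s' - s) * (Rp (fun=> q) k).[q * s']) @ \oo --> (s' - s) * theta q (q * s').
  exact: cvgMr.
by apply: (le_cvg c4 c5) => k; have /andP[] := L k.
Qed.

Lemma theta_le_quadratic q s : 0 <= q <= 1/3 -> 0 <= s <= 1 -> theta q s <= 1 - s + q * s ^+ 2.
Proof.
move=> hq hs; rewrite theta_rec //.
have h : 0 <= q * s <= 1 by nra.
by have := theta_bound hq h; nra.
Qed.

Lemma theta_rec2 q s : 0 <= q <= 1/3 ->
  theta q s = 1 - s + q * s ^+ 2 * theta q (q * (q * s)).
Proof. by move=> hq; rewrite theta_rec // (theta_rec (q * s)) //; ring. Qed.

(** Lower bound of theta by its partial sum of degree 3. *)
Lemma theta_ge_cubic q s : 0 <= q <= 1/3 -> 0 <= s <= 1 ->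
  1 - s + q * s ^+ 2 * (1 - q ^+ 2 * s) <= theta q s.
Proof.
move=> hq hs; rewrite theta_rec2 // lerD2l.
have h : 0 <= q * (q * s) <= 1 by nra.
have := theta_bound hq h => /andP[h1 _].
have q0 : 0 <= q by lra.
by apply: ler_wpM2l; [rewrite mulr_ge0 ?sqr_ge0|apply: le_trans h1; lra].
Qed.

(** theta is Lipschitz in the parameter. *)
Lemma theta_lipq q q' t : 0 <= q <= 1/3 -> 0 <= q' <= 1/3 -> 0 <= t <= 1 ->
  `|theta q t - theta q' t| <= 2 * `|q - q'|.
Proof.
move=> hq hq' ht.
have key k x : 0 <= x <= 1 -> `|(Rp (fun=> q) k).[x] - (Rp (fun=> q') k).[x]| <= 2 * `|q - q'| * x.
  elim: k x => [|k IH] x hx.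
    by rewrite !Rp0 subrr normr0 !mulr_ge0 //; lra.
  rewrite !RpS.
  have a1 : 0 <= q * x <= 1 by nra.
  have a2 : 0 <= q' * x <= 1 by nra.
  have := IH _ a1.
  set A := (Rp _ k).[q * x]; set B := (Rp _ k).[q * x]; set C := (Rp _ k).[q' * x] => h1.
  have h2 : `|B - C| <= `|q - q'| * x.
    have [h|h] := leP q q'.
      have h3 : q * x <= q' * x by nra.
      have /andP[e1 e2] := @Rp_lip1 R (fun=> q') k _ _ (fun=> hq') (andP a1).1 h3 (andP a2).2.
      by rewrite ger0_norm // ler0_norm; [apply: le_trans e2 _; lra|lra].
    have h3 : q' * x <= q * x by nra.
    have /andP[e1 e2] := @Rp_lip1 R (fun=> q') k _ _ (fun=> hq') (andP a2).1 h3 (andP a1).2.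
    by rewrite distrC ger0_norm // gtr0_norm; [apply: le_trans e2 _; lra|lra].
  have -> : 1 - x * A - (1 - x * C) = - x * ((A - B) + (B - C)) by ring.
  rewrite normrM normrN (ger0_norm (andP hx).1).
  have h4 : `|(A - B) + (B - C)| <= 2 * `|q - q'| * (q * x) + `|q - q'| * x.
    by apply: le_trans (ler_normD _ _) _; exact: lerD.
  apply: le_trans (_ : x * (2 * `|q - q'| * (q * x) + `|q - q'| * x) <= _).
    by rewrite ler_wpM2l //; lra.
  have n0 : 0 <= `|q - q'| by [].
  have -> : x * (2 * `|q - q'| * (q * x) + `|q - q'| * x) = `|q - q'| * (x ^+ 2 * (2 * q + 1)) by ring.
  have -> : 2 * `|q - q'| * x = `|q - q'| * (2 * x) by ring.
  by rewrite ler_wpM2l //; nra.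
have c : (fun k => `|(Rp (fun=> q) k).[t] - (Rp (fun=> q') k).[t]|) @ \oo -->
    `|theta q t - theta q' t|.
  by apply: cvg_norm; apply: cvgB; exact: theta_cvg.
apply: (le_cvg c (cvg_cst _)) => k; apply: le_trans (key k t ht) _.
by rewrite ler_piMr // ?mulr_ge0 //; lra.
Qed.

End Theta.

Section Extremal.
Variable R : realType.
Implicit Types (q t : R).

(** The parameters q at most 1/3 for which theta_q(x) = 1 - x theta_q(q x) vanishes or
    becomes negative for some x in [0, 1 / q], written in terms of t = q x. *)
Definition touching (R : realType) : set R :=
  [set q : R | 0 <= q <= 1/3 /\ exists2 t, 0 <= t <= 1 & q <= t * theta q t].

(** The extremal parameter, written l below; its reciprocal is the limit of
    the m_i. *)
Definition lamstar : R := sup (@touching R).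

(** Upper bound for the extremal parameter: t theta_q(t) is at most the degree 5
    truncation, which stays below q when q >= 13/42. *)
Lemma theta_lt_of_ge t q : 0 <= t <= 1 -> 13/42 <= q <= 1/3 -> t * theta q t < q.
Proof.
move=> ht hq; have hq0 : 0 <= q <= 1/3 by lra.
set q0 : R := 13/42.
have hs : 0 <= q * (q * t) <= 1 by nra.
have h1 := theta_le_quadratic hq0 hs.
have t3 : 0 <= t ^+ 3 <= 1 by rewrite exprn_ge0 ?exprn_ile1 //; lra.
have t5 : 0 <= t ^+ 5 by rewrite exprn_ge0 //; lra.
have t54 : t ^+ 5 <= t ^+ 4.
  by rewrite exprS ler_piMl ?exprn_ge0 //; lra.
have h2 : t * theta q t <= t - t ^+ 2 + q * t ^+ 3 - q ^+ 3 * t ^+ 4 + q ^+ 6 * t ^+ 5.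
  rewrite theta_rec2 //.
  have -> : t * (1 - t + q * t ^+ 2 * theta q (q * (q * t))) =
    t - t ^+ 2 + (q * t ^+ 3) * theta q (q * (q * t)) by ring.
  have h : (q * t ^+ 3) * theta q (q * (q * t)) <=
    q * t ^+ 3 * (1 - q * (q * t) + q * (q * (q * t)) ^+ 2).
    by rewrite ler_wpM2l // mulr_ge0 //; lra.
  have -> : t - t ^+ 2 + q * t ^+ 3 - q ^+ 3 * t ^+ 4 + q ^+ 6 * t ^+ 5 =
    t - t ^+ 2 + q * t ^+ 3 * (1 - q * (q * t) + q * (q * (q * t)) ^+ 2) by ring.
  by rewrite lerD2l.
apply: le_lt_trans h2 _; rewrite -subr_gt0.
have mono : q0 * (1 - t^+3) + q0 ^+3 * t^+4 - q0 ^+6 * t^+5 <=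
     q * (1 - t^+3) + q^+3 * t^+4 - q^+6 * t^+5.
  have c0 : q0 ^+ 3 <= q ^+ 3 by rewrite lerXn2r // ?nnegrE /q0; lra.
  have c1 : q ^+ 3 <= 1/27.
    have -> : 1/27 = (1/3) ^+ 3 :> R by field.
    by rewrite lerXn2r // ?nnegrE; lra.
  have c2 : 0 <= q0 ^+ 3 by rewrite exprn_ge0 /q0; lra.
  have e : q ^+ 6 - q0^+6 = (q^+3 - q0^+3) * (q^+3+q0^+3) by ring.
  have c3 : q ^+ 6 - q0^+6 <= q^+3 - q0^+3.
    by rewrite e ler_piMr //; lra.
  have c4 : t^+5 * (q ^+ 6 - q0^+6) <= t^+4 * (q^+3 - q0^+3).
    apply: le_trans (_ : t^+5 * (q^+3 - q0^+3) <= _).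
      by rewrite ler_wpM2l.
    by rewrite ler_wpM2r //; lra.
  have c5 : q0 * (1 - t^+3) <= q * (1 - t^+3) by rewrite ler_wpM2r /q0; lra.
  lra.
have base : t - t^+2 < q0 * (1 - t^+3) + q0 ^+3 * t^+4 - q0 ^+6 * t^+5.
  have k : 23/800 <= q0 ^+ 3 - q0 ^+ 6.
    have -> : q0 ^+ 6 = q0 ^+ 3 * q0 ^+ 3 by ring.
    have : 51/1720 <= q0 ^+ 3 <= 3/101 by rewrite /q0; lra.
    by move: (q0 ^+ 3) => w; nra.
  have k2 : q0 ^+ 6 * t ^+ 5 <= q0 ^+ 6 * t ^+ 4.
    by rewrite ler_wpM2l // exprn_ge0 // /q0; lra.
  have t4 : 0 <= t ^+ 4 by rewrite exprn_ge0 //; lra.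
  have k3 : 23/800 * t ^+ 4 <= q0 ^+ 3 * t ^+ 4 - q0 ^+ 6 * t ^+ 4.
    by rewrite -mulrBl ler_wpM2r.
  have k4 : t - t ^+ 2 < q0 * (1 - t ^+ 3) + 23/800 * t ^+ 4.
    rewrite /q0; move: ht; clear => ht.
    (* the difference of the two sides is smallest near t = 5/7 *)
    have h1 : 0 <= (t - 5/7) ^+ 2 * (1 - t) by rewrite mulr_ge0 ?sqr_ge0 //; lra.
    have h2 : 0 <= ((t - 5/7) ^+ 2) ^+ 2 by rewrite sqr_ge0.
    have h3 : 0 <= (t - 5/7 - 1/200) ^+ 2 by rewrite sqr_ge0.
    have h4 : 0 <= (t - 5/7 - 1/250) ^+ 2 by rewrite sqr_ge0.
    lra.
  lra.
lra.
Qed.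

(** Lower bound for the extremal parameter, from the test point t = 5/7. *)
Lemma touching_1755 : (17/55 : R) \in @touching R.
Proof.
apply/mem_set; split; first lra.
exists (5/7); first lra.
have := @theta_ge_cubic R (17/55 * (17/55 * (5/7))) ; rewrite theta_rec2; last lra.
have := @theta_ge_cubic R (17/55) (17/55 * (17/55 * (5/7))).
move=> /(_ ltac:(lra) ltac:(lra)).
set T := theta _ _ => h _.
lra.
Qed.

Lemma touching_ub q : touching q -> q <= 13/42.
Proof.
move=> [hq [t ht hqt]]; rewrite leNgt; apply/negP => h.
have := @theta_lt_of_ge t q ht ltac:(lra); lra.
Qed.

Lemma lamstar_bounds : 17/55 <= lamstar <= 13/42.
Proof.
apply/andP; split.
  apply: ub_le_sup; last by apply/set_mem; exact: touching_1755.
  by exists (13/42) => q /touching_ub.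
by apply: ge_sup; [exists (17/55); apply/set_mem; exact: touching_1755|move=> q /touching_ub].
Qed.

Lemma lamstar13 : 0 <= lamstar <= 1/3.
Proof. have := lamstar_bounds; lra. Qed.

(** theta is Lipschitz in the variable, on [0, 1]. *)
Lemma theta_lipx q s s' : 0 <= q <= 1/3 -> 0 <= s <= 1 -> 0 <= s' <= 1 ->
  `|theta q s - theta q s'| <= `|s - s'|.
Proof.
move=> hq; wlog h : s s' / s <= s'.
  move=> W hs hs'; have [h|h] := leP s s'; first exact: W.
  by rewrite distrC [`|s - s'|]distrC; apply: W => //; exact: ltW.
move=> hs hs'; have /andP[s0 s1] := hs; have /andP[s0' s1'] := hs'.
have /andP[e1 e2] := theta_lip hq s0 h s1'.
have hy : 0 <= q * s' <= 1 by nra.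
have /andP[_ e3] := theta_bound hq hy.
rewrite ger0_norm // ler0_norm; last lra.
apply: le_trans e2 _; rewrite -[X in _ <= X]mulr1 opprB ler_wpM2l //; lra.
Qed.

Lemma theta_max q : 0 <= q <= 1/3 -> exists2 t0, 0 <= t0 <= 1 &
  forall t, 0 <= t <= 1 -> t * theta q t <= t0 * theta q t0.
Proof.
move=> hq.
have cf : {within `[0, 1], continuous (fun t : R => t * theta q t)}.
  apply/subspace_continuousP => x hx.
  have hx' : 0 <= x <= 1 by [].
  apply/cvgrPdist_le => e e0; rewrite near_withinE; near=> y => hy'.
  have hy : 0 <= y <= 1 by [].
  have hd : `|x - y| <= e / 2.
    near: y; apply: cvgr_dist_le; [exact: cvg_id|lra].
  rewrite /from_subspace /=.
  have -> : x * theta q x - y * theta q y = (x - y) * theta q x + y * (theta q x - theta q y) by ring.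
  apply: le_trans (ler_normD _ _) _; rewrite !normrM.
  have h1 := theta_lipx hq hx' hy.
  have /andP[b1 b2] := theta_bound hq hx'.
  have h2 : `|theta q x| <= 1 by rewrite ler_norml; lra.
  have h3 : `|y| <= 1 by rewrite ler_norml; lra.
  have n0 := normr_ge0 (x - y).
  have h4 : `|x - y| * `|theta q x| <= `|x - y| by rewrite ler_piMr.
  have h5 : `|y| * `|theta q x - theta q y| <= `|x - y| by apply: le_trans h1; rewrite ler_piMl.
  lra.
have [c hc hm] := EVT_max ler01 cf.
by exists c => // t ht; apply: hm.
Unshelve. all: by end_near.
Qed.

(** If t theta_l(t) exceeded l at some t, then a slightly larger parameter would
    still belong to [touching]. *)
Lemma lamstar_max t : 0 <= t <= 1 -> t * theta lamstar t <= lamstar.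
Proof.
move=> ht; rewrite leNgt; apply/negP => h.
have hl := lamstar_bounds.
pose e := Num.min (1/100) ((t * theta lamstar t - lamstar) / 4).
have e0 : 0 < e by rewrite /e lt_min; apply/andP; split; lra.
have e1 : e <= 1/100 by rewrite /e ge_min lexx.
have e2 : e <= (t * theta lamstar t - lamstar) / 4 by rewrite /e ge_min lexx orbT.
have hT : touching (lamstar + e).
  split; first lra.
  exists t => //.
  have /ler_normlP[_ h3] := @theta_lipq R lamstar (lamstar + e) t ltac:(lra) ltac:(lra) ht.
  have h4 : `|lamstar - (lamstar + e)| = e by rewrite opprD addrA subrr sub0r normrN ger0_norm // ltW.
  rewrite h4 in h3.
  have : t * (theta lamstar t - theta (lamstar + e) t) <= 2 * e by nra.
  nra.
have : lamstar + e <= lamstar.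
  by apply: ub_le_sup hT; exists (13/42) => q /touching_ub.
lra.
Qed.

(** The maximum of t theta_l(t) on [0, 1] equals l. *)
Lemma lamstar_attained : exists2 t0, 0 <= t0 <= 1 & t0 * theta lamstar t0 = lamstar.
Proof.
have hl := lamstar_bounds.
have [t0 ht0 hm] := theta_max lamstar13.
exists t0 => //; apply/eqP; rewrite eq_le lamstar_max // leNgt; apply/negP => h.
pose e := (lamstar - t0 * theta lamstar t0) / 4.
have e0 : 0 < e by rewrite /e; lra.
have hs : has_sup (@touching R).
  split; first by exists (17/55); apply/set_mem; exact: touching_1755.
  by exists (13/42) => q /touching_ub.
have [q qT hq] := sup_adherent e0 hs.
have [hq0 [t ht hqt]] := qT.
have hq1 : q <= lamstar by apply: ub_le_sup qT; exists (13/42) => q' /touching_ub.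
have h3 : `|theta q t - theta lamstar t| <= 2 * `|q - lamstar| by apply: theta_lipq => //; exact: lamstar13.
have h4 : `|q - lamstar| <= e by rewrite ler0_norm -/lamstar in hq *; lra.
have /ler_normlP[h5 h6] := h3.
have h7 := hm t ht.
have h8 : t * (theta q t - theta lamstar t) <= 2 * e by nra.
rewrite -/lamstar in hq.
have : e = (lamstar - t0 * theta lamstar t0) / 4 by [].
lra.
Qed.

End Extremal.

(** * The comparison theorem *)

Section Inequality.
Variable R : realType.
Implicit Types (l t e c P : R).

(** The lower bound used in [gain_main] for the gain is affine in e; this lemma gives
    its sign at e = 0.  The inequality involves t only and follows from a few
    nonnegative products. *)
Lemma gain_start t : 0 <= t <= 17/20 ->
  0 <= 2/23 * (1 - 2 * t)
     + (1 - 7/73 * t + t ^+ 2 / 370) * (3 * (17/55) * (2/23) * t ^+ 2 + 1/6 * t ^+ 3)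
     - t ^+ 3 * (13/42) * (1 - t / 35) * ((13/42) ^+ 2 * (2/23) + 13/42 * (7/6) * t) - 1/36.
Proof.
move=> ht.
have h1 : 0 <= (t - 5/7) ^+ 2 * (17/20 - t) by rewrite mulr_ge0 ?sqr_ge0 //; lra.
have h2 : 0 <= (t - 5/7) ^+ 2 * (17/20 - t) * t.
  by apply: mulr_ge0; [exact: h1|lra].
have h3 : 0 <= (t - 5/7) ^+ 2 by rewrite sqr_ge0.
have h4 : 0 <= (t - 5/7 - 1/40) ^+ 2 by rewrite sqr_ge0.
have h5 : 0 <= (t - 5/7) ^+ 2 * t ^+ 3 by rewrite mulr_ge0 ?sqr_ge0 ?exprn_ge0 //; lra.
lra.
Qed.

(** The sign of the same lower bound at the other end, e = 13/42. *)
Lemma gain_end t : 0 <= t <= 17/20 ->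
  0 <= 2/23 * (1 - 2 * t)
     + (1 - 7/73 * t + t ^+ 2 / 370) * (3 * (17/55) * (2/23) * t ^+ 2 + 1/6 * t ^+ 3)
     - t ^+ 3 * (13/42) * (1 - t / 35) * ((13/42) ^+ 2 * (2/23) + 13/42 * (7/6) * t) - 1/36
     + 13/42 * (- (2/23) ^+ 2 + 27/10 * (17/55) * (2/23) ^+ 2 * t
        - 7/73 * (2/23) * (3 * (17/55) * (2/23) * t ^+ 2 + 1/6 * t ^+ 3)
        + 13/42 * (1/6) * t ^+ 3 * (1 - t / 35) * (13/42 * (2/23) + 2 * t)).
Proof.
move=> ht.
have h1 : 0 <= (t - 1/2) ^+ 2 * (17/20 - t) by rewrite mulr_ge0 ?sqr_ge0 //; lra.
have h2 : 0 <= (t - 1/2) ^+ 2 * (17/20 - t) * t.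
  by apply: mulr_ge0; [exact: h1|lra].
have h3 : 0 <= (t - 1/2) ^+ 2 by rewrite sqr_ge0.
have h4 : 0 <= (t - 1/2 - 1/10) ^+ 2 by rewrite sqr_ge0.
have h5 : 0 <= t ^+ 5 by rewrite exprn_ge0 //; lra.
have h6 : 0 <= (t - 1/2) ^+ 2 * t by rewrite mulr_ge0 //; lra.
lra.
Qed.

(** Upper bound of the negative part of the gain in [gain_main] by an expression
    affine in e. *)
Lemma gain_negative_part l t e c (a := 2/23 : R) (L := 13/42 : R) :
  17/55 <= l <= L -> 0 <= t -> 0 <= e <= l -> l ^+ 2 <= L ^+ 2 -> 0 <= c -> c <= 1 - t / 35 ->
  t ^+ 3 * (l - e / 6) * c * (l ^+ 2 * a + t * (l * (7/6) - e / 6)) <=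
  t ^+ 3 * ((1 - t / 35) * (L * (L ^+ 2 * a + L * (7/6) * t - e / 6 * (L * a + 2 * t)))).
Proof.
move=> hl t0 /andP[e0 el] l2 c0 c1.
have te : 0 <= t * e by rewrite mulr_ge0.
have B1 : 0 <= l ^+ 2 * a + t * (l * (7/6) - e / 6).
  by rewrite addr_ge0 // mulr_ge0 ?sqr_ge0 /a //; lra.
have B2 : l ^+ 2 * a + t * (l * (7/6) - e / 6) <= L ^+ 2 * a + t * (L * (7/6) - e / 6).
  apply: lerD; first by rewrite ler_wpM2r /a //; lra.
  by rewrite ler_wpM2l //; lra.
have v0 : 0 <= l - e / 6 by lra.
have v1 : l - e / 6 <= L - e / 6 by lra.
have W1 : (l - e / 6) * (l ^+ 2 * a + t * (l * (7/6) - e / 6)) <=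
          (L - e / 6) * (L ^+ 2 * a + t * (L * (7/6) - e / 6)).
  by apply: ler_pM.
have W2 : (L - e / 6) * (L ^+ 2 * a + t * (L * (7/6) - e / 6)) <=
          L * (L ^+ 2 * a + L * (7/6) * t - e / 6 * (L * a + 2 * t)).
  have k1 : 0 <= t * e * (L - e) by rewrite mulr_ge0 // subr_ge0; lra.
  rewrite -subr_ge0.
  have -> : L * (L ^+ 2 * a + L * (7/6) * t - e / 6 * (L * a + 2 * t)) -
     (L - e / 6) * (L ^+ 2 * a + t * (L * (7/6) - e / 6)) =  t * e * (L - e) / 36 by field.
  by rewrite divr_ge0.
have W3 : 0 <= (l - e / 6) * (l ^+ 2 * a + t * (l * (7/6) - e / 6)) by rewrite mulr_ge0.
have -> : t ^+ 3 * (l - e / 6) * c * (l ^+ 2 * a + t * (l * (7/6) - e / 6)) =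
   t ^+ 3 * (c * ((l - e / 6) * (l ^+ 2 * a + t * (l * (7/6) - e / 6)))) by ring.
rewrite ler_wpM2l ?exprn_ge0 //.
by apply: ler_pM => //; exact: le_trans W1 W2.
Qed.

(** The decisive estimate: replacing t by t' = t + (2/23) e increases
    t (1 - t) + l t^3 P enough to compensate for the smaller parameter l - e / 6
    and the smaller argument, with e / 36 to spare.  Here P stands for theta_l(s),
    c for theta_l(l s), the Lipschitz constant at s, and e / 6 for the deficit. *)
Lemma gain_main l t e c P (a := 2/23 : R) (t' := t + a * e) (s := l ^+ 2 * t') :
  17/55 <= l <= 13/42 -> 0 <= t <= 17/20 -> 0 <= e <= l ->
  1 - s + 3/10 * s ^+ 2 <= P -> P <= 1 -> 0 <= c <= 1 - 3/10 * s ->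
  t * (1 - t) + t ^+ 3 * (l - e / 6) * (P + c * (s - (l - e/6) * (l - e) * t)) + e / 36
    <= t' * (1 - t') + t' ^+ 3 * l * P.
Proof.
move=> hl ht he hP hP1 hc.
have l2 : 2/21 <= l ^+ 2 <= 7/73 by nra.
have l2' : l ^+ 2 <= (13/42) ^+ 2 by nra.
have hs0 : 2/21 * t <= s.
  by rewrite /s /t' /a; nra.
have hs1 : s <= 7/73 * (t + a * e).
  by rewrite /s /t' ler_wpM2r //; [rewrite /a; nra|lra].
have hsq : t ^+ 2 / 370 <= 3/10 * s ^+ 2.
  have : (2/21 * t) ^+ 2 <= s ^+ 2 by rewrite lerXn2r // ?nnegrE; nra.
  have : 0 <= t ^+ 2 by rewrite sqr_ge0.
  lra.
have hPlow : 1 - 7/73 * (t + a * e) + t ^+ 2 / 370 <= P by move: hsq hs1 hP; clear; lra.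
have hc1 : c <= 1 - t / 35 by move: hc hs0; clear; lra.
(* the gain divided by e *)
pose G := a * (1 - 2 * t - a * e)
  + P * (l * (3 * t ^+ 2 * a + 3 * t * a ^+ 2 * e + a ^+ 3 * e ^+ 2) + t ^+ 3 / 6)
  - t ^+ 3 * (l - e / 6) * c * (l ^+ 2 * a + t * (l * (7/6) - e / 6)) - 1/36.
rewrite -subr_ge0.
have -> : t' * (1 - t') + t' ^+ 3 * l * P -
  (t * (1 - t) + t ^+ 3 * (l - e / 6) * (P + c * (s - (l - e / 6) * (l - e) * t)) + e / 36) = e * G.
  by rewrite /G /s /t'; field.
apply: mulr_ge0; first by case/andP: he.
have t0 : 0 <= t by case/andP: ht.
have e0 : 0 <= e by case/andP: he.
have t2 : 0 <= t ^+ 2 by rewrite sqr_ge0.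
have t3 : 0 <= t ^+ 3 by rewrite exprn_ge0.
have te : 0 <= t * e by rewrite mulr_ge0.
(* lower bound of the positive part *)
pose A := 3 * (17/55) * a * t ^+ 2 + 1/6 * t ^+ 3.
have A0 : 0 <= A by rewrite /A /a; move: t2 t3; clear; lra.
have hA : A + 3 * (17/55) * a ^+ 2 * (t * e) <=
   l * (3 * t ^+ 2 * a + 3 * t * a ^+ 2 * e + a ^+ 3 * e ^+ 2) + t ^+ 3 / 6.
  have k1 : 17/55 * (3 * t ^+ 2 * a + 3 * t * a ^+ 2 * e) <= l * (3 * t ^+ 2 * a + 3 * t * a ^+ 2 * e).
    by rewrite ler_wpM2r /a //; move: t2 te hl; clear; lra.
  have k2 : 0 <= l * (a ^+ 3 * e ^+ 2) by rewrite mulr_ge0 ?mulr_ge0 ?sqr_ge0 ?exprn_ge0 /a //; clear -hl; lra.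
  by rewrite /A; move: k1 k2; clear; lra.
have P9 : 9/10 <= P by move: hPlow t2 he hl ht; rewrite /a; clear; lra.
have pos : (1 - 7/73 * t + t ^+ 2 / 370) * A + e * (27/10 * (17/55) * a ^+ 2 * t - 7/73 * a * A) <=
  P * (l * (3 * t ^+ 2 * a + 3 * t * a ^+ 2 * e + a ^+ 3 * e ^+ 2) + t ^+ 3 / 6).
  apply: le_trans (_ : P * (A + 3 * (17/55) * a ^+ 2 * (t * e)) <= _); last first.
    by rewrite ler_wpM2l //; clear -P9; lra.
  have k1 : (1 - 7/73 * (t + a * e) + t ^+ 2 / 370) * A <= P * A by rewrite ler_wpM2r.
  have k2 : 9/10 * (3 * (17/55) * a ^+ 2 * (t * e)) <= P * (3 * (17/55) * a ^+ 2 * (t * e)).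
    by rewrite ler_wpM2r // /a; clear -te; lra.
  by move: k1 k2; clear; lra.
(* upper bound of the negative part *)
pose L : R := 13/42.
have neg := gain_negative_part hl t0 he l2' (andP hc).1 hc1.
have hE : e / L <= 1 by rewrite ler_pdivrMr /L; move: he hl; clear; lra.
have hE0 : 0 <= e / L by rewrite divr_ge0 // /L; clear; lra.
have i0 := gain_start ht; have i1 := gain_end ht.
pose g0 := 2/23 * (1 - 2 * t)
     + (1 - 7/73 * t + t ^+ 2 / 370) * (3 * (17/55) * (2/23) * t ^+ 2 + 1/6 * t ^+ 3)
     - t ^+ 3 * (13/42) * (1 - t / 35) * ((13/42) ^+ 2 * (2/23) + 13/42 * (7/6) * t) - 1/36.
pose g1 := - (2/23) ^+ 2 + 27/10 * (17/55) * (2/23) ^+ 2 * t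
        - 7/73 * (2/23) * (3 * (17/55) * (2/23) * t ^+ 2 + 1/6 * t ^+ 3)
        + 13/42 * (1/6) * t ^+ 3 * (1 - t / 35) * (13/42 * (2/23) + 2 * t).
(* interpolate between the cases e = 0 and e = L *)
have k0 : 0 <= (1 - e / L) * g0 by rewrite mulr_ge0 // subr_ge0.
have k1 : 0 <= (e / L) * (g0 + 13/42 * g1) by rewrite mulr_ge0.
have k : 0 <= g0 + e * g1.
  have <- : (1 - e / L) * g0 + (e / L) * (g0 + 13/42 * g1) = g0 + e * g1 by rewrite /L; field.
  exact: addr_ge0.
apply: le_trans k _.
apply: le_trans (_ : a * (1 - 2 * t - a * e)
  + ((1 - 7/73 * t + t ^+ 2 / 370) * A + e * (27/10 * (17/55) * a ^+ 2 * t - 7/73 * a * A))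
  - t ^+ 3 * ((1 - t / 35) * (L * (L ^+ 2 * a + L * (7/6) * t - e / 6 * (L * a + 2 * t)))) - 1/36 <= _).
  by rewrite le_eqVlt; apply/orP; left; apply/eqP; rewrite /g0 /g1 /A /L /a; field.
by rewrite /G; move: pos neg; rewrite -/a -/L; clear; lra.
Qed.

End Inequality.

Section Comparison.
Variable R : realType.
Implicit Types (t d : R) (lam : nat -> R).
Local Notation l := (lamstar R).
Local Notation F := (theta (lamstar R)).

(** The extreme case d = l / 6 of the comparison step. *)
Lemma far_case t : 0 <= t <= 1 -> t * (1 - t) + t ^+ 3 * (5/6 * l) <= 35/36 * l.
Proof.
move=> ht; have hl := lamstar_bounds R.
have t3 : 0 <= t ^+ 3 <= 1 by rewrite exprn_ge0 ?exprn_ile1 //; lra.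
have h : 17/55 * (35/36 - 5/6 * t ^+ 3) <= l * (35/36 - 5/6 * t ^+ 3).
  by rewrite ler_wpM2r //; lra.
have h1 : 0 <= (t - 2/3) ^+ 2 * (1 - t) by rewrite mulr_ge0 ?sqr_ge0 //; lra.
have h2 : 0 <= (t - 2/3) ^+ 2 by rewrite sqr_ge0.
have h3 : 0 <= (t - 7/10) ^+ 2 by rewrite sqr_ge0.
have : t * (1 - t) <= 17/55 * (35/36 - 5/6 * t ^+ 3) by move: h1 h2 h3; clear; lra.
move: h; clear; lra.
Qed.

Lemma near_one_case t : 17/20 <= t <= 1 -> 1/36 <= t ^+ 3 * (1/6 - 4/3 * (7/73) * t).
Proof.
move=> ht.
have h1 : 0 <= (1 - t) * (t - 17/20) by rewrite mulr_ge0 //; lra.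
have h2 : 0 <= (1 - t) * (t - 17/20) * t by rewrite mulr_ge0 //; lra.
have h3 : 0 <= (1 - t) * (t - 17/20) * t ^+ 2 by rewrite mulr_ge0 ?sqr_ge0.
lra.
Qed.

(** The comparison step for two consecutive deficits d2 and d: as d2 <= 6 d, the
    maximum of t R(t) for the next polynomial has deficit at least d / 6.  For
    d >= l / 6 the bound theta <= 1 suffices; otherwise t is moved to the right
    by (2/23) 6 d ([gain_main]), or kept when it is larger than 17/20. *)
Lemma step_max t d d2 : 0 <= t <= 1 -> 0 <= d <= l -> 0 <= d2 <= l -> d2 <= 6 * d ->
  t * (1 - t) + t ^+ 3 * ((l - d) * F ((l - d2) * ((l - d) * t))) <= l - d / 6.
Proof.
move=> ht hd hd2 h6.
have hl := lamstar_bounds R; have hl3 := lamstar13 R.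
have t0 : 0 <= t by lra.
have t3 : 0 <= t ^+ 3 by rewrite exprn_ge0.
have t31 : t ^+ 3 <= 1 by rewrite exprn_ile1 //; lra.
have dt : 0 <= (l - d) * t <= 1/3 by apply/andP; split; nra.
have ddt : 0 <= (l - d2) * ((l - d) * t) <= 1 by apply/andP; split; nra.
have [far|near] := leP (l / 6) d.
  have h1 : t ^+ 3 * ((l - d) * F ((l - d2) * ((l - d) * t))) <= t ^+ 3 * (l - d).
    rewrite ler_wpM2l // ler_piMr //; first lra.
    by have /andP[] := theta_bound hl3 ddt.
  apply: le_trans (_ : t * (1 - t) + t ^+ 3 * (l - d) <= _); first by rewrite lerD2l.
  have X1 := far_case ht.
  have X2 : t * (1 - t) <= l - l / 6.
    have : 0 <= (t - 1/2) ^+ 2 by rewrite sqr_ge0.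
    by move: hl; clear; lra.
  have Y1 : (l - d) * (t * (1 - t) + t ^+ 3 * (5/6 * l)) <= (l - d) * (35/36 * l).
    by rewrite ler_wpM2l //; lra.
  have Y2 : (d - l / 6) * (t * (1 - t)) <= (d - l / 6) * (l - l / 6).
    by rewrite ler_wpM2l //; lra.
  have Y3 : (5/6 * l) * (t * (1 - t) + t ^+ 3 * (l - d)) <= (5/6 * l) * (l - d / 6).
    by move: Y1 Y2; clear; lra.
  by rewrite ler_pM2l in Y3 => //; lra.
pose e := 6 * d.
have de : d = e / 6 by rewrite /e; field.
have he : 0 <= e <= l by rewrite /e; lra.
have l2 : l ^+ 2 <= 7/73 by clear -hl; nra.
pose s1 := (l - e / 6) * (l - e) * t.
have s10 : 0 <= s1 by rewrite /s1 !mulr_ge0 //; clear -he; lra.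
have mono : F ((l - d2) * ((l - d) * t)) <= F s1.
  have ds : s1 <= (l - d2) * ((l - d) * t).
    rewrite /s1 -de; have -> : (l - d) * (l - e) * t = (l - e) * ((l - d) * t) by ring.
    by rewrite ler_wpM2r //; [case/andP: dt|rewrite /e; clear -h6; lra].
  have /andP[] := theta_lip hl3 s10 ds (andP ddt).2; clear; lra.
have v0 : 0 <= l - e / 6 by clear -he; lra.
have [tl|tl] := leP t (17/20).
  pose t' := t + 2/23 * e.
  pose s := l ^+ 2 * t'.
  have ht' : 0 <= t' <= 1 by rewrite /t'; clear -tl t0 he hl; lra.
  have hs : 0 <= s <= 1/10.
    rewrite /s; apply/andP; split; first by rewrite mulr_ge0 ?sqr_ge0 //; case/andP: ht'.
    by move: l2 ht'; have := sqr_ge0 l; clear; nra.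
  have ss1 : s1 <= s.
    rewrite /s1 /s expr2; apply: ler_pM; [by rewrite mulr_ge0 //; clear -he; lra|exact: t0| |by rewrite /t'; clear -he; lra].
    by apply: ler_pM; clear -he hl; lra.
  have ls : 0 <= l * s <= 1 by clear -hl hs; nra.
  have P1 : 1 - s + 3/10 * s ^+ 2 <= F s.
    have := @theta_ge_cubic R l s hl3 ltac:(clear -hs; lra).
    have s2 : 0 <= s ^+ 2 by rewrite sqr_ge0.
    have : 3/10 * s ^+ 2 <= l * s ^+ 2 * (1 - l ^+ 2 * s).
      have -> : l * s ^+ 2 * (1 - l ^+ 2 * s) = (l * (1 - l ^+ 2 * s)) * s ^+ 2 by ring.
      rewrite ler_wpM2r //.
      have k : 98/100 <= 1 - l ^+ 2 * s by clear -l2 hs; have := sqr_ge0 l; nra.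
      by clear -k hl; nra.
    by clear; lra.
  have /andP[_ P2] := @theta_bound R l s hl3 ltac:(clear -hs; lra).
  have /andP[c0 _] := @theta_bound R l (l * s) hl3 ls.
  have c1 : F (l * s) <= 1 - 3/10 * s.
    have := @theta_le_quadratic R l (l * s) hl3 ls.
    have : l * (l * s) ^+ 2 <= (l - 3/10) * s.
      have -> : l * (l * s) ^+ 2 = (l * l ^+ 2 * s) * s by ring.
      rewrite ler_wpM2r //; first by case/andP: hs.
      have k : l ^+ 2 * s <= 7/730 by clear -l2 hs; have := sqr_ge0 l; nra.
      have k0 : 0 <= l ^+ 2 * s by rewrite mulr_ge0 ?sqr_ge0 //; case/andP: hs.
      by clear -k k0 hl; rewrite -mulrA; nra.
    by clear; lra.
  have c00 : 0 <= F (l * s) by clear -c0 ls; lra.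
  have /andP[_ L2] := theta_lip hl3 s10 ss1 (ltac:(clear -hs; lra) : s <= 1).
  have M := @gain_main R l t e (F (l * s)) (F s) hl (ltac:(clear -t0 tl; lra) : 0 <= t <= 17/20) he P1 P2
    (ltac:(clear -c00 c1; lra) : 0 <= F (l * s) <= 1 - 3/10 * s).
  have T := lamstar_max ht'.
  have T2 : t' * F t' = t' * (1 - t') + t' ^+ 3 * l * F s.
    by rewrite (theta_rec2 _ hl3) /s (_ : l * (l * t') = l ^+ 2 * t'); ring.
  rewrite T2 in T.
  have Z : t ^+ 3 * ((l - d) * F ((l - d2) * ((l - d) * t))) <=
     t ^+ 3 * (l - e / 6) * (F s + F (l * s) * (s - s1)).
    rewrite -de -mulrA ler_wpM2l // ler_wpM2l //; first by clear -hd; lra.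
    by apply: le_trans mono _; move: L2; clear; lra.
  have -> : d / 6 = e / 36 by rewrite /e; field.
  by move: M T Z; rewrite -/t' -/s -/s1; clear; lra.
pose s := l ^+ 2 * t.
have hs : 0 <= s <= 1/10.
  rewrite /s; apply/andP; split; first by rewrite mulr_ge0 ?sqr_ge0.
  by move: l2 ht; have := sqr_ge0 l; clear; nra.
have ss1 : s1 <= s.
  rewrite /s1 /s expr2; apply: ler_pM => //; first by rewrite mulr_ge0 //; clear -he; lra.
  by apply: ler_pM; clear -he hl; lra.
have /andP[P1 _] := @theta_bound R l s hl3 ltac:(clear -hs; lra).
have ls : 0 <= l * s <= 1 by clear -hl hs; nra.
have /andP[_ c1] := @theta_bound R l (l * s) hl3 ls.
have /andP[_ L2] := theta_lip hl3 s10 ss1 (ltac:(clear -hs; lra) : s <= 1).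
have L3 : F s1 <= F s + (s - s1).
  have : (s - s1) * F (l * s) <= (s - s1) by rewrite ler_piMr //; clear -ss1; lra.
  by move: L2; clear; lra.
have T := lamstar_max ht.
have T2 : t * F t = t * (1 - t) + t ^+ 3 * l * F s.
  by rewrite (theta_rec2 _ hl3) /s (_ : l * (l * t) = l ^+ 2 * t); ring.
rewrite T2 in T.
have Z : t ^+ 3 * ((l - d) * F ((l - d2) * ((l - d) * t))) <=
     t ^+ 3 * ((l - e / 6) * (F s + (s - s1))).
  rewrite -de ler_wpM2l // ler_wpM2l //; first by clear -hd; lra.
  exact: le_trans mono L3.
have sd : s - s1 <= t * e * (7/6 * l).
  rewrite /s /s1 -subr_ge0.
  have -> : t * e * (7 / 6 * l) - (l ^+ 2 * t - (l - e / 6) * (l - e) * t) = t * e ^+ 2 / 6 by field.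
  by rewrite divr_ge0 // mulr_ge0 ?sqr_ge0.
have N := @near_one_case t (ltac:(clear -tl ht; lra) : 17/20 <= t <= 1).
have K : e / 36 <= t ^+ 3 * (l * F s - (l - e / 6) * (F s + (s - s1))).
  have K1 : (l - e / 6) * (s - s1) <= l * (t * e * (7/6 * l)).
    by apply: ler_pM => //; clear -ss1 he; lra.
  have K2 : e * (1/6 - 4/3 * (7/73) * t) <= l * F s - (l - e / 6) * (F s + (s - s1)).
    have -> : l * F s - (l - e / 6) * (F s + (s - s1)) = e / 6 * F s - (l - e / 6) * (s - s1) by field.
    have K3 : e / 6 * (1 - s) <= e / 6 * F s by rewrite ler_wpM2l //; clear -he; lra.
    have K4 : e * t * l ^+ 2 <= e * t * (7/73) by rewrite ler_wpM2l // mulr_ge0 //; clear -he; lra.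
    move: K1 K3; rewrite /s; move: K4; clear; lra.
  have K5 : t ^+ 3 * (e * (1/6 - 4/3 * (7/73) * t)) <= t ^+ 3 * (l * F s - (l - e / 6) * (F s + (s - s1))).
    by rewrite ler_wpM2l.
  apply: le_trans K5.
  have -> : t ^+ 3 * (e * (1/6 - 4/3 * (7/73) * t)) = e * (t ^+ 3 * (1/6 - 4/3 * (7/73) * t)) by ring.
  by have : e * (1/36) <= e * (t ^+ 3 * (1/6 - 4/3 * (7/73) * t)); [rewrite ler_wpM2l //; clear -he; lra|clear; lra].
have -> : d / 6 = e / 36 by rewrite /e; field.
by move: K Z T; clear; lra.
Qed.

(** The polynomial bound is monotone in the deficits. *)
Lemma step_le t d d2 : 0 <= t <= 1 -> 0 <= d <= l -> 0 <= d2 <= l -> d2 <= 6 * d ->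
  (l - d) * F ((l - d2) * ((l - d) * t)) <= l * F (l * (l * t)).
Proof.
move=> ht hd hd2 h6.
have hl := lamstar_bounds R; have hl3 := lamstar13 R.
have dt : 0 <= (l - d) * t <= 1/3 by apply/andP; split; nra.
have s0 : 0 <= (l - d2) * ((l - d) * t) by rewrite mulr_ge0 //; lra.
have llt : 0 <= l * (l * t) <= 7/73 by apply/andP; split; nra.
have ss : (l - d2) * ((l - d) * t) <= l * (l * t).
  by apply: ler_pM; [clear -hd2; lra|by case/andP: dt|clear -hd2; lra|rewrite ler_wpM2r //; clear -ht hd; lra].
have /andP[_ L2] := theta_lip hl3 s0 ss (ltac:(lra) : l * (l * t) <= 1).
have ls : 0 <= l * (l * (l * t)) <= 1 by clear -llt hl; nra.
have /andP[_ c1] := @theta_bound R l _ hl3 ls.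
have /andP[P1 _] := @theta_bound R l (l * (l * t)) hl3 ltac:(lra).
set s := (l - d2) * ((l - d) * t) in s0 ss L2 *; set s' := l * (l * t) in llt ss L2 P1 *.
have L3 : F s <= F s' + (s' - s).
  have : (s' - s) * F (l * s') <= (s' - s) by rewrite ler_piMr //; lra.
  lra.
have d1 : (l - d) * F s <= (l - d) * (F s' + (s' - s)) by rewrite ler_wpM2l //; lra.
have d3 : d * (1 - 7/73) <= d * F s' by rewrite ler_wpM2l //; lra.
have d4 : s' - s <= l * (d + d2).
  have -> : s' - s = (l * d + d2 * (l - d)) * t by rewrite /s /s'; ring.
  have : (l * d + d2 * (l - d)) * t <= l * d + d2 * (l - d).
    by rewrite ler_piMr // ?addr_ge0 ?mulr_ge0 //; clear -ht hd hd2 hl; lra.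
  have : d2 * (l - d) <= d2 * l by rewrite ler_wpM2l //; clear -hd hd2; lra.
  by clear; lra.
have d5 : (l - d) * (s' - s) <= l * (l * (d + d2)) by apply: ler_pM => //; clear -hd ss; lra.
have d6 : l * (l * (d + d2)) <= 7/73 * (d + d2).
  have l2 : l ^+ 2 <= 7/73 by clear -hl; nra.
  by rewrite mulrA -expr2 ler_wpM2r //; lra.
by move: d1 d3 d5 d6 h6 hd; clear; lra.
Qed.

(** If every ratio can be reached by its predecessors, that is, if
    lam_(i+1) <= max t R_(i+1)(t) on [0, 1], then no ratio exceeds l.  The
    recursive bound on consecutive deficits is what makes the induction work. *)
Theorem comparison lam : lam 0%N = 0 -> (forall i, 0 <= lam i <= 1/3) ->
  (forall i, exists2 t, 0 <= t <= 1 & lam i.+1 <= t * (Rp lam i.+1).[t]) ->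
  forall i, [/\ lam i <= l, lam i.+1 <= l, l - lam i <= 6 * (l - lam i.+1),
     forall t, 0 <= t <= 1 -> (Rp lam i).[lam i * t] <= F (lam i * t) &
     forall t, 0 <= t <= 1 -> (Rp lam i.+1).[t] <= F t].
Proof.
move=> lam0 lam13 lamP.
have hl := lamstar_bounds R; have hl3 := lamstar13 R.
elim=> [|i [h1 h2 h3 h4 h5]].
  have h1 : lam 1%N <= 1/4.
    have [t ht] := lamP 0%N; rewrite RpS Rp0 => h.
    have := sqr_ge0 (t - 1/2); lra.
  split; rewrite ?lam0; try lra.
    move=> t ht; rewrite Rp0 mul0r.
    by have /andP[+ _] := @theta_bound R l 0 hl3 ltac:(lra); rewrite subr0.
  move=> t ht; rewrite RpS Rp0 mulr1; have /andP[] := @theta_bound R l t hl3 ht; lra.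
have hi := lam13 i; have hi1 := lam13 i.+1.
pose d := l - lam i.+1; pose d2 := l - lam i.
have ed : lam i.+1 = l - d by rewrite /d; lra.
have ed2 : lam i = l - d2 by rewrite /d2; lra.
have hd : 0 <= d <= l by rewrite /d; lra.
have hd2 : 0 <= d2 <= l by rewrite /d2; lra.
have h6 : d2 <= 6 * d by [].
have key t : 0 <= t <= 1 -> (Rp lam i.+2).[t] <=
   1 - t + t ^+ 2 * ((l - d) * F ((l - d2) * ((l - d) * t))).
  move=> ht; rewrite RpS RpS.
  have hx : 0 <= lam i.+1 * t <= 1 by nra.
  have := h4 _ hx; rewrite -ed -ed2.
  set A := (Rp lam i).[_]; set B := F _ => AB.
  have : (t * (lam i.+1 * t)) * A <= (t * (lam i.+1 * t)) * B by rewrite ler_wpM2l // mulr_ge0 //; lra.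
  by clear; lra.
have hlast t : 0 <= t <= 1 -> (Rp lam i.+2).[t] <= F t.
  move=> ht; apply: le_trans (key t ht) _; rewrite (theta_rec2 t hl3) lerD2l.
  have := step_le ht hd hd2 h6; move=> h.
  have : t ^+ 2 * ((l - d) * F ((l - d2) * ((l - d) * t))) <= t ^+ 2 * (l * F (l * (l * t))).
    by rewrite ler_wpM2l ?sqr_ge0.
  by clear; lra.
have [t ht hlam] := lamP i.+1.
have hS : lam i.+2 <= l - d / 6.
  apply: le_trans hlam _; apply: le_trans (step_max ht hd hd2 h6).
  have : t * (Rp lam i.+2).[t] <= t * (1 - t + t ^+ 2 * ((l - d) * F ((l - d2) * ((l - d) * t)))).
    by rewrite ler_wpM2l ?key //; lra.
  by clear; lra.
split => //; [by lra|by rewrite -/d; lra|].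
by move=> t1 ht1; apply: h5; nra.
Qed.

End Comparison.

(** * Real-rooted polynomials and reversal *)

Section PowerSums.
Variable R : realType.
Implicit Types (f : {poly R}) (ys : seq R).

Lemma ceval_toC f x : ceval f (toC x) = toC f.[x].
Proof. by rewrite /ceval horner_map. Qed.

Lemma cevalM f g (z : cplx R) : ceval (f * g) z = ceval f z * ceval g z.
Proof. by rewrite /ceval rmorphM hornerM. Qed.

Lemma cevalZ (c : R) f (z : cplx R) : ceval (c *: f) z = toC c * ceval f z.
Proof. by rewrite /ceval map_polyZ hornerZ. Qed.

Lemma ceval_XsubC (r : R) (z : cplx R) : ceval ('X - r%:P) z = z - toC r.
Proof. by rewrite /ceval rmorphB /= map_polyX map_polyC !hornerE. Qed.

Lemma ceval_scale f (a : R) (z : cplx R) : ceval (f \Po (a *: 'X)) z = ceval f (toC a * z).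
Proof.
rewrite /ceval map_comp_poly map_polyZ /= map_polyX.
by rewrite horner_comp !hornerE.
Qed.

Lemma real_toC (z : cplx R) : z \is Num.real -> exists x, z = toC x.
Proof. by move=> /complex_realP[x ->]; exists x. Qed.

Lemma toC_eq0 (x : R) : (toC x == 0) = (x == 0).
Proof. exact: fmorph_eq0. Qed.

Lemma toC_inj : injective (@toC R).
Proof. exact: fmorph_inj. Qed.

(** Newton's identities for the first three power sums of the reciprocals of the
    roots. *)
Lemma power_sums3 ys (f := \prod_(y <- ys) (1 - y *: 'X)) :
  [/\ f`_0 = 1, \sum_(y <- ys) y = - f`_1,
     \sum_(y <- ys) y ^+ 2 = f`_1 ^+ 2 - 2 * f`_2 &
     \sum_(y <- ys) y ^+ 3 = - f`_1 ^+ 3 + 3 * f`_1 * f`_2 - 3 * f`_3].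
Proof.
rewrite /f {f}; elim: ys => [|y ys [h0 h1 h2 h3]].
  by rewrite !big_nil !coef1 /=; split => //; ring.
rewrite !big_cons; set g := \prod_(j <- ys) _ in h0 h1 h2 h3 *.
have eS n : ((1 - y *: 'X) * g)`_n.+1 = g`_n.+1 - y * g`_n.
  by rewrite mulrBl mul1r coefB -scalerAl coefZ coefXM.
have e0 : ((1 - y *: 'X) * g)`_0 = g`_0.
  by rewrite mulrBl mul1r coefB -scalerAl coefZ coefXM mulr0 subr0.
by rewrite e0 !eS h0 h1 h2 h3; split => //; ring.
Qed.

(** Factorisation of a real-rooted polynomial with constant term 1 over its
    reciprocal roots. *)
Lemma hyperbolic_factor f : hyperbolic f -> f`_0 = 1 ->
  exists ys, f = \prod_(y <- ys) (1 - y *: 'X).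
Proof.
move=> hf f0.
have fn0 : f != 0 by apply: contra_eq_neq f0 => ->; rewrite coef0 eq_sym oner_eq0.
have [r er] := closed_field_poly_normal (map_poly (@toC R) f).
have lc0 : lead_coef (map_poly (@toC R) f) != 0.
  by rewrite lead_coef_eq0 map_poly_eq0.
have rr z : z \in r -> exists2 x, z = toC x & x != 0.
  move=> zr; have hz : ceval f z = 0.
    apply/eqP; rewrite /ceval er hornerZ mulf_eq0; apply/orP; right.
    by rewrite -rootE root_prod_XsubC.
  have [x ex] := real_toC (hf _ hz); exists x => //.
  apply/eqP => x0; move: hz; rewrite ex ceval_toC x0 horner_coef0 f0.
  by move/eqP; rewrite toC_eq0 oner_eq0.
have [ys eys] : exists ys, all (fun y => y != 0) ys /\ r = [seq toC y^-1 | y <- ys].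
  elim: r rr {er} => [|z r IH] rr; first by exists [::].
  have [x -> x0] := rr z (mem_head _ _).
  have [|ys [h ->]] := IH; first by move=> w wr; apply: rr; rewrite inE wr orbT.
  by exists (x^-1 :: ys); rewrite /= invr_eq0 x0 h invrK.
case: eys => hys eys.
exists ys; apply: (map_poly_inj (@toC R)).
have e2 : map_poly (@toC R) f = (lead_coef (map_poly (@toC R) f) * \prod_(y <- ys) toC (- y^-1)) *:
    map_poly (@toC R) (\prod_(y <- ys) (1 - y *: 'X)).
  rewrite {1}er eys big_map -scalerA; congr (_ *: _).
  rewrite rmorph_prod /=.
  elim: ys hys {eys} => [|y ys IH] /=; first by rewrite !big_nil scale1r.
  case/andP=> y0 hys; rewrite !big_cons IH //.
  have -> : 'X - (toC y^-1)%:P = toC (- y^-1) *: map_poly (@toC R) (1 - y *: 'X).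
    rewrite rmorphB rmorph1 /= map_polyZ /= map_polyX scalerBr scalerA -rmorphM mulNr mulVf //.
    by rewrite !rmorphN rmorph1 scaleN1r opprK scaleNr alg_polyC addrC.
  by rewrite -scalerAl -scalerAr scalerA.
rewrite e2; set c := _ * _; suff -> : c = 1 by rewrite scale1r.
have := congr1 (fun p : {poly cplx R} => p`_0) e2; rewrite coefZ !coef_map /= f0 rmorph1.
have -> : (\prod_(y <- ys) (1 - y *: 'X))`_0 = 1.
  by have [-> _ _ _] := power_sums3 ys.
by rewrite rmorph1 mulr1 => h; rewrite /c -h.
Qed.

(** For a real-rooted polynomial 1 - c1 x + c2 x^2 - c3 x^3 + ... with positive
    roots, the power sums p1, p2, p3 of the reciprocals of the roots satisfy
    p2^2 <= p1 p3, and the smallest root is at most p1 / p2. *)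
Lemma hyperbolic_low_coef f (c1 := - f`_1) (c2 := f`_2) (c3 := - f`_3) :
  hyperbolic f -> f`_0 = 1 -> (forall x, x <= 0 -> f.[x] != 0) -> 0 < c1 ->
  (c1 ^+ 2 - 2 * c2) ^+ 2 <= c1 * (c1 ^+ 3 - 3 * c1 * c2 + 3 * c3) /\
  (0 < c1 ^+ 2 - 2 * c2 -> exists2 x, f.[x] = 0 & 0 < x /\ x * (c1 ^+ 2 - 2 * c2) <= c1).
Proof.
move=> hf f0 fpos c10.
have [ys ef] := hyperbolic_factor hf f0.
have [_ s1 s2 s3] := power_sums3 ys; rewrite -ef in s1 s2 s3.
have fy y : y \in ys -> y != 0 -> f.[y^-1] = 0.
  move=> yys y0; rewrite ef horner_prod; apply/eqP; rewrite prodf_seq_eq0.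
  by apply/hasP; exists y => //=; rewrite !hornerE mulfV // subrr.
have ypos y : y \in ys -> 0 <= y.
  move=> yys; rewrite leNgt; apply/negP => y0.
  have := fy y yys (negbT (lt_eqF y0)); apply/eqP/fpos.
  by rewrite invr_le0 ltW.
set p1 := \sum_(y <- ys) y in s1.
set p2 := \sum_(y <- ys) y ^+ 2 in s2.
set p3 := \sum_(y <- ys) y ^+ 3 in s3.
have e1 : c1 = p1 by rewrite s1.
have e2 : c1 ^+ 2 - 2 * c2 = p2 by rewrite s2 /c1 /c2; ring.
have e3 : c1 ^+ 3 - 3 * c1 * c2 + 3 * c3 = p3 by rewrite s3 /c1 /c2 /c3; ring.
rewrite e2 e3 e1; rewrite e1 in c10; split.
  (* Cauchy-Schwarz for the weights y *)
  have : 0 <= \sum_(y <- ys) y * (p2 - p1 * y) ^+ 2.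
    by rewrite big_seq sumr_ge0 // => y /ypos y0; rewrite mulr_ge0 ?sqr_ge0.
  have -> : \sum_(y <- ys) y * (p2 - p1 * y) ^+ 2 = p1 * (p1 * p3 - p2 ^+ 2).
    have -> : p1 * (p1 * p3 - p2 ^+ 2) = p2 ^+ 2 * p1 - (2 * p1 * p2) * p2 + p1 ^+ 2 * p3 by ring.
    have gen a b : \sum_(y <- ys) y * (b - a * y) ^+ 2 = b ^+ 2 * p1 - 2 * a * b * p2 + a ^+ 2 * p3.
      by rewrite /p1 /p2 /p3 !mulr_sumr -sumrB -big_split /=; apply: eq_bigr => y _; ring.
    exact: gen.
  by rewrite pmulr_rge0 // subr_ge0.
move=> p20.
(* the largest y is at least the weighted mean p2 / p1 *)
have [/hasP[y yys hy]|hno] := boolP (has (fun y => p2 <= p1 * y) ys).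
  have y0 : 0 < y by rewrite -(pmulr_rgt0 _ c10); exact: lt_le_trans hy.
  exists y^-1; first by rewrite fy // gt_eqF.
  by rewrite invr_gt0; split => //; rewrite mulrC ler_pdivrMr.
exfalso; have : \sum_(y <- ys) y * (p2 - p1 * y) <= 0.
  have -> : \sum_(y <- ys) y * (p2 - p1 * y) = 0; last by [].
  have gen a b : \sum_(y <- ys) y * (b - a * y) = b * p1 - a * p2.
    by rewrite /p1 /p2 !mulr_sumr -sumrB; apply: eq_bigr => y _; ring.
  by rewrite gen; ring.
have nn y : y \in ys -> 0 <= y * (p2 - p1 * y).
  move=> yys; apply: mulr_ge0; first exact: ypos.
  rewrite subr_ge0 leNgt; apply/negP => h.
  by move/hasPn: hno => /(_ y yys); rewrite ltW.
have : exists2 y, y \in ys & 0 < y.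
  apply: contrapT => hn; move: c10; rewrite /p1 big_seq big1 ?ltxx // => y yys.
  apply/eqP; rewrite eq_le ypos // andbT leNgt; apply/negP => h; apply: hn; by exists y.
move=> [y yys y0]; rewrite (big_rem _ yys) /= => h.
have : 0 < y * (p2 - p1 * y).
  rewrite mulr_gt0 // subr_gt0 ltNge; by move/hasPn: hno => /(_ y yys).
have : 0 <= \sum_(y <- rem y ys) y * (p2 - p1 * y).
  by rewrite big_seq sumr_ge0 // => w /mem_rem; exact: nn.
lra.
Qed.

End PowerSums.

Section Necessary.
Variable R : realType.
Implicit Types (lam : nat -> R) (a : nat -> R).

(** For x <= 0 the value of R_k is at least 1. *)
Lemma Rp_ge1 lam k x : (forall j, 0 <= lam j) -> x <= 0 -> 1 <= (Rp lam k).[x].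
Proof.
move=> h; elim: k x => [|k IH] x hx; first by rewrite Rp0.
rewrite RpS; have := IH (lam k * x) ltac:(by rewrite mulr_ge0_le0).
by nra.
Qed.

(** Real-rootedness of R_(i+2) bounds the last ratio by 1/3 and makes it
    attained by t R_(i+1)(t) on [0, 1]. *)
Lemma hyperbolic_ratio lam i : (forall j, 0 <= lam j) -> 0 < lam i.+1 -> lam i <= 1/3 ->
  hyperbolic (Rp lam i.+2) ->
  lam i.+1 <= 1/3 /\ exists2 t, 0 <= t <= 1 & lam i.+1 = t * (Rp lam i.+1).[t].
Proof.
move=> lam0 l0 l13 hyp.
have c1 : (Rp lam i.+2)`_1 = -1 by rewrite coef_RpS coef_Rp0; ring.
have c2 : (Rp lam i.+2)`_2 = lam i.+1 by rewrite coef_RpS coef_RpS coef_Rp0; ring.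
have c3 : - (Rp lam i.+2)`_3 = lam i.+1 ^+ 2 * (- (Rp lam i.+1)`_2 * -1) by rewrite coef_RpS; ring.
have c3' : 0 <= - (Rp lam i.+2)`_3 <= lam i.+1 ^+ 2 * (1/3).
  have -> : - (Rp lam i.+2)`_3 = lam i.+1 ^+ 2 * (Rp lam i.+1)`_2 by rewrite c3; ring.
  have h : 0 <= (Rp lam i.+1)`_2 <= 1/3.
    rewrite coef_RpS; case: (i) l13 => [|j] l13; first by rewrite coef1 mulr0 oppr0; lra.
    by rewrite coef_RpS coef_Rp0; have := lam0 j.+1; lra.
  by rewrite mulr_ge0 ?sqr_ge0 //= ?ler_wpM2l ?sqr_ge0 //; lra.
have pos x : x <= 0 -> (Rp lam i.+2).[x] != 0.
  by move=> hx; rewrite gt_eqF // (lt_le_trans _ (Rp_ge1 _ lam0 hx)).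
have c10 : 0 < - (Rp lam i.+2)`_1 by rewrite c1 opprK.
have [h1 h2] := hyperbolic_low_coef hyp (coef_Rp0 _ _) pos c10.
rewrite c1 c2 opprK in h1 h2.
set l := lam i.+1 in l0 h1 h2 c3' *.
have hl : l <= 1/3.
  have : l * (4 * l) <= l * (1 + l) by move: h1 c3'; move: (- _`_3) => c; clear; lra.
  by rewrite ler_pM2l //; lra.
split => //.
have [|x hx [x0 hx1]] := h2; first by lra.
have hx2 : x <= 3 by nra.
exists (l * x); first by apply/andP; split; nra.
move: hx; rewrite RpS -/l => hx.
have -> : l * x * (Rp lam i.+1).[l * x] = l * (x * (Rp lam i.+1).[l * x]) by ring.
have -> : x * (Rp lam i.+1).[l * x] = 1 by lra.
by rewrite mulr1.
Qed.

(** The ratios a_(k-1) a_(k+1) / a_k^2 of a sequence, with the irrelevant value 0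
    for k = 0. *)
Definition ratio a (k : nat) : R := if k is k'.+1 then a k' * a k.+1 / a k ^+ 2 else 0.

Lemma ceval_Rp0 lam z : ceval (Rp lam 0) z = 1.
Proof. by rewrite /ceval rmorph1 hornerC. Qed.

Lemma ceval_RpS lam k z :
  ceval (Rp lam k.+1) z = 1 - z * ceval (Rp lam k) (toC (lam k) * z).
Proof.
rewrite /ceval /= rmorphB rmorph1 rmorphM /= map_polyX map_comp_poly map_polyZ /= map_polyX.
by rewrite !hornerE horner_comp !hornerE.
Qed.

(** Reversal of 1 + a_1 x + ... and rescaling produce the polynomials R_k of the
    ratios of the sequence a. *)
Lemma ratio_reverse a k (z : cplx R) : (forall j, (j <= k.+1)%N -> 0 < a j) ->
  \sum_(m < k.+2) toC (a (k.+1 - m)%N) * (- z) ^+ m =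
  toC (a k.+1) * ceval (Rp (ratio a) k.+1) (z * toC (a k / a k.+1)).
Proof.
elim: k z => [|k IH] z apos.
  have a0 := apos 0%N isT; have a1 := apos 1%N isT.
  rewrite ceval_RpS ceval_Rp0 !big_ord_recl big_ord0 /= /bump /= rmorphM /= fmorphV.
  by field; rewrite toC_eq0 lt0r_neq0.
rewrite big_ord_recl expr0 mulr1 subn0.
under eq_bigr => i _ do rewrite /= /bump /= add1n subSS exprS mulrCA.
rewrite -mulr_sumr IH; last by move=> j hj; apply: apos; exact: leqW.
have a0 := apos k (leqW (leqnSn _)); have a1 := apos k.+1 (leqnSn _); have a2 := apos k.+2 (leqnn _).
rewrite [in RHS]ceval_RpS.
have -> : toC (ratio a k.+1) * (z * toC (a k.+1 / a k.+2)) = z * toC (a k / a k.+1).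
  rewrite mulrCA -rmorphM; congr (_ * toC _).
  by rewrite /ratio; field; rewrite !lt0r_neq0.
have -> : toC (a k.+2) * (1 - z * toC (a k.+1 / a k.+2) * ceval (Rp (ratio a) k.+1) (z * toC (a k / a k.+1))) =
  toC (a k.+2) - z * toC (a k.+2 * (a k.+1 / a k.+2)) * ceval (Rp (ratio a) k.+1) (z * toC (a k / a k.+1)).
  by rewrite [in RHS]rmorphM; ring.
have -> : a k.+2 * (a k.+1 / a k.+2) = a k.+1 by field; rewrite lt0r_neq0.
ring.
Qed.

Lemma ceval_reverse a k (p : {poly R}) (z : cplx R) : (forall j, (j <= k.+1)%N -> 0 < a j) ->
  (size p <= k.+2)%N -> (forall j, (j <= k.+1)%N -> p`_j = a j) -> z != 0 ->
  ceval p z = z ^+ k.+1 * toC (a k.+1) * ceval (Rp (ratio a) k.+1) (- z^-1 * toC (a k / a k.+1)).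
Proof.
move=> apos sp pa z0; rewrite -mulrA -ratio_reverse // opprK.
rewrite /ceval (@horner_coef_wide _ k.+2); last by rewrite size_map_poly.
rewrite mulr_sumr (reindex_inj rev_ord_inj) /=; apply: eq_bigr => i _.
have hi : (i <= k.+1)%N by rewrite -ltnS.
rewrite coef_map /= subSS pa ?leq_subr // mulrCA; congr (_ * _).
move: (nat_of_ord i) hi => m hm.
by rewrite -{2}(subnK hm) exprD exprVn mulfK // expf_neq0.
Qed.

Lemma hyperbolic_reverse a k (p : {poly R}) : (forall j, (j <= k.+1)%N -> 0 < a j) ->
  (size p <= k.+2)%N -> (forall j, (j <= k.+1)%N -> p`_j = a j) ->
  hyperbolic p <-> hyperbolic (Rp (ratio a) k.+1).
Proof.
move=> apos sp pa.
have ak : 0 < a k by apply: apos; exact: leqnSn.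
have ak1 : 0 < a k.+1 by apply: apos.
have c0 : toC (a k / a k.+1) != 0 :> cplx R by rewrite toC_eq0 lt0r_neq0 // divr_gt0.
split=> h z hz.
  have z0 : z != 0.
    apply/eqP => z0; move: hz; rewrite z0 ceval_RpS mul0r subr0 => /eqP.
    by rewrite oner_eq0.
  pose w := - toC (a k / a k.+1) / z.
  have w0 : w != 0 by rewrite mulf_neq0 ?invr_eq0 ?oppr_eq0.
  have wr : w \is Num.real.
    apply: h; rewrite (ceval_reverse apos sp pa w0).
    have -> : - w^-1 * toC (a k / a k.+1) = z by rewrite /w; move: c0; move: (toC _) => c c0; field; rewrite c0 z0.
    by rewrite hz mulr0.
  have -> : z = - toC (a k / a k.+1) / w by rewrite /w; move: c0; move: (toC _) => c c0; field; rewrite c0 z0.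
  by rewrite rpredM // ?rpredV ?rpredN //; apply/complex_realP; exists (a k / a k.+1).
have z0 : z != 0.
  apply/eqP => z0; move: hz; rewrite z0 -(rmorph0 (@toC R)) ceval_toC horner_coef0 pa //.
  by move/eqP; rewrite toC_eq0 gt_eqF // apos.
have : - z^-1 * toC (a k / a k.+1) \is Num.real.
  apply: h; move: hz; rewrite (ceval_reverse apos sp pa z0) => /eqP.
  by rewrite !mulf_eq0 expf_eq0 (negbTE z0) andbF toC_eq0 gt_eqF //= => /eqP.
set c := toC _ in c0 *.
have cr : c \is Num.real by apply/complex_realP; exists (a k / a k.+1).
move: c c0 cr => c c0 cr h1.
have -> : z = - c / (- z^-1 * c) by field; rewrite c0 z0.
by rewrite rpredM ?rpredV ?rpredN.
Qed.

End Necessary.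

(** * The greedy sequence and its roots *)

(** A point of [0, 1] where t f(t) is largest. *)
Definition argmax01 {R : realType} (f : {poly R}) : R :=
  xget 0 [set t : R | 0 <= t <= 1 /\ forall s, 0 <= s <= 1 -> s * f.[s] <= t * f.[t]].

(** The polynomials R_k for the ratios defined by the greedy rule
    lam_0 = 0 and lam_(k+1) = max t R_(k+1)(t) on [0, 1]; the ratios are inlined
    in the recursion. *)
Fixpoint greedy {R : realType} (k : nat) : {poly R} :=
  if k is k'.+1 then
    1 - 'X * (greedy k' \Po
      ((if k' is 0%N then 0 else argmax01 (greedy k') * (greedy k').[argmax01 (greedy k')]) *: 'X))
  else 1.

(** The greedy ratios. *)
Definition glam {R : realType} (k : nat) : R :=
  if k is 0%N then 0 else argmax01 (greedy k) * (greedy k).[argmax01 (greedy k)].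

(** The double zero of the greedy R_k for k >= 2: if t R_(k-1)(t) is largest at t,
    then R_k(x) = 1 - x R_(k-1)(lam_(k-1) x) >= 0 vanishes at x = t / lam_(k-1).
    For k = 1 it is the simple zero 1 of 1 - x. *)
Definition rho {R : realType} (k : nat) : R :=
  if k is k'.+2 then argmax01 (greedy k'.+1) / glam k'.+1 else 1.

Arguments greedy : simpl never.
Arguments glam : simpl never.
Arguments rho : simpl never.

Section Greedy.
Variable R : realType.
Implicit Types (lam : nat -> R) (t x : R) (f : {poly R}).

Lemma argmax01P f : 0 <= argmax01 f <= 1 /\
  forall s, 0 <= s <= 1 -> s * f.[s] <= argmax01 f * f.[argmax01 f].
Proof.
have cf : {within `[0, 1], continuous (fun t : R => ('X * f).[t])}.
  by apply: continuous_subspaceT => x; exact: continuous_horner.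
have [c hc hm] := EVT_max ler01 cf.
rewrite /argmax01; case: xgetP => [t _ ht|/(_ c)]; first exact: ht.
case; split; first by [].
by move=> s hs; have := hm s hs; rewrite !hornerE.
Qed.

Lemma Rp_ext lam lam' k : (forall j, (j < k)%N -> lam j = lam' j) -> Rp lam k = Rp lam' k.
Proof.
elim: k => //= k IH h; rewrite IH; last by move=> j hj; apply: h; exact: ltnW.
by rewrite h.
Qed.

Lemma greedyE k : greedy k = Rp (@glam R) k.
Proof. by elim: k => //= k IH; rewrite -IH. Qed.

Lemma glamP k (t := argmax01 (greedy k.+1)) :
  [/\ 0 <= t <= 1, glam k.+1 = t * (Rp (@glam R) k.+1).[t] &
  forall s, 0 <= s <= 1 -> s * (Rp (@glam R) k.+1).[s] <= glam k.+1].
Proof.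
rewrite -greedyE; have [h1 h2] := argmax01P (greedy k.+1).
by split => // s hs; exact: h2.
Qed.

(** A greedy ratio is at most 1/3, because t (1 - t) + t^3 / 3 <= 1/3 on [0, 1]. *)
Lemma glam13 k : 0 <= (glam k : R) <= 1/3.
Proof.
suff: forall n j, (j <= n)%N -> 0 <= (glam j : R) <= 1/3 by move=> /(_ k k (leqnn _)).
elim=> [|n IH] j; first by rewrite leqn0 => /eqP ->; rewrite /glam; lra.
rewrite leq_eqVlt => /orP[/eqP ->|]; last by rewrite ltnS; exact: IH.
pose lam j : R := if (j <= n)%N then glam j else 0.
have hl i : 0 <= lam i <= 1/3 by rewrite /lam; case: ifP => // [/IH|_] //; lra.
have [ht et hm] := glamP n.
apply/andP; split; first by have := hm 0 ltac:(lra); rewrite mul0r.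
have e : Rp (@glam R) n.+1 = Rp lam n.+1.
  by apply: Rp_ext => i; rewrite ltnS /lam => ->.
rewrite et e; move: (argmax01 _) ht => t ht.
case: (n) lam hl {e et hm IH} => [|m] lam hl.
  rewrite RpS Rp0; have := sqr_ge0 (t - 1/2); lra.
rewrite !RpS; have h1 := hl m.+1; have h0 := hl m.
have hx : 0 <= lam m * (lam m.+1 * t) <= 1.
  have : 0 <= lam m.+1 * t <= 1 by nra.
  by nra.
have /andP[_] := Rp_bound m hl hx; set A := (Rp lam m).[_] => hA.
have : t ^+ 3 * (lam m.+1 * A) <= t ^+ 3 * (1/3).
  rewrite ler_wpM2l ?exprn_ge0 //; first lra.
  apply: le_trans (_ : lam m.+1 * 1 <= _); last by lra.
  by rewrite ler_wpM2l //; lra.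
have : 0 <= (1 - t) ^+ 3 by rewrite exprn_ge0 //; lra.
clear; lra.
Qed.

Lemma glam_ge14 k : 1/4 <= (glam k.+1 : R).
Proof.
have [_ _ hm] := glamP k.
have h := @Rp_bound R _ k.+1 (1/2) glam13 ltac:(lra).
have := hm (1/2) ltac:(lra); lra.
Qed.

Lemma glam_gt0 k : 0 < (glam k.+1 : R).
Proof. by have := glam_ge14 k; lra. Qed.

Lemma greedy_comparison k : [/\ (glam k : R) <= lamstar R, glam k.+1 <= lamstar R,
  lamstar R - glam k <= 6 * (lamstar R - glam k.+1) &
     forall t, 0 <= t <= 1 -> (Rp (@glam R) k.+1).[t] <= theta (lamstar R) t].
Proof.
have [] // := @comparison R (@glam R) erefl glam13 _ k.
by move=> i; have [h1 h2 _] := glamP i; eexists; [exact: h1|rewrite h2].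
Qed.

(** The maximum of t R_(k+1)(t) is not attained at the end t = 1, where the value
    is smaller than at t = 5/7. *)
Lemma argmax01_lt1 k (t := argmax01 (greedy k.+1) : R) : 0 < t < 1.
Proof.
have [ht et hm] := glamP k; rewrite -/t in ht et.
have g0 := glam_gt0 k.
apply/andP; split; rewrite lt_neqAle.
  apply/andP; split; last by lra.
  by apply/eqP => t0; move: et; rewrite -t0 mul0r => g00; rewrite g00 ltxx in g0.
apply/andP; split; last by lra.
apply/eqP => t1; move: et; rewrite t1 mul1r => et.
case: k @t ht hm g0 t1 et => [|k] t ht hm g0 t1 et.
  by move: et g0; rewrite RpS Rp0; lra.
have [_ _ _ hF] := greedy_comparison k.+1.
have hl := lamstar_bounds R; have hl3 := lamstar13 R.
have F1 : theta (lamstar R) 1 <= 2/7 - 1/600.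
  rewrite (theta_rec2 1 hl3).
  have hs : 9/100 <= lamstar R * (lamstar R * 1) <= 1/10 by apply/andP; split; nra.
  have := @theta_le_quadratic R _ (lamstar R * (lamstar R * 1)) hl3 ltac:(lra).
  set s := lamstar R * _ in hs *; set T := theta _ s; move=> hT.
  have hT2 : T <= 32/35 by clear -hT hs hl; nra.
  have : lamstar R * T <= 13/42 * (32/35).
    have [T0|T0] := leP 0 T; first by apply: ler_pM => //; lra.
    by apply: le_trans (_ : 0 <= _); [rewrite mulr_ge0_le0 //; lra|lra].
  lra.
have := hF 1 ltac:(lra); rewrite -et => h1.
have := hm (5/7) ltac:(lra).
rewrite !RpS.
have hk := glam13 k; have hk1 := glam13 k.+1; have hk4 := glam_ge14 k.
have hx : 0 <= (glam k : R) * (glam k.+1 * (5/7)) <= 5/63.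
  have : 0 <= (glam k.+1 : R) * (5/7) <= 5/21 by lra.
  by nra.
have /andP[hA _] := @Rp_bound R _ k _ glam13 (ltac:(lra) : 0 <= (glam k : R) * (glam k.+1 * (5/7)) <= 1).
move: hA; set A := (Rp _ k).[_] => hA h2.
have hA1 : 58/63 <= A by lra.
have hA2 : 1/4 * (58/63) <= glam k.+1 * A by apply: ler_pM => //; lra.
clear -hA2 h2 h1 F1; lra.
Qed.

Lemma rho_root k : (Rp (@glam R) k.+1).[rho k.+1] = 0.
Proof.
case: k => [|k]; first by rewrite RpS Rp0 /rho; ring.
have [_ e _] := glamP k; have g0 := glam_gt0 k.
rewrite RpS /rho mulrCA divff ?lt0r_neq0 // mulr1 mulrAC -e divff ?lt0r_neq0 //; ring.
Qed.

Lemma rho_ge1 k : 1 <= (rho k.+1 : R).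
Proof.
case: k => [//|k]; rewrite leNgt; apply/negP => h.
have r0 : 0 <= rho k.+2 :> R.
  have /andP[t0 _] := argmax01_lt1 k.
  by rewrite /rho divr_ge0 ?ltW // glam_gt0.
have /andP[h1 _] := @Rp_bound R _ k.+2 (rho k.+2) glam13 ltac:(by rewrite r0 ltW).
by move: h1; rewrite rho_root; lra.
Qed.

Lemma rho_lt k : rho k.+2 < (glam k.+1)^-1 :> R.
Proof.
have /andP[_ t1] := argmax01_lt1 k.
by rewrite /rho -[X in _ < X]mul1r ltr_pM2r // invr_gt0 glam_gt0.
Qed.

Lemma rho_le4 k : rho k.+1 <= 4 :> R.
Proof.
case: k => [|k]; first by rewrite /rho; lra.
apply: le_trans (ltW (rho_lt k)) _.
rewrite -[4]invrK lef_pV2 ?posrE ?invr_gt0 ?glam_gt0 //; have := glam_ge14 k; lra.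
Qed.

(** The greedy R_(k+2) is nonnegative up to 1 / lam_(k+1), so that its zero rho is a
    double one. *)
Lemma greedy_ge0 k x : 0 <= x <= (glam k.+1)^-1 -> 0 <= (Rp (@glam R) k.+2).[x].
Proof.
move=> /andP[x0 x1]; have g0 := glam_gt0 k.
have [_ _ hm] := glamP k.
rewrite RpS subr_ge0.
have h : 0 <= glam k.+1 * x <= 1.
  apply/andP; split; first by rewrite mulr_ge0 // ltW.
  by rewrite mulrC -ler_pdivlMr // mul1r.
by have := hm _ h; rewrite -mulrA -[X in _ <= X]mulr1 ler_pM2l.
Qed.

(** Points at which the greedy R_i has absolute value at least 1, with alternating
    signs, obtained recursively from R_(i+1)(x) = 1 - x R_i(lam_i x): first the
    point where R_i vanishes, then the images of the points of R_i.  The index k counts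
    these points; the definition is meaningful for k + 2 <= i. *)
Fixpoint altpt (i k : nat) {struct i} : R :=
  if i is i'.+1 then (if k is k'.+1 then altpt i' k' else rho i') / glam i' else 1.

Lemma altptS0 i : altpt i.+1 0 = rho i / glam i. Proof. by []. Qed.

Lemma altptSS i k : altpt i.+1 k.+1 = altpt i k / glam i. Proof. by []. Qed.

Arguments altpt : simpl never.

Lemma altpt_ge3 i k : (k.+2 <= i)%N -> 3 <= altpt i k.
Proof.
elim: i k => [//|[//|i] IH] [|k] hk.
  have r1 := rho_ge1 i; have g0 := glam_gt0 i; have g3 := glam13 i.+1; rewrite altptS0.
  by rewrite ler_pdivlMr //; lra.
have g0 := glam_gt0 i; have g3 := glam13 i.+1.
have := IH k hk; rewrite [altpt i.+2 _]altptSS => h; rewrite ler_pdivlMr //; apply: le_trans h; lra.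
Qed.

Lemma altpt_sign i k : (k.+2 <= i)%N -> 1 <= (-1) ^+ k * (Rp (@glam R) i).[altpt i k].
Proof.
elim: i k => [//|[//|i] IH] [|k] hk.
  rewrite expr0 mul1r RpS altptS0 mulrCA divff ?lt0r_neq0 ?glam_gt0 // mulr1 rho_root mulr0; lra.
have g0 := glam_gt0 i; have g3 := glam13 i.+1.
have h := IH k hk; have h3 := @altpt_ge3 i.+1 k hk.
rewrite RpS altptSS mulrCA divff ?lt0r_neq0 // mulr1.
set y := altpt i.+1 k in h h3 *; set A := (Rp _ _).[_] in h *.
have hy : 9 <= y / glam i.+1 by rewrite ler_pdivlMr //; lra.
have -> : (-1) ^+ k.+1 * (1 - y / glam i.+1 * A) = (y / glam i.+1) * ((-1) ^+ k * A) + (-1) ^+ k.+1.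
  by rewrite exprS; ring.
have : 9 <= y / glam i.+1 * ((-1) ^+ k * A).
  by rewrite -[9]mulr1; apply: ler_pM.
have : -1 <= (-1 : R) ^+ k.+1 by rewrite -signr_odd; case: odd; rewrite ?expr1 ?expr0; lra.
lra.
Qed.

Lemma rho_lt_altpt i : rho i.+2 < altpt i.+2 0.
Proof.
apply: lt_le_trans (rho_lt i) _; rewrite altptS0.
by rewrite ler_peMl ?rho_ge1 // invr_ge0 ltW // glam_gt0.
Qed.

Lemma altpt_lt i k : (k.+3 <= i)%N -> altpt i k < altpt i k.+1.
Proof.
elim: i k => [//|[//|[//|i]] IH] k hk.
have g0 := glam_gt0 i.+1.
rewrite altptSS; case: k hk => [|k] hk.
  by rewrite altptS0 ltr_pM2r ?invr_gt0 //; exact: rho_lt_altpt.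
by rewrite altptSS ltr_pM2r ?invr_gt0 //; exact: IH.
Qed.

Lemma Rp_top_coef lam k : (forall j, 0 < lam j.+1) -> (Rp lam k)`_k != 0.
Proof.
move=> h; elim: k => [|k IH]; first by rewrite coef1 oner_neq0.
rewrite coef_RpS oppr_eq0 mulf_neq0 // expf_eq0.
by case: k {IH} => [|k]; rewrite //= gt_eqF.
Qed.

Lemma size_greedy k : size (Rp (@glam R) k) = k.+1.
Proof.
apply/eqP; rewrite eqn_leq size_Rp_le /= ltnNge; apply/negP => h.
by have := @Rp_top_coef (@glam R) k (@glam_gt0); rewrite nth_default ?eqxx.
Qed.

(** A zero around which a polynomial is nonnegative is at least double. *)
Lemma double_root_of_touching f x a b : a < x < b -> f.[x] = 0 ->
  (forall y, a < y < b -> 0 <= f.[y]) -> exists g, f = g * ('X - x%:P) ^+ 2.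
Proof.
move=> /andP[ax xb] fx fpos.
have /factor_theorem [g eg] : root f x by rewrite /root fx.
suff /eqP/factor_theorem [h eh] : g.[x] = 0 by exists h; rewrite eg eh expr2 mulrA.
have cg : {for x, continuous (horner g)} by exact: continuous_horner.
have key y : a < y < b -> 0 <= g.[y] * (y - x).
  by move=> /fpos; rewrite eg !hornerE.
apply: contrapT => /eqP gx.
have [g0|g0|g0] := ltgtP g.[x] 0; last by rewrite g0 eqxx in gx.
  have hn : \forall y \near x, g.[y] < 0.
    by have := cvgr_lt _ cg _ g0; move=> /(_ _).
  have [y [/andP[y1 y2] y3]] : exists y, x < y < b /\ g.[y] < 0.
    near x^'+ => y; exists y; split; last by near: y; apply: cvg_within; exact: hn.
    by apply/andP; split; near: y; [exact: nbhs_right_gt|exact: nbhs_right_lt].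
  have := key y; rewrite y2 (lt_trans ax y1) => /(_ isT).
  by rewrite leNgt nmulr_rlt0 // subr_gt0 y1.
have hn : \forall y \near x, 0 < g.[y].
  by have := cvgr_gt _ cg _ g0; move=> /(_ _).
have [y [/andP[y1 y2] y3]] : exists y, a < y < x /\ 0 < g.[y].
  near x^'- => y; exists y; split; last by near: y; apply: cvg_within; exact: hn.
  by apply/andP; split; near: y; [exact: nbhs_left_gt|exact: nbhs_left_lt].
have := key y; rewrite y1 (lt_trans y2 xb) => /(_ isT).
by rewrite leNgt pmulr_rlt0 // subr_lt0 y2.
Unshelve. all: by end_near.
Qed.

(** The greedy R_(i+2) has the double root rho_(i+2), one simple root between any
    two consecutive sign-alternating points, and no other root. *)
Lemma greedy_factor i : exists c (rs : seq R),
  [/\ c != 0, size rs = i,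
     forall k, (k < i)%N -> altpt i.+2 k < rs`_k < altpt i.+2 k.+1 &
     Rp (@glam R) i.+2 = c *: (('X - (rho i.+2)%:P) ^+ 2 * \prod_(r <- rs) ('X - r%:P))].
Proof.
set f := Rp (@glam R) i.+2.
have fn0 : f != 0 by rewrite -size_poly_eq0 size_greedy.
have [g eg] : exists g, f = g * ('X - (rho i.+2)%:P) ^+ 2.
  apply: (@double_root_of_touching _ _ 0 (glam i.+1)^-1).
  - by rewrite rho_lt (lt_le_trans ltr01 (rho_ge1 _)).
  - exact: rho_root.
  - by move=> y /andP[y0 y1]; apply: greedy_ge0; rewrite !ltW.
have hr k : exists r, (k < i)%N -> altpt i.+2 k < r < altpt i.+2 k.+1 /\ root f r.
  have [hk|hk] := ltnP k i; last by exists 0.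
  have s0 := @altpt_sign i.+2 k (ltnW hk); have s1 := @altpt_sign i.+2 k.+1 hk.
  have l1 := @altpt_lt i.+2 k hk.
  have e1 : 0 < ((-1) ^+ k.+1 *: f).[altpt i.+2 k.+1].
    by rewrite hornerZ; apply: lt_le_trans s1.
  have e0 : ((-1) ^+ k.+1 *: f).[altpt i.+2 k] < 0.
    by rewrite hornerZ exprS mulN1r mulNr oppr_lt0; apply: lt_le_trans s0.
  have [||r /andP[r1 r2] rr] := @poly_ivt R ((-1) ^+ k.+1 *: f) (altpt i.+2 k) (altpt i.+2 k.+1).
  - exact: ltW.
  - by rewrite !ltW.
  exists r => _; split; last by move: rr; rewrite rootZ ?signr_eq0.
  rewrite !lt_neqAle r1 r2 !andbT; apply/andP; split; apply/eqP => er.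
    by move/rootP: rr; rewrite -er => e; rewrite e ltxx in e0.
  by move/rootP: rr; rewrite er => e; rewrite e ltxx in e1.
have [r hrr] := choice hr.
pose rs := mkseq r i.
have rsk k : (k < i)%N -> rs`_k = r k by move=> hk; rewrite nth_mkseq.
have between k : (k < i)%N -> altpt i.+2 k < rs`_k < altpt i.+2 k.+1.
  by move=> hk; rewrite rsk //; have [] := hrr k hk.
have mono : {in gtn i &, {homo r : x y / (x < y)%N >-> x < y}}.
  move=> x y hx hy xy.
  have [/andP[_ h1] _] := hrr x hx; have [/andP[h2 _] _] := hrr y hy.
  apply: lt_trans h1 (le_lt_trans _ h2).
  elim: y xy hy {h2 hx} => // y IH; rewrite ltnS leq_eqVlt => /orP[/eqP ->//|xy] hy.
  apply: le_trans (IH xy (ltnW hy)) (ltW _); apply: altpt_lt; exact: (ltnW hy).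
have urs : uniq rs.
  apply/mkseq_uniqP => x y hx hy e.
  by have [h|h|//] := ltngtP x y; have := mono _ _ _ _ h; rewrite e ltxx => /(_ _ _)/implyP; rewrite ?hx ?hy // => /(_ isT isT).
have rgt k : (k < i)%N -> rho i.+2 < r k.
  move=> hk; have [/andP[h1 _] _] := hrr k hk.
  apply: lt_trans (rho_lt_altpt i) (le_lt_trans _ h1).
  elim: k hk {h1} => // k IH hk; apply: le_trans (IH (ltnW hk)) (ltW _).
  by apply: altpt_lt; exact: (ltnW hk).
have gn0 : g != 0 by apply: contraNneq fn0 => g0; rewrite eg g0 mul0r.
have sg : size g = (size rs).+1.
  have := size_greedy i.+2; rewrite -/f eg size_Mmonic ?monic_exp ?monicXsubC //.
  by rewrite size_exp_XsubC size_mkseq addn3 /= => -[].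
have rg : all (root g) rs.
  apply/allP => x /mapP[k]; rewrite mem_iota => /andP[_ hk] ->.
  have [_] := hrr k hk; rewrite eg rootM => /orP[//|].
  by rewrite root_exp_XsubC gt_eqF // rgt.
(* the degree leaves no room for further roots *)
have uu : uniq_roots rs by rewrite uniq_rootsE.
exists (lead_coef g), rs; split => //.
- by rewrite lead_coef_eq0.
- by rewrite size_mkseq.
by rewrite eg {1}(all_roots_prod_XsubC sg rg uu) -scalerAl mulrC.
Qed.

End Greedy.

(** * The greedy polynomials and the quantities m_i *)

Section GreedyPolynomials.
Variable R : realType.
Implicit Types (a lam : nat -> R) (p : {poly R}).

Lemma hyperbolic_greedy k : hyperbolic (Rp (@glam R) k.+1).
Proof.
case: k => [|k] z.
  rewrite ceval_RpS ceval_Rp0 mulr1 => /eqP; rewrite subr_eq0 => /eqP <-.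
  exact: real1.
have [c [rs [c0 _ _ ->]]] := greedy_factor R k.
rewrite cevalZ cevalM expr2 cevalM !ceval_XsubC => /eqP.
rewrite !mulf_eq0 toC_eq0 (negbTE c0) /= orbb => /orP[|].
  by rewrite subr_eq0 => /eqP ->; apply/complex_realP; eexists.
elim: rs => [|r rs IH]; first by rewrite big_nil /ceval rmorph1 hornerC oner_eq0.
rewrite big_cons cevalM mulf_eq0 ceval_XsubC => /orP[|]; last exact: IH.
by rewrite subr_eq0 => /eqP ->; apply/complex_realP; eexists.
Qed.

(** Two consecutive coefficients of the sequence with a_0 = a_1 = 1 and greedy
    ratios. *)
Fixpoint gcoef2 (k : nat) : R * R :=
  if k is k'.+1 then let u := gcoef2 k' in (u.2, glam k'.+1 * u.2 ^+ 2 / u.1) else (1, 1).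

(** The positive sequence with a_0 = a_1 = 1 and greedy ratios. *)
Definition gcoef (k : nat) : R := (gcoef2 k).1.

Lemma gcoefSS k : gcoef k.+2 = glam k.+1 * gcoef k.+1 ^+ 2 / gcoef k.
Proof. by []. Qed.

Lemma gcoef_gt0 k : 0 < gcoef k.
Proof.
suff [] : 0 < gcoef k /\ 0 < gcoef k.+1 by [].
elim: k => [|k [h1 h2]]; first by rewrite /gcoef /=; split.
by split => //; rewrite gcoefSS divr_gt0 // mulr_gt0 ?exprn_gt0 // glam_gt0.
Qed.

Lemma ratio_gcoef k : ratio gcoef k = glam k.
Proof.
case: k => //= k; rewrite gcoefSS.
have h0 := gcoef_gt0 k; have h1 := gcoef_gt0 k.+1.
by field; rewrite !lt0r_neq0.
Qed.

Lemma Rp_ratio_gcoef k : Rp (ratio gcoef) k = Rp (@glam R) k.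
Proof. by apply: Rp_ext => j _; exact: ratio_gcoef. Qed.

(** The partial sums of its generating series; by [p_E] they are the polynomials p_n. *)
Definition gpoly n : {poly R} := \poly_(j < n.+1) gcoef j.

Lemma size_gpoly n : size (gpoly n) = n.+1.
Proof. by rewrite size_poly_eq // gt_eqF // gcoef_gt0. Qed.

Lemma coef_gpoly n j : (j <= n)%N -> (gpoly n)`_j = gcoef j.
Proof. by move=> h; rewrite coef_poly ltnS h. Qed.

Lemma hyperbolic_gpoly n : hyperbolic (gpoly n.+1).
Proof.
apply/(@hyperbolic_reverse R gcoef n).
- by move=> j _; exact: gcoef_gt0.
- by rewrite size_gpoly.
- exact: coef_gpoly.
by rewrite Rp_ratio_gcoef; exact: hyperbolic_greedy.
Qed.

Lemma gpoly_rec n : gpoly n.+1 = gpoly n + gcoef n.+1 *: 'X^(n.+1).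
Proof.
apply/polyP => j; rewrite coefD coefZ coefXn !coef_poly !ltnS.
have [->|nj] := eqVneq j n.+1; first by rewrite leqnn ltnn mulr1 add0r.
by rewrite mulr0 addr0 [(j <= n.+1)%N]leq_eqVlt (negbTE nj) ltnS.
Qed.

(** The greedy coefficient is the largest admissible one: for a coefficient A the
    corresponding ratio is a value t R_(k+1)(t) by [hyperbolic_ratio]. *)
Lemma gcoef_max k : is_maximum
  [set A : R | 0 < A /\ hyperbolic (gpoly k.+1 + A *: 'X^(k.+2))] (gcoef k.+2).
Proof.
split; first by split; [exact: gcoef_gt0|rewrite -gpoly_rec; exact: hyperbolic_gpoly].
move=> A [A0 hA].
pose a j := if (j == k.+2)%N then A else gcoef j.
have apos j : 0 < a j by rewrite /a; case: ifP => // _; exact: gcoef_gt0.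
have alow j : (j <= k.+1)%N -> a j = gcoef j.
  by move=> h; rewrite /a ltn_eqF.
have pa j : (j <= k.+2)%N -> (gpoly k.+1 + A *: 'X^(k.+2))`_j = a j.
  rewrite /a leq_eqVlt coefD coefZ coefXn => /orP[/eqP ->|hj].
    by rewrite eqxx mulr1 nth_default ?size_gpoly // add0r.
  by rewrite (ltn_eqF hj) mulr0 addr0 coef_gpoly.
have sp : (size (gpoly k.+1 + A *: 'X^(k.+2))%R <= k.+3)%N.
  rewrite (leq_trans (size_polyD _ _)) // geq_max size_gpoly leqnSn /=.
  by rewrite (leq_trans (size_scale_leq _ _)) // size_polyXn.
have := (@hyperbolic_reverse R a k.+1 _ (fun j _ => apos j) sp pa).1 hA.
pose lam j := if (j <= k.+1)%N then ratio a j else 0.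
have elow j : (j <= k)%N -> ratio a j = glam j.
  case: j => [//|j] hj; rewrite -ratio_gcoef /=.
  by rewrite !alow //; lia.
have -> : Rp (ratio a) k.+2 = Rp lam k.+2.
  by apply: Rp_ext => j; rewrite /lam ltnS => ->.
move=> hyp.
have rk : ratio a k.+1 = A * gcoef k / gcoef k.+1 ^+ 2.
  by rewrite /= (alow k) ?leqnSn // (alow k.+1) // /a eqxx [A * _]mulrC.
have g0 := gcoef_gt0 k; have g1 := gcoef_gt0 k.+1.
have lam_ge0 j : 0 <= lam j.
  rewrite /lam; case: ifP => // _; case: j => //= j.
  by rewrite divr_ge0 ?sqr_ge0 // mulr_ge0 // ltW.
have [||_ [t ht]] := hyperbolic_ratio lam_ge0 _ _ hyp.
- by rewrite /lam leqnn rk divr_gt0 ?mulr_gt0 ?exprn_gt0.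
- by rewrite /lam leqnSn elow //; have /andP[] := glam13 R k.
have -> : Rp lam k.+1 = Rp (@glam R) k.+1.
  by apply: Rp_ext => j; rewrite ltnS /lam => hj; rewrite leqW // elow.
have [_ _ hm] := glamP R k.
rewrite /lam leqnn rk => e; have := hm t ht; rewrite -e gcoefSS.
rewrite ler_pdivrMr ?exprn_gt0 // => h.
by rewrite ler_pdivlMr.
Qed.

Lemma maximum_eq (S : set R) x : is_maximum S x -> maximum S = x.
Proof.
move=> hx; rewrite /maximum; case: xgetP => [y _ hy|/(_ x)//].
case: hx => hx1 hx2; case: hy => hy1 hy2.
by apply/eqP; rewrite eq_le hx2 // hy2.
Qed.

Lemma p_E n : p_ R n = gpoly n.
Proof.
elim: n => [|[|n] IH].
- by rewrite /gpoly; apply/polyP => -[|j]; rewrite coef_poly coef1 //=.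
- by apply/polyP => -[|[|j]]; rewrite coef_poly /= coefD coef1 coefX /=; rewrite ?addr0 ?add0r.
have -> : p_ R n.+2 = p_ R n.+1 +
  maximum [set A : R | 0 < A /\ hyperbolic (p_ R n.+1 + A *: 'X^(n.+2))] *: 'X^(n.+2) by [].
rewrite IH.
by rewrite (maximum_eq (gcoef_max n)) -gpoly_rec.
Qed.

Lemma take_gpoly n i : (i <= n)%N -> take_poly i.+1 (gpoly n) = gpoly i.
Proof.
move=> h; apply/polyP => j; rewrite coef_take_poly !coef_poly !ltnS.
by case: leqP => // hj; rewrite (leq_trans hj h).
Qed.

Lemma Delta_gpoly n : @Delta R (gpoly n.+1).
Proof.
exists n.+1 => //=; split; first by rewrite size_gpoly.
- by rewrite coef_gpoly.
- by move=> i /andP[_ hi]; rewrite coef_gpoly // gcoef_gt0.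
by case=> // i /andP[_ hi]; rewrite take_gpoly //; exact: hyperbolic_gpoly.
Qed.

(** Every polynomial in Delta satisfies a_i^2 / (a_(i-1) a_(i+1)) >= 1 / l, by the
    comparison theorem applied to its ratios, extended by 0. *)
Lemma Delta_ratio p i : @Delta R p -> (i.+2 < size p)%N ->
  (lamstar R)^-1 <= p`_i.+1 ^+ 2 / (p`_i * p`_i.+2).
Proof.
move=> [n /= n1 [sp p0 ppos hyp]]; rewrite sp ltnS => hi.
pose a j := p`_j.
have apos j : (j <= n)%N -> 0 < a j.
  case: j => [_|j hj]; first by rewrite /a p0.
  by apply: ppos.
pose lam j := if (j < n)%N then ratio a j else 0.
have lam_gt0 j : (j.+1 < n)%N -> 0 < lam j.+1.
  move=> hj; rewrite /lam hj /= divr_gt0 ?mulr_gt0 ?exprn_gt0 //; apply: apos; lia.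
have lam_ge0 j : 0 <= lam j.
  case: j => [|j]; first by rewrite /lam; case: ifP.
  have [h|h] := ltnP j.+1 n; first by rewrite ltW // lam_gt0.
  by rewrite /lam ltnNge h.
have key j : (j.+1 < n)%N -> hyperbolic (Rp lam j.+2).
  move=> hj; have -> : Rp lam j.+2 = Rp (ratio a) j.+2.
    by apply: Rp_ext => m hm; rewrite /lam ifT //; lia.
  apply/(@hyperbolic_reverse R a j.+1 (take_poly j.+3 p)).
  - by move=> m hm; apply: apos; lia.
  - exact: size_take_poly.
  - by move=> m hm; rewrite coef_take_poly ltnS hm.
  by apply: hyp; lia.
have lam13 j : 0 <= lam j <= 1/3.
  rewrite lam_ge0 /=; elim: j => [|j IH]; first by rewrite /lam; case: ifP => _ /=; lra.
  have [h|h] := ltnP j.+1 n; last by rewrite /lam ltnNge h /=; lra.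
  by have [] := hyperbolic_ratio lam_ge0 (lam_gt0 j h) IH (key j h).
have lamt j : exists2 t, 0 <= t <= 1 & lam j.+1 <= t * (Rp lam j.+1).[t].
  have [h|h] := ltnP j.+1 n; last first.
    by exists 0; [lra|rewrite /lam ltnNge h /= mul0r].
  have /andP[_ l13] := lam13 j.
  have [_ [t ht e]] := hyperbolic_ratio lam_ge0 (lam_gt0 j h) l13 (key j h).
  by exists t => //; rewrite e.
have lam0 : lam 0%N = 0 by rewrite /lam; case: ifP.
have [_ h _ _ _] := comparison lam0 lam13 lamt i.
have l0 := lam_gt0 i hi.
have -> : p`_i.+1 ^+ 2 / (p`_i * p`_i.+2) = (lam i.+1)^-1 by rewrite /lam hi /= invf_div.
by rewrite lef_pV2 ?posrE // (lt_le_trans l0).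
Qed.

Lemma m_bounds i : (lamstar R)^-1 <= m_ R i.+1 <= (glam i.+1)^-1.
Proof.
rewrite /m_; set S := [set _ | _ in _].
have Sg : S (glam i.+1)^-1.
  exists (gpoly i.+2).
    by split; [exact: Delta_gpoly|rewrite size_gpoly].
  rewrite /= !coef_gpoly ?leqnSn //; last by lia.
  by rewrite -ratio_gcoef /= invf_div.
have Slb : lbound S (lamstar R)^-1.
  by move=> _ [p [hp sp] <-]; exact: Delta_ratio.
apply/andP; split; first by apply: lb_le_inf => //; exists (glam i.+1)^-1.
by apply: ge_inf => //; exists (lamstar R)^-1.
Qed.

End GreedyPolynomials.

(** * Convergence of the greedy ratios *)

(** A point of [0, 1] at which t theta_l(t) = l. *)
Definition tstar {R : realType} : R :=
  xget 0 [set t : R | 0 <= t <= 1 /\ t * theta (lamstar R) t = lamstar R].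

Section Convergence.
Variable R : realType.
Local Notation l := (lamstar R).
Local Notation F := (theta (lamstar R)).
Local Notation ts := (@tstar R).
Implicit Types (t : R).

Lemma tstarP : 0 <= ts <= 1 /\ ts * F ts = l.
Proof.
have [t ht e] := lamstar_attained R.
by rewrite /tstar; case: xgetP => [s _ hs|/(_ t)[]].
Qed.

(** The maximum of t theta_l(t) is not attained close to 1. *)
Lemma theta_near1 t : 9/10 <= t <= 1 -> t * F t < 17/55.
Proof.
move=> ht; have hl := lamstar_bounds R; have hl3 := lamstar13 R.
rewrite (theta_rec2 t hl3).
have hs : 17/201 <= l * (l * t) <= 1/10.
  have h1 : 17/62 <= l * t <= 13/42 by apply/andP; split; nra.
  by apply/andP; split; nra.
have := @theta_le_quadratic R _ (l * (l * t)) hl3 ltac:(lra).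
set s := l * (l * t) in hs *; set T := F s; move=> hT.
have hT2 : T <= 12/13 by clear -hT hs hl; nra.
have hlT : l * T <= 2/7.
  have [T0|T0] := leP 0 T; last by apply: le_trans (_ : 0 <= _); [rewrite mulr_ge0_le0 //; lra|lra].
  by apply: le_trans (_ : 13/42 * (12/13) <= _); [apply: ler_pM; lra|lra].
have -> : t * (1 - t + l * t ^+ 2 * T) = t - t ^+ 2 + t ^+ 3 * (l * T) by ring.
have : t ^+ 3 * (l * T) <= t ^+ 3 * (2/7) by rewrite ler_wpM2l ?exprn_ge0 //; lra.
have h1 : 0 <= (t - 9/10) ^+ 2 * (1 - t) by rewrite mulr_ge0 ?sqr_ge0 //; lra.
have h2 : 0 <= (t - 9/10) ^+ 2 by rewrite sqr_ge0.
move: ht h1 h2; clear; lra.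
Qed.

Lemma tstar_bounds : 1/4 <= ts <= 9/10.
Proof.
have [ht e] := tstarP; have hl := lamstar_bounds R; have hl3 := lamstar13 R.
apply/andP; split; last first.
  rewrite leNgt; apply/negP => h; have := @theta_near1 ts ltac:(lra); rewrite e; lra.
have /andP[_ h] := theta_bound hl3 ht.
have : ts * F ts <= ts by rewrite ler_piMr //; lra.
rewrite e; lra.
Qed.

(** The greedy R_i approach theta_l geometrically on [0, 1].  The step from i to
    i + 2 works since the argument is contracted twice by a factor at most 1/3,
    while the deficit of the ratio is bounded through its value at [tstar]. *)
Lemma greedy_close i t : 0 <= t <= 1 ->
  F t - (Rp (@glam R) i).[t] <= t ^+ 2 * (9/10) ^+ i.
Proof.
have hl := lamstar_bounds R; have hl3 := lamstar13 R.
suff: (forall t, 0 <= t <= 1 -> F t - (Rp (@glam R) i).[t] <= t ^+ 2 * (9/10) ^+ i) /\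
      (forall t, 0 <= t <= 1 -> F t - (Rp (@glam R) i.+1).[t] <= t ^+ 2 * (9/10) ^+ i.+1).
  by case=> h _ ht; exact: h.
elim: i {t} => [|i [IH0 IH1]].
  split=> t ht; have t2 : 0 <= t ^+ 2 by rewrite sqr_ge0.
    by rewrite Rp0 expr0 mulr1; have /andP[] := theta_bound hl3 ht; lra.
  by rewrite RpS Rp0 expr1; have := theta_le_quadratic hl3 ht; nra.
split => // t ht.
have [h1 h2 _ _] := greedy_comparison R i.
have [ht0 et0] := tstarP; have t0b := tstar_bounds.
have g0 := glam13 R i; have g1 := glam13 R i.+1.
have w0 : 0 <= (9/10 : R) ^+ i by rewrite exprn_ge0 //; lra.
have d1 : l - glam i.+1 <= 8/10 * (9/10) ^+ i.+1.
  have [_ _ hm] := glamP R i; have := hm _ ht0.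
  have := IH1 _ ht0; set A := (Rp _ _).[_] => hA hB.
  have h3 : ts * (F ts - A) <= ts * (ts ^+ 2 * (9/10) ^+ i.+1) by rewrite ler_wpM2l //; lra.
  have h4 : ts ^+ 3 <= 8/10.
    apply: le_trans (_ : (9/10) ^+ 3 <= _); last by lra.
    by rewrite lerXn2r // ?nnegrE; lra.
  have h5 : ts ^+ 3 * (9/10) ^+ i.+1 <= 8/10 * (9/10) ^+ i.+1.
    by rewrite ler_wpM2r // exprn_ge0 //; lra.
  move: h3 h5 hB; rewrite mulrBr et0; move: (9/10) => u; lra.
have s1 : 0 <= glam i.+1 * t <= 1/3 by apply/andP; split; nra.
have s2 : 0 <= glam i * (glam i.+1 * t) <= 1/9 by apply/andP; split; nra.
rewrite !RpS (theta_rec2 t hl3).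
have := IH0 (glam i * (glam i.+1 * t)) ltac:(lra).
set s := glam i * _ in s2 *; set A := (Rp _ _).[s] => hA.
have ss : s <= l * (l * t).
  rewrite /s; apply: ler_pM; [lra|lra|by []|].
  by rewrite ler_wpM2r //; lra.
have ls1 : l * (l * t) <= 1.
  have : 0 <= l * t <= 1 by nra.
  by nra.
have /andP[e0 _] := theta_lip hl3 (andP s2).1 ss ls1.
have ll0 : 0 <= l * (l * t) by rewrite !mulr_ge0 //; lra.
have /andP[_ F1] := @theta_bound R l (l * (l * t)) hl3 ltac:(by rewrite ll0 ls1).
set B := F (l * (l * t)) in e0 F1 *.
have k1 : (l - glam i.+1) * B <= l - glam i.+1 by rewrite ler_piMr //; lra.
have k2 : s ^+ 2 * (9/10) ^+ i <= 1/81 * (9/10) ^+ i.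
  rewrite ler_wpM2r //; have -> : 1/81 = (1/9) ^+ 2 :> R by field.
  by rewrite lerXn2r // ?nnegrE; lra.
have k3 : glam i.+1 * (B - A) <= 1/3 * (1/81 * (9/10) ^+ i).
  have [BA|BA] := leP 0 (B - A); last first.
    apply: le_trans (_ : 0 <= _); first by rewrite mulr_ge0_le0 //; lra.
    by rewrite !mulr_ge0 //; lra.
  by apply: ler_pM => //; lra.
have k4 : l * B - glam i.+1 * A <= (9/10) ^+ i.+2.
  have -> : l * B - glam i.+1 * A = (l - glam i.+1) * B + glam i.+1 * (B - A) by ring.
  move: k1 k3 d1 w0; rewrite !exprS; move: ((9/10) ^+ i) => w; lra.
have -> : 1 - t + l * t ^+ 2 * B - (1 - t * (1 - glam i.+1 * t * A)) = t ^+ 2 * (l * B - glam i.+1 * A) by ring.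
by rewrite ler_wpM2l ?sqr_ge0.
Qed.

Lemma glam_close i : 0 <= l - glam i.+1 <= (9/10) ^+ i.+1.
Proof.
have [_ h2 _ _] := greedy_comparison R i.
have [ht0 et0] := tstarP; have t0b := tstar_bounds.
rewrite subr_ge0 h2 /=.
have [_ _ hm] := glamP R i; have := hm _ ht0.
have := greedy_close i.+1 ht0; set A := (Rp _ _).[_] => hA hB.
have w0 : 0 <= (9/10 : R) ^+ i.+1 by rewrite exprn_ge0 //; lra.
have h3 : ts * (F ts - A) <= ts * (ts ^+ 2 * (9/10) ^+ i.+1) by rewrite ler_wpM2l //; lra.
have h4 : ts ^+ 3 <= 1 by rewrite exprn_ile1 //; lra.
have h5 : ts ^+ 3 * (9/10) ^+ i.+1 <= 1 * (9/10) ^+ i.+1 by rewrite ler_wpM2r.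
move: h3 h5 hB; rewrite mulrBr et0; move: ((9/10) ^+ i.+1) => u; lra.
Qed.

Lemma cvg_pow_910 : (fun i => (9/10 : R) ^+ i) @ \oo --> (0 : R).
Proof. by apply: cvg_expr; rewrite ger0_norm; lra. Qed.

Lemma glam_cvg : (@glam R) @ \oo --> l.
Proof.
rewrite -(cvg_shiftS (@glam R)).
have c0 : (fun i => l - (9/10) ^+ i.+1) @ \oo --> l.
  rewrite -[X in _ --> X]subr0; apply: cvgB; first exact: cvg_cst.
  by rewrite (cvg_shiftS (fun i => (9/10 : R) ^+ i)); exact: cvg_pow_910.
apply: (squeeze_cvgr _ c0 (cvg_cst l)).
by apply: nearW => i /=; have := glam_close i; lra.
Qed.

Lemma m_cvg : @m_ R @ \oo --> l^-1.
Proof.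
have l0 : l != 0 by apply: lt0r_neq0; have := lamstar_bounds R; lra.
rewrite -(cvg_shiftS (@m_ R)).
have c : (fun i => (glam i.+1 : R)^-1) @ \oo --> l^-1.
  by apply: cvgV => //; rewrite (cvg_shiftS (@glam R)); exact: glam_cvg.
apply: (squeeze_cvgr _ (cvg_cst l^-1) c).
by apply: nearW => i /=; exact: m_bounds.
Qed.

End Convergence.

(** * Complex power series with rapidly decreasing coefficients *)

(** The modulus of a complex number, as a real number. *)
Definition cabs (R : realType) (z : cplx R) : R := complex.Re `|z|.

Section ComplexModulus.
Variable R : realType.
Implicit Types (z w : cplx R) (x e : R) (u v : nat -> cplx R).

Lemma toC_cabs z : toC (cabs z) = `|z|.
Proof. by apply: RRe_real; exact: normr_real. Qed.

Lemma toC_le x y : (toC x <= toC y :> cplx R) = (x <= y).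
Proof. exact: lecR. Qed.

Lemma toC_lt x y : (toC x < toC y :> cplx R) = (x < y).
Proof. exact: ltcR. Qed.

Lemma cabs_ge0 z : 0 <= cabs z.
Proof. by rewrite -toC_le rmorph0 toC_cabs. Qed.

Lemma cabsM z w : cabs (z * w) = cabs z * cabs w.
Proof. by apply: toC_inj; rewrite rmorphM !toC_cabs normrM. Qed.

Lemma cabsD z w : cabs (z + w) <= cabs z + cabs w.
Proof. by rewrite -toC_le rmorphD !toC_cabs ler_normD. Qed.

Lemma cabsN z : cabs (- z) = cabs z.
Proof. by apply: toC_inj; rewrite !toC_cabs normrN. Qed.

Lemma cabsX z n : cabs (z ^+ n) = cabs z ^+ n.
Proof. by apply: toC_inj; rewrite rmorphXn !toC_cabs normrX. Qed.

Lemma cabs_toC x : cabs (toC x) = `|x|.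
Proof.
apply: toC_inj; rewrite toC_cabs; have [h|h] := leP 0 x.
  by rewrite !ger0_norm // -(rmorph0 (@toC R)) toC_le.
rewrite [`|x|]ltr0_norm // ler0_norm ?rmorphN // -(rmorph0 (@toC R)) toC_le; exact: ltW.
Qed.

Lemma cabs0 : cabs (0 : cplx R) = 0.
Proof. by rewrite -(rmorph0 (@toC R)) cabs_toC normr0. Qed.

Lemma cabs_eq0 z : (cabs z == 0) = (z == 0).
Proof. by rewrite -toC_eq0 toC_cabs normr_eq0. Qed.

Lemma cabs_sum n (f : nat -> cplx R) : cabs (\sum_(i < n) f i) <= \sum_(i < n) cabs (f i).
Proof.
elim: n => [|n IH]; first by rewrite !big_ord0 cabs0.
by rewrite !big_ord_recr /=; apply: le_trans (cabsD _ _) _; rewrite lerD2r.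
Qed.

Lemma Re_le_cabs z : `|complex.Re z| <= cabs z.
Proof. by rewrite -toC_le toC_cabs; exact: normc_ge_Re. Qed.

Lemma Im_le_cabs z : `|complex.Im z| <= cabs z.
Proof.
have -> : complex.Im z = - complex.Re (z * 'i%C) by rewrite ReiNIm opprK.
rewrite normrN; apply: le_trans (Re_le_cabs _) _; rewrite cabsM.
suff -> : cabs ('i%C : cplx R) = 1 by rewrite mulr1.
apply/eqP; rewrite -(@eqrXn2 _ 2) ?cabs_ge0 // -cabsX sqr_i cabsN.
by rewrite -(rmorph1 (@toC R)) cabs_toC normr1 expr1n.
Qed.

Lemma cabs_le_ReIm z : cabs z <= `|complex.Re z| + `|complex.Im z|.
Proof.
rewrite {1}[z]complexE; apply: le_trans (cabsD _ _) _.
rewrite cabsM; have -> : cabs ('i%C : cplx R) = 1.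
  apply/eqP; rewrite -(@eqrXn2 _ 2) ?cabs_ge0 // -cabsX sqr_i cabsN.
  by rewrite -(rmorph1 (@toC R)) cabs_toC normr1 expr1n.
by rewrite mul1r (cabs_toC (complex.Re z)) (cabs_toC (complex.Im z)).
Qed.

Lemma cplx_cvgP u (l : cplx R) : u @ \oo --> l <->
  (fun n => cabs (l - u n)) @ \oo --> (0 : R).
Proof.
split=> [/cvgrPdist_lt h|/cvgrPdist_lt h].
  apply/cvgrPdist_lt => e e0.
  have e0' : 0 < toC e by rewrite -(rmorph0 (@toC R)) toC_lt.
  have := h _ e0'; apply: filterS => n.
  by rewrite -toC_cabs toC_lt sub0r normrN ger0_norm // cabs_ge0.
apply/cvgrPdist_lt => e e0.
have er : e \is Num.real by exact: gtr0_real.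
have [x ex] := real_toC er; rewrite ex -(rmorph0 (@toC R)) toC_lt in e0.
have := h _ e0; apply: filterS => n.
by rewrite ex -toC_cabs toC_lt sub0r normrN ger0_norm // cabs_ge0.
Qed.

(** Geometric Cauchy criterion in the complex plane. *)
Lemma cplx_geo_cauchy u (C : R) : (forall k, cabs (u k.+1 - u k) <= C * (2^-1) ^+ k) ->
  u @ \oo --> limn u /\ forall k, cabs (limn u - u k) <= 4 * C * (2^-1) ^+ k.
Proof.
move=> hu.
have [|cr hr] := @geo_cauchy R (fun k => complex.Re (u k)) C.
  by move=> k; apply: le_trans (hu k); rewrite -raddfB; exact: Re_le_cabs.
have [|ci hi] := @geo_cauchy R (fun k => complex.Im (u k)) C.
  by move=> k; apply: le_trans (hu k); rewrite -raddfB; exact: Im_le_cabs.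
set a := limn _ in hr; set b := limn _ in hi.
pose l : cplx R := Complex a b.
have hl k : cabs (l - u k) <= 4 * C * (2^-1) ^+ k.
  apply: le_trans (cabs_le_ReIm _) _.
  have := lerD (hr k) (hi k).
  have -> : complex.Re (l - u k) = a - complex.Re (u k).
    by rewrite raddfB.
  have -> : complex.Im (l - u k) = b - complex.Im (u k).
    by rewrite raddfB.
  by move/le_trans; apply; rewrite le_eqVlt; apply/orP; left; apply/eqP; ring.
have cu : u @ \oo --> l.
  apply/cplx_cvgP; apply: (squeeze_cvgr _ (cvg_cst 0) (cvg_geo0 (4 * C))).
  by apply: nearW => k; rewrite cabs_ge0 hl.
have -> : limn u = l by apply: cvg_lim.
by split.
Qed.

Lemma near_cabs (z : cplx R) (e : R) : 0 < e -> \forall y \near z, cabs (z - y) < e.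
Proof.
move=> e0; have e0' : 0 < toC e by rewrite -(rmorph0 (@toC R)) toC_lt.
have := nbhsx_ballx z (toC e) e0'.
by apply: filterS => y; rewrite -ball_normE /= -toC_cabs toC_lt.
Qed.

Lemma cabs_continuous : continuous (@cabs R).
Proof.
move=> z; have FF : Filter (nbhs (z : cplx R)) by exact: nbhs_filter.
apply/cvgrPdist_lt => e e0; have := near_cabs z e0.
apply: filterS => y; apply: le_lt_trans.
rewrite ler_norml; have h1 := cabsD (z - y) y; have h2 := cabsD (y - z) z.
rewrite !subrK in h1 h2; have h3 : cabs (y - z) = cabs (z - y) by rewrite -cabsN opprB.
by apply/andP; split; lra.
Qed.

Lemma toC_continuous : continuous (@toC R).
Proof.
move=> x; have FF : Filter (nbhs (x : R)) by exact: nbhs_filter.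
apply/cvgrPdist_lt => e e0.
have er : e \is Num.real by exact: gtr0_real.
have [y ey] := real_toC er; rewrite ey -(rmorph0 (@toC R)) toC_lt in e0.
have := nbhsx_ballx (x : R) y e0.
by apply: filterS => t; rewrite -ball_normE /= ey -toC_cabs toC_lt -rmorphB cabs_toC.
Qed.

Lemma compact_cabs_bounded (K : set (cplx R)) : compact K ->
  exists2 M : R, 0 <= M & forall z, K z -> cabs z <= M.
Proof.
move=> cK.
have cI : compact (@cabs R @` K).
  apply: continuous_compact => //; apply: continuous_subspaceT; exact: cabs_continuous.
have [M [_ hM]] := compact_bounded cI.
exists (`|M| + 1); first by rewrite addr_ge0.
move=> z Kz; have := hM (`|M| + 1); rewrite (le_lt_trans (ler_norm M)) ?ltrDl // => /(_ isT).
move=> /(_ (cabs z)) h; apply: le_trans (ler_norm _) _; apply: h; by exists z.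
Qed.

(** Convergence uniform on compact sets, in terms of moduli. *)
Lemma family_compactP (f : nat -> cplx R -> cplx R) (g : cplx R -> cplx R) :
  {family compact, f @ \oo --> g} <->
  (forall (K : set (cplx R)) (e : R), compact K -> 0 < e ->
    exists N, forall n, (N <= n)%N -> forall z, K z -> cabs (g z - f n z) < e).
Proof.
split.
  move=> /fam_cvgP h K e cK e0.
  have := h K cK; move=> /(_ [set h | forall y, K y -> cabs (g y - h y) < e]).
  have e0' : 0 < toC e by rewrite -(rmorph0 (@toC R)) toC_lt.
  case.
    apply/uniform_nbhs; exists [set xy | ball xy.1 (toC e) xy.2]; split.
      by rewrite -entourage_ballE; exists (toC e).
    move=> k /= hk y Ky; have := hk y Ky.
    by rewrite -ball_normE /= -toC_cabs toC_lt.
  by move=> N _ hN; exists N => n hn z Kz; exact: (hN n hn).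
move=> h; apply/fam_cvgP => K cK P /uniform_nbhs [E [entE sub]].
move: entE; rewrite -entourage_ballE => -[e /= e0 sube].
have er : e \is Num.real by exact: gtr0_real.
have [x ex] := real_toC er; rewrite ex -(rmorph0 (@toC R)) toC_lt in e0.
have [N hN] := h K x cK e0.
exists N => // n hn; apply: sub => y Ky; apply: sube => /=.
by rewrite -ball_normE /= ex -toC_cabs toC_lt; exact: hN.
Qed.

Lemma family_compact_disks (f : nat -> cplx R -> cplx R) (g : cplx R -> cplx R) :
  (forall M e : R, 0 <= M -> 0 < e -> exists N, forall n, (N <= n)%N -> forall z, cabs z <= M ->
    cabs (g z - f n z) < e) -> {family compact, f @ \oo --> g}.
Proof.
move=> h; apply/family_compactP => K e cK e0.
have [M M0 hM] := compact_cabs_bounded cK.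
have [N hN] := h M e M0 e0; exists N => n hn z Kz; apply: hN => //; exact: hM.
Qed.

End ComplexModulus.

(** The partial sums of the power series with real coefficients c. *)
Definition psum {R : realType} (c : nat -> R) (n : nat) : {poly R} := \poly_(m < n) c m.

(** The sum of this power series in the complex plane. *)
Definition cser {R : realType} (c : nat -> R) (z : cplx R) : cplx R :=
  limn (fun n => ceval (psum c n) z).

(** The sequence decreases faster than any geometric sequence; the power series
    then has infinite radius of convergence. *)
Definition superdec {R : realType} (B : nat -> R) : Prop :=
  forall M : R, 0 <= M -> exists2 C : R, 0 <= C & forall m, `|B m| * M ^+ m <= C * (2^-1) ^+ m.

Section PowerSeries.
Variable R : realType.
Implicit Types (z w h : cplx R) (c B : nat -> R) (M C e : R) (p : {poly R}).

Lemma ceval_wide p n z : (size p <= n)%N -> ceval p z = \sum_(m < n) toC p`_m * z ^+ m.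
Proof.
move=> hn; rewrite /ceval (@horner_coef_wide _ n) ?size_map_poly //.
by apply: eq_bigr => i _; rewrite coef_map.
Qed.

Lemma ceval_psum c n z : ceval (psum c n) z = \sum_(m < n) toC (c m) * z ^+ m.
Proof.
rewrite (@ceval_wide _ n) ?size_poly //; apply: eq_bigr => i _.
by rewrite coef_poly ltn_ord.
Qed.

Lemma cabs_term x m z : cabs (toC x * z ^+ m) = `|x| * cabs z ^+ m :> R.
Proof. by rewrite cabsM cabs_toC cabsX. Qed.

Lemma cser_cvg c z C : (forall m, `|c m| * cabs z ^+ m <= C * (2^-1) ^+ m) ->
  (fun n => ceval (psum c n) z) @ \oo --> cser c z /\
  forall n, cabs (cser c z - ceval (psum c n) z) <= 4 * C * (2^-1) ^+ n.
Proof.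
move=> hc; apply: cplx_geo_cauchy => k.
by rewrite !ceval_psum big_ord_recr /= addrAC subrr add0r cabs_term.
Qed.

Lemma superdec_le B c : superdec B -> (forall m, `|c m| <= `|B m|) -> superdec c.
Proof.
move=> sB h M M0; have [C C0 hC] := sB M M0; exists C => // m.
by apply: le_trans (hC m); rewrite ler_wpM2r // exprn_ge0.
Qed.

Lemma superdec_scale c (a : R) : 0 <= a -> superdec c -> superdec (fun m => a ^+ m * c m).
Proof.
move=> a0 sc M M0; have [C C0 hC] := sc (a * M) (mulr_ge0 a0 M0); exists C => // m.
apply: le_trans (hC m); rewrite normrM normrX (ger0_norm a0) exprMn.
by rewrite mulrAC mulrC mulrA.
Qed.

(** The common majorant of the coefficients of all the R_k and of theta. *)
Lemma superdec_base : superdec (fun m => (1/3 : R) ^+ 'C(m, 2)).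
Proof.
move=> M M0; have [C C0 hC] := superexp_dominated M0; exists C => // m.
by rewrite ger0_norm ?exprn_ge0 //; lra.
Qed.

Lemma cser_superdec c z : superdec c -> (fun n => ceval (psum c n) z) @ \oo --> cser c z.
Proof. by move=> /(_ _ (cabs_ge0 z)) [C C0 hC]; have [] := cser_cvg hC. Qed.

Lemma geo_small C e : 0 < e -> exists N, C * (2^-1) ^+ N <= e.
Proof.
move=> e0; have /cvgrPdist_le/(_ e e0)[N _ hN] := cvg_geo0 C.
exists N; have := hN N (leqnn N); rewrite /= sub0r normrN; apply: le_trans; exact: ler_norm.
Qed.

(** Dominated convergence of power series, uniformly on disks. *)
Lemma tannery (P : nat -> {poly R}) c B M e : superdec B ->
  (forall i m, `|(P i)`_m| <= `|B m|) -> (forall m, `|c m| <= `|B m|) ->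
  (forall m, (fun i => (P i)`_m) @ \oo --> c m) -> 0 <= M -> 0 < e ->
  exists N, forall i, (N <= i)%N -> forall z, cabs z <= M -> cabs (cser c z - ceval (P i) z) < e.
Proof.
move=> sB hP hc cv M0 e0.
have [C C0 hC] := sB M M0.
have [K hK] := @geo_small (8 * C) (e / 3) ltac:(lra).
(* convergence of the first K coefficients *)
have [N hN] : exists N, forall i, (N <= i)%N ->
    \sum_(m < K) `|c m - (P i)`_m| * M ^+ m < e / 3.
  have cs : (fun i => \sum_(m < K) `|c m - (P i)`_m| * M ^+ m) @ \oo --> (0 : R).
    elim: (K) => [|k IH]; first by under eq_fun do rewrite big_ord0; exact: cvg_cst.
    have -> : (fun i => \sum_(m < k.+1) `|c m - (P i)`_m| * M ^+ m) =
      (fun i => \sum_(m < k) `|c m - (P i)`_m| * M ^+ m + `|c k - (P i)`_k| * M ^+ k).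
      by apply/funext => i; rewrite big_ord_recr.
    rewrite -[X in _ --> X]addr0; apply: cvgD => //.
    rewrite -[X in _ --> X](mul0r (M ^+ k)); apply: cvgMl.
    have h0 : (fun i => `|c k - (P i)`_k|) @ \oo --> `|c k - c k|.
      by apply: cvg_norm; apply: cvgB; [exact: cvg_cst|exact: cv].
    by rewrite subrr normr0 in h0.
  have /cvgrPdist_lt/(_ (e/3) ltac:(lra))[N _ hN] := cs.
  exists N => i hi; have := hN i hi; rewrite /= sub0r normrN; apply: le_lt_trans; exact: ler_norm.
exists N => i hi z hz.
have hz0 := cabs_ge0 z.
have cz m : `|c m| * cabs z ^+ m <= C * (2^-1) ^+ m.
  apply: le_trans (hC m); apply: ler_pM => //; first by rewrite exprn_ge0.
  by rewrite lerXn2r // nnegrE.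
have [_ tail] := cser_cvg cz.
have tailP : cabs (ceval (psum (fun m => (P i)`_m) K) z - ceval (P i) z) <= 2 * C * (2^-1) ^+ K.
  have gen n : cabs (ceval (psum (fun m => (P i)`_m) (K + n)) z - ceval (psum (fun m => (P i)`_m) K) z)
      <= 2 * C * (2^-1) ^+ K - 2 * C * (2^-1) ^+ (K + n).
    elim: n => [|n IH]; first by rewrite addn0 subrr cabs0 subrr.
    rewrite addnS !ceval_psum big_ord_recr /= -!ceval_psum addrAC.
    apply: le_trans (cabsD _ _) _; rewrite cabs_term.
    have h1 : `|(P i)`_(K + n)| * cabs z ^+ (K + n) <= C * (2^-1) ^+ (K + n).
      apply: le_trans (hC (K + n)%N); apply: ler_pM => //; first by rewrite exprn_ge0.
      by rewrite lerXn2r // nnegrE.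
    have h2 := geo_step C (K + n).
    by move: IH h1 h2; move: (_ ^+ K) (_ ^+ (K + n)) (_ ^+ (K + n).+1) => x y w; lra.
  have := gen (size (P i)).
  have -> : ceval (psum (fun m => (P i)`_m) (K + size (P i))) z = ceval (P i) z.
    by rewrite ceval_psum (@ceval_wide _ (K + size (P i))) // leq_addl.
  rewrite -cabsN opprB => /le_trans; apply; rewrite lerBlDr lerDl mulr_ge0 ?exprn_ge0 ?invr_ge0 //.
  by rewrite mulr_ge0.
have mid : cabs (ceval (psum c K) z - ceval (psum (fun m => (P i)`_m) K) z) < e / 3.
  apply: le_lt_trans (hN i hi); rewrite !ceval_psum -sumrB.
  apply: le_trans (cabs_sum _ (fun m => toC (c m) * z ^+ m - toC (P i)`_m * z ^+ m)) _.
  apply: ler_sum => m _; rewrite -mulrBl -rmorphB cabs_term ler_wpM2l // lerXn2r // nnegrE.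
have -> : cser c z - ceval (P i) z = (cser c z - ceval (psum c K) z) +
   ((ceval (psum c K) z - ceval (psum (fun m => (P i)`_m) K) z) +
   (ceval (psum (fun m => (P i)`_m) K) z - ceval (P i) z)) by ring.
apply: le_lt_trans (cabsD _ _) _.
have h3 := cabsD (ceval (psum c K) z - ceval (psum (fun m => (P i)`_m) K) z)
   (ceval (psum (fun m => (P i)`_m) K) z - ceval (P i) z).
have h4 := tail K.
by move: h3 h4 mid tailP hK; move: (_ ^+ K) => x; lra.
Qed.

Lemma tannery_point (P : nat -> {poly R}) c B z : superdec B ->
  (forall i m, `|(P i)`_m| <= `|B m|) -> (forall m, `|c m| <= `|B m|) ->
  (forall m, (fun i => (P i)`_m) @ \oo --> c m) ->
  (fun i => ceval (P i) z) @ \oo --> cser c z.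
Proof.
move=> sB hP hc cv; apply/cplx_cvgP/cvgrPdist_lt => e e0.
have [N hN] := tannery sB hP hc cv (cabs_ge0 z) e0.
exists N => // i hi /=; rewrite sub0r normrN ger0_norm ?cabs_ge0 //; exact: hN.
Qed.

(** Second order estimate for the difference quotients of a power. *)
Lemma pow_taylor1 z h m : cabs h <= 1 ->
  cabs ((z + h) ^+ m.+1 - z ^+ m.+1 - h * (m.+1%:R * z ^+ m)) <=
  cabs h ^+ 2 * (m.+1%:R ^+ 2 * (cabs z + 1) ^+ m.+1).
Proof.
move=> h1; have z0 := cabs_ge0 z; have h0 := cabs_ge0 h.
set r := cabs z + 1; have r1 : 1 <= r by rewrite /r; lra.
elim: m => [|m IH].
  have -> : (z + h) ^+ 1 - z ^+ 1 - h * (1%:R * z ^+ 0) = 0 by rewrite !expr1 expr0; ring.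
  by rewrite cabs0 !mulr_ge0 ?exprn_ge0 ?sqr_ge0 //; lra.
have -> : (z + h) ^+ m.+2 - z ^+ m.+2 - h * (m.+2%:R * z ^+ m.+1) =
  (z + h) * ((z + h) ^+ m.+1 - z ^+ m.+1 - h * (m.+1%:R * z ^+ m)) + (h ^+ 2 * (toC m.+1%:R * z ^+ m)).
  by rewrite rmorph_nat [(z + h) ^+ m.+2]exprS [z ^+ m.+2]exprS [z ^+ m.+1]exprS -[m.+2]addn1 natrD; ring.
apply: le_trans (cabsD _ _) _; rewrite cabsM [cabs (h ^+ 2 * _)]cabsM cabsX cabs_term normr_nat.
have zh : cabs (z + h) <= r by apply: le_trans (cabsD _ _) _; rewrite /r lerD2l.
have k1 := ler_pM (cabs_ge0 _) (cabs_ge0 _) zh IH.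
have k2 : m.+1%:R * cabs z ^+ m <= (2 * m.+1%:R + 1) * r ^+ m.+2.
  apply: ler_pM; rewrite ?ler0n ?exprn_ge0 //.
    by have n0 := ler0n R m.+1; lra.
  apply: le_trans (_ : r ^+ m <= _); first by rewrite lerXn2r // ?nnegrE /r; lra.
  by rewrite -addn2 exprD ler_peMr ?exprn_ge0 ?exprn_ege1 //; lra.
have k3 : cabs h ^+ 2 * (m.+1%:R * cabs z ^+ m) <= cabs h ^+ 2 * ((2 * m.+1%:R + 1) * r ^+ m.+2).
  by rewrite ler_wpM2l ?sqr_ge0.
apply: le_trans (lerD k1 k3) _; rewrite le_eqVlt; apply/orP; left; apply/eqP.
by rewrite -[m.+2%:R]natr1 [r ^+ m.+2]exprS; ring.
Qed.

(** The coefficients of the derivative of a power series. *)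
Definition dcoef c (m : nat) : R := m.+1%:R * c m.+1.

Lemma superdec_dcoef c : superdec c -> superdec (dcoef c).
Proof.
move=> sc M M0; have [C C0 hC] := sc (4 * (M + 1)) ltac:(lra).
exists C => // m; have := hC m.+1.
rewrite /dcoef normrM normr_nat exprMn => h.
have n4 : m.+1%:R <= (4 : R) ^+ m.+1.
  by rewrite -natrX ler_nat ltnW // ltn_expl.
have MM : M ^+ m <= (M + 1) ^+ m.+1.
  apply: le_trans (_ : (M + 1) ^+ m <= _); first by rewrite lerXn2r // ?nnegrE; lra.
  by rewrite exprS ler_peMl ?exprn_ge0 //; lra.
apply: le_trans (_ : `|c m.+1| * (4 ^+ m.+1 * (M + 1) ^+ m.+1) <= _).
  rewrite -mulrA mulrCA ler_wpM2l //.
  by apply: ler_pM => //; rewrite exprn_ge0.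
apply: le_trans h _; rewrite ler_wpM2l // exprS ler_piMl ?exprn_ge0 ?invr_ge0 //.
by rewrite invf_le1 // ler1n.
Qed.

Lemma cser_taylor1 c z : superdec c -> exists2 K, 0 <= K & forall h, cabs h <= 1 ->
  cabs (cser c (z + h) - cser c z - h * cser (dcoef c) z) <= K * cabs h ^+ 2.
Proof.
move=> sc; have z0 := cabs_ge0 z.
have [C C0 hC] := sc (4 * (cabs z + 1)) ltac:(lra).
exists (2 * C) => [|h h1]; first lra.
pose A n := ceval (psum c n.+1) (z + h) - ceval (psum c n.+1) z - h * ceval (psum (dcoef c) n) z.
have AE n : A n = \sum_(m < n) toC (c m.+1) * ((z + h) ^+ m.+1 - z ^+ m.+1 - h * (m.+1%:R * z ^+ m)).
  rewrite /A !ceval_psum !big_ord_recl /= !expr0 mulr_sumr.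
  have -> (x y w v : cplx R) : x + y - (x + w) - v = y - w - v by ring.
  rewrite -!sumrB; apply: eq_bigr => i _; rewrite /bump /= add1n /dcoef rmorphM rmorph_nat; ring.
have Ab n : cabs (A n) <= 2 * C * cabs h ^+ 2.
  have : cabs (A n) <= (2 * C - 2 * C * (2^-1) ^+ n) * cabs h ^+ 2.
    rewrite AE; elim: n => [|n IH]; first by rewrite big_ord0 cabs0 expr0 mulr1 subrr mul0r.
    rewrite big_ord_recr /=; apply: le_trans (cabsD _ _) _.
    have k1 := @pow_taylor1 z h n h1.
    have k2 : cabs (toC (c n.+1) * ((z + h) ^+ n.+1 - z ^+ n.+1 - h * (n.+1%:R * z ^+ n))) <=
       C * (2^-1) ^+ n.+1 * cabs h ^+ 2.
      rewrite cabsM cabs_toC.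
      apply: le_trans (_ : `|c n.+1| * (cabs h ^+ 2 * (n.+1%:R ^+ 2 * (cabs z + 1) ^+ n.+1)) <= _).
        by rewrite ler_wpM2l.
      rewrite mulrCA mulrC ler_wpM2r ?sqr_ge0 //; apply: le_trans (hC n.+1).
      rewrite ler_wpM2l // exprMn ler_wpM2r ?exprn_ge0 //; first lra.
      have -> : (4 : R) ^+ n.+1 = (2 ^+ n.+1) ^+ 2 by rewrite -exprM mulnC exprM; congr (_ ^+ _); ring.
      by rewrite lerXn2r ?nnegrE ?exprn_ge0 // -natrX ler_nat ltnW // ltn_expl.
    apply: le_trans (lerD IH k2) _; rewrite -mulrDl ler_wpM2r ?sqr_ge0 //.
    by have := geo_step C n; have : 0 <= C * (2^-1) ^+ n.+1; [rewrite mulr_ge0 ?exprn_ge0 ?invr_ge0|lra].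
  move/le_trans; apply; rewrite ler_wpM2r ?sqr_ge0 // gerBl mulr_ge0 ?exprn_ge0 ?invr_ge0 //; lra.
have cA : A @ \oo --> cser c (z + h) - cser c z - h * cser (dcoef c) z.
  have s1 (w : cplx R) : (fun n => ceval (psum c n.+1) w) @ \oo --> cser c w.
    by rewrite (cvg_shiftS (fun n => ceval (psum c n) w)); exact: cser_superdec.
  apply: cvgB; first by apply: cvgB; exact: s1.
  by apply: cvgMr; apply: cser_superdec; exact: superdec_dcoef.
have cc := (cplx_cvgP _ _).1 cA.
rewrite leNgt; apply/negP => hlt.
set L := cser c (z + h) - _ - _ in cc hlt.
have /cvgrPdist_lt/(_ (cabs L - 2 * C * cabs h ^+ 2) ltac:(lra))[N _ hN] := cc.
have := hN N (leqnn N); rewrite /= sub0r normrN ger0_norm ?cabs_ge0 // => k1.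
have k2 := cabsD (L - A N) (A N); rewrite subrK in k2.
have k3 := Ab N; lra.
Qed.

Lemma diff_quotient_rewrite (h d p : cplx R) : h != 0 -> p - h^-1 * d = - h^-1 * (d - h * p).
Proof.
by move=> h0; rewrite mulrBr !mulNr mulrA mulVf // mul1r opprK addrC.
Qed.

(** Term by term differentiation. *)
Lemma cser_derive1 c : superdec c -> ((cser c)^`())%classic = cser (dcoef c).
Proof.
move=> sc; apply/funext => z; rewrite /derive1.
have [K K0 hK] := cser_taylor1 z sc.
apply: cvg_lim => //.
apply/cvgrPdist_lt => e e0.
have er : e \is Num.real by exact: gtr0_real.
have [x ex] := real_toC er; rewrite ex -(rmorph0 (@toC R)) toC_lt in e0.
have d0 : 0 < Num.min 1 (x / (K + 1)) by rewrite lt_min ltr01 divr_gt0 //; lra.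
have hn := near_cabs (0 : cplx R) d0; rewrite /dnbhs /= near_withinE.
apply: filterS hn => h; rewrite sub0r cabsN lt_min => /andP[h1 h2] hn0.
rewrite ex -toC_cabs toC_lt [h + z]addrC.
have ch0 : 0 < cabs h by rewrite lt_def cabs_ge0 cabs_eq0 hn0.
have -> : cser (dcoef c) z - h^-1 *: (cser c (z + h) - cser c z) =
  - h^-1 * (cser c (z + h) - cser c z - h * cser (dcoef c) z).
  move: (cser _ _) (cser _ _) (cser _ _) => p1 p2 p3.
  by rewrite /GRing.scale /= diff_quotient_rewrite.
rewrite cabsM cabsN.
have ci : cabs h^-1 * cabs h = 1 by rewrite -cabsM mulVf // -(rmorph1 (@toC R)) cabs_toC normr1.
have cih : 0 <= cabs h^-1 by exact: cabs_ge0.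
apply: le_lt_trans (_ : cabs h^-1 * (K * cabs h ^+ 2) < _).
  by rewrite ler_wpM2l // hK // ltW.
have -> : cabs h^-1 * (K * cabs h ^+ 2) = K * cabs h * (cabs h^-1 * cabs h) by ring.
rewrite ci mulr1; rewrite ltr_pdivlMr in h2; last by lra.
by apply: le_lt_trans h2; rewrite mulrC ler_wpM2l //; lra.
Qed.

Lemma cser_derive2 c : superdec c -> ((cser c)^`(2))%classic = cser (dcoef (dcoef c)).
Proof.
move=> sc; rewrite derive1nS derive1n1 cser_derive1 // cser_derive1 //.
exact: superdec_dcoef.
Qed.

Lemma eq_cser c c' : c =1 c' -> cser c = cser c'.
Proof. by move=> /funext ->. Qed.

Lemma cser_scale c (a b : R) z : superdec c ->
  cser (fun m => b * a ^+ m * c m) z = toC b * cser c (toC a * z).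
Proof.
move=> sc; apply: cvg_lim => //.
have -> : (fun n => ceval (psum (fun m => b * a ^+ m * c m) n) z) =
  (fun n => toC b * ceval (psum c n) (toC a * z)).
  apply/funext => n; rewrite !ceval_psum mulr_sumr; apply: eq_bigr => m _.
  by rewrite exprMn !rmorphM /= rmorphXn; ring.
by apply: cvgMr; exact: cser_superdec.
Qed.

(** The real function defined by the same power series. *)
Definition rser c (x : R) : R := limn (fun n => (psum c n).[x]).

Lemma cplx_cvg_toC (u : nat -> R) (l : cplx R) : (fun n => toC (u n)) @ \oo --> l ->
  u @ \oo --> complex.Re l /\ l = toC (complex.Re l).
Proof.
move=> cu; have cc := (cplx_cvgP _ _).1 cu.
have cRe : u @ \oo --> complex.Re l.
  apply/cvgrPdist_lt => e e0; have /cvgrPdist_lt/(_ e e0) := cc.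
  apply: filterS => n; rewrite sub0r normrN ger0_norm ?cabs_ge0 //.
  by apply: le_lt_trans; have := Re_le_cabs (l - toC (u n)); rewrite raddfB.
split => //; have cu2 : (fun n => toC (u n)) @ \oo --> toC (complex.Re l).
  apply/cplx_cvgP.
  have -> : (fun n => cabs (toC (complex.Re l) - toC (u n))) = (fun n => `|complex.Re l - u n|).
    by apply/funext => n; rewrite -rmorphB cabs_toC.
  have h : (fun n => `|complex.Re l - u n|) @ \oo --> `|complex.Re l - complex.Re l|.
    by apply: cvg_norm; apply: cvgB; [exact: cvg_cst|exact: cRe].
  by rewrite subrr normr0 in h.
by apply: (cvg_unique _ cu cu2).
Qed.

Lemma cser_toC c x : superdec c -> cser c (toC x) = toC (rser c x).
Proof.
move=> sc; have := @cser_superdec c (toC x) sc.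
have -> : (fun n => ceval (psum c n) (toC x)) = (fun n => toC (psum c n).[x]).
  by apply/funext => n; exact: ceval_toC.
move=> /cplx_cvg_toC[h ->]; congr toC; apply/esym; apply: cvg_lim => //.
Qed.

Lemma rser_tannery (P : nat -> {poly R}) c B x : superdec B ->
  (forall i m, `|(P i)`_m| <= `|B m|) -> (forall m, `|c m| <= `|B m|) ->
  (forall m, (fun i => (P i)`_m) @ \oo --> c m) ->
  (fun i => (P i).[x]) @ \oo --> rser c x.
Proof.
move=> sB hP hc cv; have sc := superdec_le sB hc.
have := @tannery_point P c B (toC x) sB hP hc cv.
have -> : (fun i => ceval (P i) (toC x)) = (fun i => toC (P i).[x]).
  by apply/funext => n; exact: ceval_toC.
by rewrite cser_toC // => /cplx_cvg_toC[].
Qed.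

Lemma rser_taylor1 c (x : R) : superdec c -> exists2 K : R, 0 <= K & forall h : R, `|h| <= 1 ->
  `|rser c (x + h) - rser c x - h * rser (dcoef c) x| <= K * h ^+ 2.
Proof.
move=> sc; have [K K0 hK] := @cser_taylor1 c (toC x) sc.
exists K => // h h1; have := hK (toC h); rewrite cabs_toC => /(_ h1).
rewrite -rmorphD !cser_toC //; last exact: superdec_dcoef.
by rewrite -rmorphM -!rmorphB cabs_toC real_normK ?num_real.
Qed.

End PowerSeries.

(** * Convergence of the greedy polynomials to theta *)

(** The coefficients of theta_q. *)
Definition thcoef {R : realType} (q : R) (m : nat) : R := (-1) ^+ m * q ^+ 'C(m, 2).

Section LogConcave.
Variable R : realType.
Implicit Types (f : {poly R}) (x y Y : R).

(** The logarithm of a real-rooted polynomial is concave on intervals without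
    roots: there the graph of log f lies below its tangent at y.  It suffices to
    treat the factors 1 - a x. *)
Lemma hyperbolic_log_concave f y Y : hyperbolic f -> f`_0 = 1 ->
  (forall x, Num.min y Y <= x <= Num.max y Y -> f.[x] != 0) ->
  0 < f.[Y] / f.[y] <= expR ((Y - y) * (f^`().[y] / f.[y])).
Proof.
move=> hf f0 noroot; have [ys ef] := hyperbolic_factor hf f0.
have fac a : a \in ys -> 0 < (1 - a * Y) / (1 - a * y).
  move=> ha; rewrite ltNge; apply/negP => hle.
  have fa x : a * x = 1 -> f.[x] = 0.
    move=> e; apply/eqP; rewrite ef horner_prod prodf_seq_eq0; apply/hasP; exists a => //=.
    by rewrite !hornerE e subrr.
  have ny : 1 - a * y != 0.
    apply/eqP => /eqP; rewrite subr_eq0 eq_sym => /eqP /fa /eqP; apply/negP/noroot.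
    by rewrite ge_min le_max lexx.
  have nY : 1 - a * Y != 0.
    apply/eqP => /eqP; rewrite subr_eq0 eq_sym => /eqP /fa /eqP; apply/negP/noroot.
    by rewrite ge_min le_max lexx !orbT.
  have prod : (1 - a * Y) * (1 - a * y) < 0.
    rewrite lt_neqAle mulf_neq0 //=.
    have -> : (1 - a * Y) * (1 - a * y) = (1 - a * Y) / (1 - a * y) * (1 - a * y) ^+ 2.
      by rewrite expr2 mulrA divfK.
    by rewrite mulr_le0_ge0 // sqr_ge0.
  have a0 : a != 0.
    by apply: contraTneq prod => ->; rewrite !mul0r subr0 mulr1 -leNgt ler01.
  suff hb : Num.min y Y <= a^-1 <= Num.max y Y.
    by have := noroot _ hb; rewrite fa ?mulfV // eqxx.
  (* a factor changing its sign between y and Y would have its root 1 / a in between *)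
  rewrite ge_min le_max.
  wlog ap : a y Y {ef f0 noroot ys ha hle fa ny nY hf} prod a0 / 0 < a.
    move=> W; have [h|h|h] := ltgtP 0 a; first exact: W.
      have := W (- a) (- y) (- Y); rewrite !mulrNN invrN !lerN2 oppr_eq0 oppr_gt0.
      by move=> /(_ prod a0 h) /andP[h1 h2]; rewrite h1 h2.
    by rewrite h eqxx in a0.
  have e1 x : (a^-1 <= x) = (1 - a * x <= 0).
    by rewrite subr_le0 -[X in X <= a * x](mulfV a0) ler_pM2l.
  have e2 x : (x <= a^-1) = (0 <= 1 - a * x).
    by rewrite subr_ge0 -[X in a * x <= X](mulfV a0) ler_pM2l.
  rewrite !e1 !e2; move: prod; move: (1 - a * Y) (1 - a * y) => A B.
  move=> AB; have [hA|hA] := leP A 0; have [hB|hB] := leP B 0.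
  - by move: AB; rewrite ltNge mulr_le0.
  - by rewrite (ltW hB).
  - by rewrite (ltW hA) orbT.
  - by move: AB; rewrite ltNge mulr_ge0 // ltW.
rewrite {}ef {hf f0 noroot}.
suff [] : \prod_(a <- ys) (1 - a *: 'X).[y] != 0 /\
  0 < \prod_(a <- ys) (1 - a *: 'X).[Y] / \prod_(a <- ys) (1 - a *: 'X).[y] <=
   expR ((Y - y) * ((\prod_(a <- ys) (1 - a *: 'X))^`().[y] / \prod_(a <- ys) (1 - a *: 'X).[y])).
  by rewrite -!horner_prod.
elim: ys fac => [|a ys IH] fac.
  by rewrite !big_nil derivC horner0 divr1 mul0r mulr0 expR0 oner_neq0 ltr01 lexx.
have [|n0 /andP[g0 g1]] := IH.
  by move=> b hb; apply: fac; rewrite inE hb orbT.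
have f0 := fac a (mem_head _ _).
rewrite !big_cons derivM !hornerE derivB derivC derivZ derivX !hornerE.
set P := \prod_(j <- ys) (1 - j *: 'X).[y] in n0 g0 g1 *.
set Q := \prod_(j <- ys) (1 - j *: 'X).[Y] in g0 g1 *.
rewrite horner_prod -/P.
set D := (deriv _).[y] in g1 *.
have ny : 1 - a * y != 0 by apply: contraTneq f0 => ->; rewrite invr0 mulr0 ltxx.
split; first by rewrite mulf_neq0.
have -> : (1 - a * Y) * Q / ((1 - a * y) * P) = (1 - a * Y) / (1 - a * y) * (Q / P).
  by field; rewrite n0 ny.
rewrite mulr_gt0 //=.
have -> : (Y - y) * (- a * P + (1 - a * y) * D) / ((1 - a * y) * P) =
   (Y - y) * (- a / (1 - a * y)) + (Y - y) * (D / P) by field; rewrite n0 ny.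
rewrite expRD; apply: ler_pM => //; try exact: ltW.
have -> : (1 - a * Y) / (1 - a * y) = 1 + (Y - y) * (- a / (1 - a * y)) by field.
exact: expR_ge1Dx.
Qed.

End LogConcave.

Section ThetaSeries.
Variable R : realType.
Implicit Types (q x y : R) (lam : nat -> R).
Local Notation l := (lamstar R).
Local Notation F := (theta (lamstar R)).
Local Notation ts := (@tstar R).
Local Notation Rg := (Rp (@glam R)).

(** The common majorant of the coefficients. *)
Definition base3 (m : nat) : R := (1/3) ^+ 'C(m, 2).

Lemma base3_norm m : `|base3 m| = base3 m.
Proof. by rewrite ger0_norm // exprn_ge0 //; lra. Qed.

Lemma thcoef_le q m : 0 <= q <= 1/3 -> `|thcoef q m| <= `|base3 m|.
Proof.
move=> /andP[q0 q1]; rewrite base3_norm normrM normrX normrN normr1 expr1n mul1r.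
by rewrite normrX ger0_norm // lerXn2r // ?nnegrE //; lra.
Qed.

Lemma superdec_thcoef q : 0 <= q <= 1/3 -> superdec (thcoef q).
Proof.
by move=> hq; apply: (superdec_le (@superdec_base R)) => m; exact: thcoef_le.
Qed.

Lemma thcoefS q m : thcoef q m.+1 = - (q ^+ m * thcoef q m).
Proof. by rewrite /thcoef binS bin1 exprD exprS; ring. Qed.

Lemma coef_greedy_cvg m : (fun i => (Rg i)`_m) @ \oo --> thcoef l m.
Proof.
elim: m => [|m IH].
  under eq_fun do rewrite coef_Rp0.
  by rewrite /thcoef expr0 mulr1; exact: cvg_cst.
rewrite -(cvg_shiftS (fun i => (Rg i)`_m.+1)).
have -> : [sequence (Rg n.+1)`_m.+1]_n = (fun n => - (glam n ^+ m * (Rg n)`_m)).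
  by apply/funext => n /=; rewrite coef_RpS.
rewrite thcoefS; apply: cvgN; apply: cvgM => //.
by apply: cvg_pow; exact: glam_cvg.
Qed.

Lemma coef_cst_cvg q m : (fun i => (Rp (fun=> q) i)`_m) @ \oo --> thcoef q m.
Proof.
apply/cvgrPdist_lt => e e0; exists m => // i hi.
by rewrite coef_Rp_cst ifT // /thcoef subrr normr0.
Qed.

Lemma theta_rser q x : 0 <= q <= 1/3 -> theta q x = rser (thcoef q) x.
Proof.
move=> hq; apply: cvg_lim => //.
apply: (rser_tannery (@superdec_base R)) => [i m|m|m].
- by rewrite -/(base3 m) base3_norm; exact: coef_Rp_bound.
- exact: thcoef_le.
- exact: coef_cst_cvg.
Qed.

Lemma greedy_cvg x : (fun i => (Rg i).[x]) @ \oo --> F x.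
Proof.
have hl := lamstar13 R; rewrite theta_rser //.
apply: (rser_tannery (@superdec_base R)) => [i m|m|m].
- by rewrite -/(base3 m) base3_norm; apply: coef_Rp_bound; exact: glam13.
- exact: thcoef_le.
- exact: coef_greedy_cvg.
Qed.

(** The derivative of theta_q, defined by its power series. *)
Definition theta1 q x : R := rser (dcoef (thcoef q)) x.

Lemma dcoef_norm (c : nat -> R) m : `|dcoef c m| = m.+1%:R * `|c m.+1|.
Proof. by rewrite /dcoef normrM normr_nat. Qed.

Lemma deriv_cvg (P : nat -> {poly R}) c x : (forall i m, `|(P i)`_m| <= base3 m) ->
  (forall m, `|c m| <= base3 m) -> (forall m, (fun i => (P i)`_m) @ \oo --> c m) ->
  (fun i => (P i)^`().[x]) @ \oo --> rser (dcoef c) x.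
Proof.
move=> hP hc cv; apply: (rser_tannery (superdec_dcoef (@superdec_base R))) => [i m|m|m].
- have -> : `|(P i)^`()`_m| = m.+1%:R * `|(P i)`_m.+1| by rewrite coef_deriv normrMn mulr_natl.
  by rewrite dcoef_norm ler_wpM2l // -/(base3 m.+1) base3_norm.
- by rewrite !dcoef_norm ler_wpM2l // -/(base3 m.+1) base3_norm.
- under eq_fun do rewrite coef_deriv -mulr_natl.
  by apply: cvgMr; exact: cv.
Qed.

Lemma greedy_deriv_cvg x : (fun i => (Rg i)^`().[x]) @ \oo --> theta1 l x.
Proof.
apply: deriv_cvg => [i m|m|m].
- by apply: coef_Rp_bound; exact: glam13.
- by rewrite -base3_norm; apply: thcoef_le; exact: lamstar13.
- exact: coef_greedy_cvg.
Qed.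

Lemma cst_deriv_cvg q x : 0 <= q <= 1/3 ->
  (fun i => (Rp (fun=> q) i)^`().[x]) @ \oo --> theta1 q x.
Proof.
move=> hq; apply: deriv_cvg => [i m|m|m].
- exact: coef_Rp_bound.
- by rewrite -base3_norm; exact: thcoef_le.
- exact: coef_cst_cvg.
Qed.

Lemma Rp_deriv lam k x : (Rp lam k.+1)^`().[x] =
  - (Rp lam k).[lam k * x] - lam k * x * (Rp lam k)^`().[lam k * x].
Proof.
rewrite /= derivB derivC derivM derivX deriv_comp derivZ derivX.
rewrite alg_polyC sub0r mul1r hornerN hornerD !hornerM !horner_comp hornerZ hornerX hornerC; ring.
Qed.

Lemma theta1_rec q x : 0 <= q <= 1/3 ->
  theta1 q x = - theta q (q * x) - q * x * theta1 q (q * x).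
Proof.
move=> hq; have c := @cst_deriv_cvg q x hq.
have c2 : (fun i => (Rp (fun=> q) i.+1)^`().[x]) @ \oo -->
   - theta q (q * x) - q * x * theta1 q (q * x).
  under eq_fun do rewrite Rp_deriv.
  apply: cvgB; first by apply: cvgN; exact: theta_cvg.
  by apply: cvgMr; exact: cst_deriv_cvg.
have c1 : (fun i => (Rp (fun=> q) i.+1)^`().[x]) @ \oo --> theta1 q x.
  by rewrite (cvg_shiftS (fun i => (Rp (fun=> q) i)^`().[x])).
exact: (cvg_unique _ c1 c2).
Qed.

Lemma theta_taylor1 q x : 0 <= q <= 1/3 -> exists2 K : R, 0 <= K & forall h : R, `|h| <= 1 ->
  `|theta q (x + h) - theta q x - h * theta1 q x| <= K * h ^+ 2.
Proof.
move=> hq; have [K K0 hK] := rser_taylor1 x (superdec_thcoef hq).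
by exists K => // h h1; rewrite !theta_rser //; exact: hK.
Qed.

(** The derivative of t theta_l(t) vanishes at the maximum. *)
Lemma tstar_crit : F ts + ts * theta1 l ts = 0.
Proof.
have hl3 := lamstar13 R; have hl := lamstar_bounds R; have tb := tstar_bounds R.
have [_ et] := tstarP R.
have [K K0 hK] := theta_taylor1 ts hl3.
set A := F ts + _.
(* compare with the values at ts + h, for small h of both signs *)
have key h : `|h| <= 1/10 -> h * A <= (2 * K + `|theta1 l ts|) * h ^+ 2.
  move=> hh; have /ler_normlP[h1 h2] : `|h| <= 1/10 by [].
  have m := @lamstar_max R (ts + h) ltac:(lra).
  have /ler_normlP[k1 k2] := hK h ltac:(lra).
  have k3 : (ts + h) * (F (ts + h) - F ts - h * theta1 l ts) >= - (2 * (K * h ^+ 2)).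
    have q0 : 0 <= K * h ^+ 2 by rewrite mulr_ge0 ?sqr_ge0.
    have p0 : 0 <= ts + h <= 2 by lra.
    move: k1 q0 p0; move: (F (ts + h) - F ts - h * theta1 l ts) (K * h ^+ 2) (ts + h) => b a c.
    by clear; nra.
  have k4 : - h ^+ 2 * theta1 l ts <= `|theta1 l ts| * h ^+ 2.
    by rewrite mulNr -mulrN mulrC ler_wpM2r ?sqr_ge0 // -normrN ler_norm.
  move: m k3 k4 et; rewrite /A.
  move: `|theta1 l ts| (theta1 l ts) (F (ts + h)) (F ts) l => a b c d e; clear.
  by move=> m k3 k4 et; lra.
set B := 2 * K + _ in key.
have B0 : 0 <= B by rewrite /B addr_ge0 // mulr_ge0.
have key2 e : 0 < e <= 1/10 -> `|A| <= B * e.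
  move=> he; have := key e; have := key (- e); rewrite normrN ger0_norm; last by lra.
  move=> /(_ ltac:(lra)) h1 /(_ ltac:(lra)) h2.
  have e0 : 0 < e by lra.
  rewrite ler_norml; apply/andP; split; rewrite -(ler_pM2l e0); move: h1 h2; rewrite sqrrN;
    move: (A) (B) (e); clear => a b c h1 h2; lra.
apply/eqP; rewrite -normr_eq0 eq_le normr_ge0 andbT leNgt; apply/negP => hA.
have := key2 (Num.min (1/10) (`|A| / (2 * (B + 1)))).
have d0 : 0 < `|A| / (2 * (B + 1)) by rewrite divr_gt0 // mulr_gt0 //; lra.
rewrite lt_min d0 andbT ge_min lexx /= => /(_ ltac:(lra)) h1.
have h2 : B * Num.min (1/10) (`|A| / (2 * (B + 1))) <= B * (`|A| / (2 * (B + 1))).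
  by rewrite ler_wpM2l // ge_min lexx orbT.
have h3 : B * (`|A| / (2 * (B + 1))) <= `|A| / 2.
  rewrite mulrA ler_pdivrMr; last by lra.
  have -> : `|A| / 2 * (2 * (B + 1)) = `|A| * (B + 1) by field.
  by rewrite [B * _]mulrC ler_wpM2l //; lra.
have := le_trans h1 (le_trans h2 h3); lra.
Qed.

End ThetaSeries.

(** * The double zero of theta *)

Section DoubleZero.
Variable R : realType.
Implicit Types (q x y Y : R) (lam : nat -> R).
Local Notation l := (lamstar R).
Local Notation F := (theta (lamstar R)).
Local Notation ts := (@tstar R).
Local Notation Rg := (Rp (@glam R)).
Local Notation altpt := (@altpt R).

Lemma altpt_mono i j k : (j <= k)%N -> (k.+2 <= i)%N -> altpt i j <= altpt i k :> R.
Proof.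
elim: k => [|k IH]; first by rewrite leqn0 => /eqP ->.
rewrite leq_eqVlt => /orP[/eqP -> //|hj] hk.
exact: le_trans (IH hj (ltnW hk)) (ltW (altpt_lt R hk)).
Qed.

Lemma altpt_ge i k : (k.+2 <= i)%N -> k.+1%:R <= altpt i k :> R.
Proof.
elim: i k => [//|[//|i] IH] [|k] hk.
  by have := @altpt_ge3 R _ _ hk; lra.
have h := IH k hk; have g0 := glam_gt0 R i; have g3 := glam13 R i.+1.
rewrite altptSS ler_pdivlMr //.
have e : k.+2%:R = k.+1%:R + 1 :> R by rewrite -[k.+2]addn1 natrD.
have k1 : 1 <= k.+1%:R :> R by rewrite ler1n.
by rewrite e; nra.
Qed.

Lemma greedy_roots n : exists rs : seq R,
  (forall k, (k < n)%N -> altpt n.+2 k < rs`_k < altpt n.+2 k.+1) /\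
  (forall x, (Rg n.+2).[x] = 0 <-> x = rho n.+2 \/ exists2 k, (k < n)%N & x = rs`_k).
Proof.
have [c [rs [c0 srs hrs e]]] := greedy_factor R n; exists rs; split => // x.
rewrite e hornerZ hornerM horner_exp hornerXsubC horner_prod; split => [/eqP|[->|[k hk ->]]].
- rewrite mulf_eq0 (negbTE c0) /= mulf_eq0 sqrf_eq0 subr_eq0 => /orP[/eqP|]; first by left.
  rewrite prodf_seq_eq0 => /hasP[r hr]; rewrite /= hornerXsubC subr_eq0 => /eqP ->.
  by right; exists (index r rs); rewrite ?nth_index // -srs index_mem.
- by rewrite subrr expr0n /= mul0r mulr0.
- rewrite (big_nth 0) big_mkord srs (bigD1 (Ordinal hk)) //= hornerXsubC subrr.
  by rewrite mul0r !mulr0.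
Qed.

Lemma greedy_noroot n x : 0 <= x < rho n.+2 -> (Rg n.+2).[x] != 0.
Proof.
move=> /andP[x0 xr]; have [rs [hrs root]] := greedy_roots n.
apply/eqP => /root[e|[k hk e]]; first by rewrite e ltxx in xr.
have h := rho_lt_altpt R n; have /andP[h1 _] := hrs k hk.
have := @altpt_mono n.+2 0 k isT ltac:(by rewrite !ltnS ltnW).
by move: xr; rewrite e => xr h2; have := lt_trans (lt_le_trans (lt_trans xr h) h2) h1; rewrite ltxx.
Qed.

(** To the right of the double root of the greedy R_(n+2), a point y at which this
    polynomial is positive is not separated by a root from a sign-alternating point
    Y of even index, at which the value is at least 1. *)
Lemma greedy_test_point n y (f := Rg n.+2) : rho n.+2 < y -> y <= altpt n.+2 n -> 0 < f.[y] ->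
  exists2 Y, 3 <= Y & 1 <= f.[Y] <= f.[y] * expR ((Y - y) * (f^`().[y] / f.[y])).
Proof.
move=> hr hy fy; have [rs [hrs root]] := greedy_roots n.
suff [j hj hno] : exists2 j, (j <= n)%N & forall x,
    Num.min y (altpt n.+2 j) <= x <= Num.max y (altpt n.+2 j) -> f.[x] != 0.
  exists (altpt n.+2 j); first exact: altpt_ge3.
  have /andP[] := hyperbolic_log_concave (@hyperbolic_greedy R n.+1) (coef_Rp0 _ _) hno.
  rewrite ler_pdivrMr // pmulr_lgt0 ?invr_gt0 // -/f => fY hle.
  rewrite mulrC hle andbT; have := @altpt_sign R n.+2 j hj.
  rewrite -signr_odd; case: odd; rewrite ?expr1 ?mulN1r ?expr0 ?mul1r // -/f; lra.
have [h|h] := leP y (altpt n.+2 0).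
  exists 0%N => // x; rewrite (min_idPl h) (max_idPr h) => /andP[x1 x2].
  apply/eqP => /root[e|[k hk e]]; first by rewrite -e in hr; have := lt_le_trans hr x1; rewrite ltxx.
  have /andP[h1 _] := hrs k hk; have h2 := @altpt_mono n.+2 0 k isT ltac:(by rewrite !ltnS ltnW).
  by move: x2; rewrite e leNgt (le_lt_trans h2 h1).
(* y lies between two consecutive sign-alternating points, with one root in between *)
have [k [hk k1 k2]] : exists k, [/\ (k < n)%N, altpt n.+2 k < y & y <= altpt n.+2 k.+1].
  suff: forall m, y <= altpt n.+2 m -> (m <= n)%N -> exists k, [/\ (k < n)%N, altpt n.+2 k < y & y <= altpt n.+2 k.+1].
    by move=> /(_ n); exact.
  elim=> [|m IH] hm; first by rewrite leNgt h in hm.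
  have [h1|h1] := leP y (altpt n.+2 m); first by move=> /ltnW; exact: IH.
  by move=> hmn; exists m.
have /andP[r1 r2] := hrs k hk.
have others x : altpt n.+2 k <= x <= altpt n.+2 k.+1 -> f.[x] = 0 -> x = rs`_k.
  move=> /andP[x1 x2] /root[e|[j hj e]].
    have := rho_lt_altpt R n; have h2 := @altpt_mono n.+2 0 k isT ltac:(by rewrite !ltnS ltnW).
    by rewrite -e => h3; have := lt_le_trans h3 (le_trans h2 x1); rewrite ltxx.
  have /andP[s1 s2] := hrs j hj; case: (ltngtP j k) e => [hjk|hjk|->//] e.
    have := @altpt_mono n.+2 j.+1 k hjk ltac:(by rewrite !ltnS ltnW).
    by rewrite leNgt (le_lt_trans x1) // e.
  have := @altpt_mono n.+2 k.+1 j hjk ltac:(by rewrite !ltnS ltnW).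
  by rewrite leNgt (lt_le_trans s1) // -e.
have yr : y != rs`_k.
  apply: contraTneq fy => e; have -> : f.[y] = 0 by apply/root; right; exists k.
  by rewrite ltxx.
have [h1|h1] := ltP y rs`_k.
  exists k; first exact: ltnW.
  move=> x; rewrite (min_idPr (ltW k1)) (max_idPl (ltW k1)) => /andP[x1 x2].
  apply/eqP => /others; rewrite x1 (le_trans x2 k2) => /(_ isT) e.
  by move: h1; rewrite -e ltNge x2.
have h2 : rs`_k < y by rewrite lt_neqAle eq_sym yr.
exists k.+1 => // x; rewrite (min_idPl k2) (max_idPr k2) => /andP[x1 x2].
apply/eqP => /others; rewrite x2 (le_trans (ltW k1) x1) => /(_ isT) e.
by move: h2; rewrite -e ltNge x1.
Qed.

(** ** The maximum of t theta(t) *)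

Lemma theta_tstar : F ts = l / ts.
Proof.
have [_ e] := tstarP R; have tb := tstar_bounds R.
have t0 : ts != 0 by apply: lt0r_neq0; lra.
by apply: (mulfI t0); rewrite e mulrCA divff ?mulr1.
Qed.

Lemma theta1_tstar : theta1 l ts = - (F ts / ts).
Proof.
have := tstar_crit R; have tb := tstar_bounds R => h.
have t0 : ts != 0 by apply: lt0r_neq0; lra.
by apply: (mulfI t0); rewrite mulrN mulrCA divff // mulr1; lra.
Qed.

(** Log-concavity of the greedy R_i on [0, rho_i), in the limit and with the
    tangent at [tstar], whose slope is - 1 / tstar because t theta_l(t) is
    critical there. *)
Lemma theta_concave Y : 0 <= Y -> (exists N, forall i, (N <= i)%N -> Y < rho i.+2) ->
  F Y <= F ts * expR (1 - Y / ts).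
Proof.
move=> Y0 [N hN]; have tb := tstar_bounds R; have hl := lamstar_bounds R.
have t0 : ts != 0 by apply: lt0r_neq0; lra.
have F0 : 0 < F ts by rewrite theta_tstar divr_gt0 //; lra.
have Fn : F ts != 0 by exact: lt0r_neq0.
have c1 : (fun i => (Rg (i + N).+2).[Y] / (Rg (i + N).+2).[ts]) @ \oo --> F Y / F ts.
  have c := @greedy_cvg R Y; have c' := @greedy_cvg R ts.
  rewrite -(cvg_shiftn N.+2) in c; rewrite -(cvg_shiftn N.+2) in c'.
  under eq_fun do rewrite -!addnS.
  by apply: cvgM => //; exact: cvgV.
have c2 : (fun i => expR ((Y - ts) * ((Rg (i + N).+2)^`().[ts] / (Rg (i + N).+2).[ts]))) @ \oo -->
    expR (1 - Y / ts).
  have -> : 1 - Y / ts = (Y - ts) * (theta1 l ts / F ts).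
    by rewrite theta1_tstar; field; rewrite t0 Fn.
  have c := @greedy_deriv_cvg R ts; have c' := @greedy_cvg R ts.
  rewrite -(cvg_shiftn N.+2) in c; rewrite -(cvg_shiftn N.+2) in c'.
  under eq_fun do rewrite -!addnS.
  apply: continuous_cvg; first exact: continuous_expR.
  by apply: cvgMr; apply: cvgM => //; exact: cvgV.
rewrite mulrC -ler_pdivrMr //; apply: (le_cvg c1 c2) => i.
have r1 := @rho_ge1 R (i + N).+1.
suff hno x : Num.min ts Y <= x <= Num.max ts Y -> (Rg (i + N).+2).[x] != 0.
  by have /andP[] := hyperbolic_log_concave (@hyperbolic_greedy R (i + N).+1) (coef_Rp0 _ _) hno.
 rewrite ge_min le_max => /andP[x1 x2]; apply: greedy_noroot; apply/andP; split.
  by case/orP: x1; apply: le_trans => //; lra.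
case/orP: x2 => h; apply: le_lt_trans h _; first lra.
by apply: hN; rewrite leq_addl.
Qed.

Lemma expR_gap (z : R) : 0 <= z <= 4 -> (z - 1) ^+ 2 <= 34 * (1 - z * expR (1 - z)).
Proof.
move=> hz; set E := expR (1 - z).
have E0 : 0 < E by exact: expR_gt0.
have hE : E * (z + (z - 1) ^+ 2 / 4) <= 1.
  have e : E * expR ((z - 1) / 2) ^+ 2 = 1.
    by rewrite /E expr2 -!expRD -[RHS]expR0; congr expR; field.
  have h := @expR_ge1Dx R ((z - 1) / 2).
  rewrite -[leRHS]e ler_pM2l //.
  have -> : z + (z - 1) ^+ 2 / 4 = (1 + (z - 1) / 2) ^+ 2 by field.
  by rewrite lerXn2r ?nnegrE //; lra.
have [h|h] := leP E (1/8).
  have : z * E <= 1/2 by nra.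
  by nra.
have h3 : (z - 1) ^+ 2 * (1/8) <= (z - 1) ^+ 2 * E by rewrite ler_wpM2l ?sqr_ge0 // ltW.
have h4 : 0 <= (z - 1) ^+ 2 by exact: sqr_ge0.
by move: h3 h4 hE; move: (E) ((z - 1) ^+ 2) => a b; clear => h3 h4 hE; lra.
Qed.

(** Quantitative uniqueness of the maximum of t theta_l(t). *)
Lemma theta_gap Y : 0 <= Y <= 4 * ts -> (exists N, forall i, (N <= i)%N -> Y < rho i.+2) ->
  (Y / ts - 1) ^+ 2 <= 120 * (l - Y * F Y).
Proof.
move=> hY hN; have tb := tstar_bounds R; have hl := lamstar_bounds R.
have t0 : 0 < ts by lra.
have h := @theta_concave Y ltac:(lra) hN.
have hz : 0 <= Y / ts <= 4 by rewrite divr_ge0 ?ler_pdivrMr //; lra.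
have g := expR_gap hz.
have h2 : Y * F Y <= l * (Y / ts * expR (1 - Y / ts)).
  have -> : l * (Y / ts * expR (1 - Y / ts)) = Y * (F ts * expR (1 - Y / ts)).
    by rewrite theta_tstar; field; rewrite gt_eqF.
  by rewrite ler_wpM2l //; lra.
have q0 : 0 <= (Y / ts - 1) ^+ 2 by exact: sqr_ge0.
move: g h2 q0 hl; move: (_ ^+ 2) (_ * expR _) (Y * F Y) => a b c; clear; nra.
Qed.

Lemma argmax_cvg : (fun k => argmax01 (greedy k.+1)) @ \oo --> ts.
Proof.
have tb := tstar_bounds R; have hl3 := lamstar13 R.
have t0 : 0 < ts by lra.
have key k : (argmax01 (greedy k.+1) - ts) ^+ 2 <= 120 * (9/10) ^+ k.+1.
  set a := argmax01 _; have /andP[a0 a1] := argmax01_lt1 R k.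
  have [_ eg _] := glamP R k; rewrite -/a in a0 a1 eg.
  have [_ _ _ /(_ a ltac:(lra)) hF] := greedy_comparison R k.
  have /andP[_ gc] := @glam_close R k.
  have := @theta_gap a ltac:(lra).
  have -> : (a / ts - 1) ^+ 2 = (a - ts) ^+ 2 / ts ^+ 2 by field; rewrite gt_eqF.
  move=> /(_ _) hg.
  have hh : (a - ts) ^+ 2 / ts ^+ 2 <= 120 * (l - a * F a).
    by apply: hg; exists 0%N => i _; exact: lt_le_trans a1 (@rho_ge1 R i.+1).
  have h1 : 120 * (l - a * F a) <= 120 * (9/10) ^+ k.+1.
    rewrite ler_pM2l; last lra.
    have : a * (Rg k.+1).[a] <= a * F a by rewrite ler_wpM2l // ltW.
    by rewrite -eg; lra.
  apply: le_trans (le_trans hh h1); rewrite ler_peMr ?sqr_ge0 //.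
  by rewrite invf_ge1 ?exprn_gt0 // exprn_ile1 //; lra.
apply/cvgrPdist_lt => e e0.
have c : (fun k => 120 * (9/10) ^+ k.+1) @ \oo --> (0 : R).
  rewrite -(mulr0 120); apply: cvgMr.
  by rewrite (cvg_shiftS (fun k => (9/10 : R) ^+ k)); exact: cvg_pow_910.
have e2 : 0 < e ^+ 2 by rewrite exprn_gt0.
have [N _ hN] := cvgr_lt _ c _ e2; exists N => // k /hN hk.
rewrite -(@ltr_pXn2r _ 2) ?nnegrE // ?ltW // -normrX ger0_norm ?sqr_ge0 //.
by rewrite -sqrrN opprB; exact: le_lt_trans (key k) hk.
Qed.

(** The limit of the double zeros rho_k. *)
Definition xstar : R := ts / l.

Lemma rho_cvg : (fun k => rho k.+2) @ \oo --> xstar.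
Proof.
rewrite /rho; apply: cvgM; first exact: argmax_cvg.
apply: cvgV; first by apply: lt0r_neq0; have := lamstar_bounds R; lra.
by rewrite (cvg_shiftS (@glam R)); exact: glam_cvg.
Qed.

Lemma xstar_ge1 : 1 <= xstar.
Proof.
have c1 : (fun=> 1 : R) @ \oo --> (1 : R) by exact: cvg_cst.
by apply: (le_cvg c1 rho_cvg) => k; exact: rho_ge1.
Qed.

(** Between 0 and xstar, the value l is taken by t theta_l(t) at [tstar] only. *)
Lemma theta_strict Y : 0 <= Y < xstar -> Y != ts -> Y * F Y < l.
Proof.
move=> /andP[Y0 Yx] Yn; have tb := tstar_bounds R; have hl := lamstar_bounds R.
have h4 : Y <= 4 * ts.
  apply/ltW/(lt_le_trans Yx); rewrite /xstar ler_pdivrMr; last lra.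
  by nra.
have := @theta_gap Y ltac:(by rewrite Y0 h4) _.
have [N _ hN] := cvgr_gt _ rho_cvg _ Yx.
move=> /(_ (ex_intro _ N (fun i hi => hN i hi))) h.
have t0 : ts != 0 by apply: lt0r_neq0; lra.
have : 0 < (Y / ts - 1) ^+ 2.
  rewrite exprn_even_gt0 //= subr_eq0; apply: contra_neq Yn => e.
  by rewrite -[LHS](divfK t0) e mul1r.
lra.
Qed.

Lemma xstar_double : F xstar = 0 /\ theta1 l xstar = 0.
Proof.
have hl3 := lamstar13 R; have hl := lamstar_bounds R; have tb := tstar_bounds R.
have e : l * xstar = ts by rewrite /xstar mulrCA divff ?mulr1 //; apply: lt0r_neq0; lra.
have t0 : ts != 0 by apply: lt0r_neq0; lra.
rewrite (theta_rec _ hl3) (theta1_rec _ hl3) e; split.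
  by rewrite theta_tstar /xstar; field; rewrite t0 lt0r_neq0 //; lra.
by have := tstar_crit R; lra.
Qed.

Lemma Rp_deriv2 lam k x : (Rp lam k.+1)^`()^`().[x] =
  - (2 * lam k * (Rp lam k)^`().[lam k * x]) - lam k ^+ 2 * x * (Rp lam k)^`()^`().[lam k * x].
Proof.
rewrite /= derivB derivC derivM derivX sub0r derivN derivD mul1r.
rewrite deriv_comp derivZ derivX alg_polyC !derivM derivX deriv_comp derivZ derivX alg_polyC derivC.
rewrite !mulr0 addr0 mul1r hornerN !hornerD !hornerM.
by rewrite !horner_comp hornerZ hornerX hornerC; ring.
Qed.

Lemma Rp_deriv_bound q k x : 0 <= q <= 1/3 -> 0 <= x <= 1 ->
  -1 <= (Rp (fun=> q) k)^`().[x] <= 0.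
Proof.
move=> hq; elim: k x => [|k IH] x hx; first by rewrite derivC horner0; lra.
have hy : 0 <= q * x <= 1/3 by nra.
have := IH (q * x) ltac:(lra); have := @Rp_bound R (fun=> q) k (q * x) (fun=> hq) ltac:(lra).
rewrite Rp_deriv; move: (_.[_]) (_.[_]) => a b h1 h2.
by move: h1 h2 hy; move: (q * x) => y; clear; nra.
Qed.

Lemma Rp_deriv2_bound q k x : 0 <= q <= 1/3 -> 0 <= x <= 1 ->
  `|(Rp (fun=> q) k)^`()^`().[x]| <= 9/4 * q.
Proof.
move=> hq; elim: k x => [|k IH] x hx; first by rewrite !derivC horner0 normr0; lra.
have hy : 0 <= q * x <= 1/3 by nra.
have := IH (q * x) ltac:(lra); have := @Rp_deriv_bound q k (q * x) hq ltac:(lra).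
rewrite Rp_deriv2 !ler_norml; move: (_.[_]) (_.[_]) => a b h1 h2.
have h3 : 0 <= q ^+ 2 * x <= 1/9 by rewrite expr2 -mulrA; nra.
by move: h1 h2 h3 hq; move: (q ^+ 2 * x) => y; clear => h1 /andP[h2 h2'] h3 hq; nra.
Qed.

(** The zero xstar of theta_l has multiplicity exactly two.  The second derivative
    is obtained from the recursion, which expresses it through the first two
    derivatives at l xstar = tstar. *)
Lemma xstar_deriv2 : rser (dcoef (dcoef (thcoef l))) xstar != 0.
Proof.
have hl3 := lamstar13 R; have hl := lamstar_bounds R; have tb := tstar_bounds R.
have e : l * xstar = ts by rewrite /xstar mulrCA divff ?mulr1 //; apply: lt0r_neq0; lra.
have B := @superdec_base R.
have c1 : (fun i => (Rp (fun=> l) i.+1)^`()^`().[xstar]) @ \oo -->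
    rser (dcoef (dcoef (thcoef l))) xstar.
  rewrite (cvg_shiftS (fun i => (Rp (fun=> l) i)^`()^`().[xstar])).
  have E i m : `|(Rp (fun=> l) i)^`()^`()`_m| =
      m.+1%:R * (m.+2%:R * `|(Rp (fun=> l) i)`_m.+2|).
    by rewrite !coef_deriv !normrMn !mulr_natl.
  apply: (rser_tannery (superdec_dcoef (superdec_dcoef B))) => [i m|m|m].
  - rewrite E !dcoef_norm !ler_wpM2l // -/(base3 _ m.+2) base3_norm.
    by apply: coef_Rp_bound.
  - by rewrite !dcoef_norm !ler_wpM2l //; exact: thcoef_le.
  - have E2 i : (Rp (fun=> l) i)^`()^`()`_m = m.+1%:R * (m.+2%:R * (Rp (fun=> l) i)`_m.+2).
      by rewrite !coef_deriv !mulr_natl.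
    by under eq_fun do rewrite E2; apply: cvgMr; apply: cvgMr; exact: coef_cst_cvg.
have c2 : (fun i => - (2 * l * (Rp (fun=> l) i)^`().[ts]) - 9/4 * l ^+ 2 * ts) @ \oo -->
    - (2 * l * theta1 l ts) - 9/4 * l ^+ 2 * ts.
  apply: cvgB; last exact: cvg_cst.
  by apply: cvgN; apply: cvgMr; exact: cst_deriv_cvg.
apply: lt0r_neq0; apply: lt_le_trans (le_cvg c2 c1 _); last first.
  move=> k; rewrite Rp_deriv2 e lerD2l.
  have := @Rp_deriv2_bound l k ts hl3 ltac:(lra); rewrite ler_norml.
  have -> : l ^+ 2 * xstar = l * ts by rewrite -e; ring.
  have q0 : 0 <= l * ts by nra.
  move: q0; move: (_.[_]) => b q0 /andP[b1 b2].
  have : l * ts * b <= l * ts * (9/4 * l) by rewrite ler_wpM2l.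
  by move=> h; rewrite lerN2; apply: le_trans h _; lra.
rewrite theta1_tstar theta_tstar.
have t0 : 0 < ts by lra.
have -> : - (2 * l * - (l / ts / ts)) - 9/4 * l ^+ 2 * ts = l ^+ 2 / ts ^+ 2 * (2 - 9/4 * ts ^+ 3).
  by field; rewrite gt_eqF.
rewrite mulr_gt0 ?divr_gt0 ?exprn_gt0 //; try lra.
have : ts ^+ 3 <= (9/10) ^+ 3 by rewrite lerXn2r ?nnegrE //; lra.
lra.
Qed.

Lemma expR_3half_le8 : expR (3/2 : R) <= 8.
Proof.
have e1 : expR (3/2 : R) * expR (- (1/2)) ^+ 3 = 1.
  by rewrite !exprS expr0 mulr1 -!expRD -[RHS]expR0; congr expR; field.
have h0 : 1/2 <= expR (- (1/2) : R) by have := @expR_ge1Dx R (- (1/2)); lra.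
have h9 : (1/2) ^+ 3 <= expR (- (1/2) : R) ^+ 3 by rewrite lerXn2r ?nnegrE //; lra.
have := @expR_gt0 R (3/2).
by move: e1 h9; move: (expR (3/2)) (_ ^+ 3) => a b; clear; nra.
Qed.

(** The numerical contradiction in [theta_double_unique]: at a double zero x the
    values r and d of R_i and of its logarithmic derivative at y = l x are close to
    l / y and - 1 / y, which is too small for the test point Y. *)
Lemma test_point_contradiction y Y d r : 0 < y -> 3 <= Y -> 0 < r -> r < (if 3 < y then 1/9 else 1) ->
  - (3/2 * y^-1) < d -> d < 0 -> r * expR ((Y - y) * d) < 1.
Proof.
move=> y0 Y3 H2 H3 H4 H5.
have [hYy|hYy] := leP y Y.
  have h6 : expR ((Y - y) * d) <= 1 by rewrite expR_le1 mulr_ge0_le0 ?subr_ge0 // ltW.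
  apply: (@le_lt_trans _ _ (r * 1)); first by rewrite ler_pM2l.
  by rewrite mulr1; apply: lt_le_trans H3 _; case: ifP => _; lra.
have y3 : 3 < y by exact: le_lt_trans Y3 hYy.
rewrite y3 in H3.
have h7 : (Y - y) * d <= 3/2.
  have : (y - Y) * - d <= y * (3/2 * y^-1).
    by apply: ler_pM; rewrite ?subr_ge0 ?oppr_ge0 ?ltW //; lra.
  have -> : y * (3/2 * y^-1) = 3/2 by field; rewrite gt_eqF.
  by lra.
have h9 : expR ((Y - y) * d) <= 8 by apply: le_trans expR_3half_le8; rewrite ler_expR.
apply: (@le_lt_trans _ _ (r * 8)); first by rewrite ler_pM2l.
lra.
Qed.

(** theta_l has a single double zero on the real line.  At a double zero x > 0 the
    point y = l x satisfies y theta_l(y) = l and is critical for y theta_l(y).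
    For y <= xstar this forces y = tstar; for y > xstar the tangent of the logarithm
    at y contradicts the existence of a test point. *)
Lemma theta_double_unique x : F x = 0 -> theta1 l x = 0 -> x = xstar.
Proof.
have hl3 := lamstar13 R; have hl := lamstar_bounds R; have tb := tstar_bounds R.
have l0 : 0 < l by lra.
have [Fx0 _] := xstar_double; have xs1 := xstar_ge1.
move=> Fx; have [x0|x0] := leP x 0.
  have c1 : (fun=> 1 : R) @ \oo --> (1 : R) by exact: cvg_cst.
  have : 1 <= F x.
    have c2 := @theta_cvg R l x hl3.
    by apply: (le_cvg c1 c2) => k; apply: Rp_ge1 => // j; lra.
  by rewrite Fx; lra.
rewrite theta1_rec // => h1; have h2 : 1 - x * F (l * x) = 0 by rewrite -theta_rec.
set y := l * x in h1 h2.
have y0 : 0 < y by rewrite mulr_gt0.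
have yF : y * F y = l by rewrite /y -mulrA; have -> : x * F y = 1; [lra|rewrite mulr1].
have ex : x = y / l by rewrite /y mulrC mulKf // gt_eqF.
have [hy|hy|hy] := ltgtP y xstar; last first.
- by move: yF; rewrite hy Fx0; lra.
- exfalso.
  have yn : y != 0 by rewrite gt_eqF.
  have Fy : F y = l / y by apply: (mulfI yn); rewrite yF mulrCA divff // mulr1.
  have F1y : theta1 l y / F y = - y^-1.
    have -> : theta1 l y = - (F y / y).
      by apply: (mulfI yn); rewrite mulrN mulrCA divff // mulr1; lra.
    by field; rewrite !gt_eqF // Fy divr_gt0.
  have Fp : 0 < F y by rewrite Fy divr_gt0.
  have c1 : (fun n => (Rg n.+2).[y]) @ \oo --> F y.
    rewrite (cvg_shiftS (fun n => (Rg n.+1).[y])) (cvg_shiftS (fun n => (Rg n).[y])).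
    exact: greedy_cvg.
  have c2 : (fun n => (Rg n.+2)^`().[y] / (Rg n.+2).[y]) @ \oo --> - y^-1.
    rewrite -F1y; apply: cvgM; last by apply: cvgV => //; exact: lt0r_neq0.
    rewrite (cvg_shiftS (fun n => (Rg n.+1)^`().[y])) (cvg_shiftS (fun n => (Rg n)^`().[y])).
    exact: greedy_deriv_cvg.
  have yi : 0 < y^-1 by rewrite invr_gt0.
  have [N1 _ H1] := cvgr_lt _ rho_cvg _ hy.
  have [N2 _ H2] := cvgr_gt _ c1 _ Fp.
  have [N3 _ H3] : \forall n \near \oo, (Rg n.+2).[y] < (if 3 < y then 1/9 else 1).
    apply: (cvgr_lt _ c1); case: ifP => h3; rewrite Fy ltr_pdivrMr //; lra.
  have [N4 _ H4] := cvgr_gt _ c2 (- (3/2 * y^-1)) ltac:(lra).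
  have [N5 _ H5] := cvgr_lt _ c2 0 ltac:(lra).
  have [N6 hN6] : exists N, y < N%:R by exists (Num.truncn y).+1; exact: truncnS_gt.
  have [n [n1 n2 n3 [n4 n5 n6]]] : exists n, [/\ N1 <= n, N2 <= n, N3 <= n & [/\ N4 <= n, N5 <= n & N6 <= n]]%N.
    by clear; exists (N1 + N2 + N3 + N4 + N5 + N6)%N; do 2?split; lia.
  have {}H1 : rho n.+2 < y by exact: H1.
  have {}H2 : 0 < (Rg n.+2).[y] by exact: H2.
  have {}H3 : (Rg n.+2).[y] < (if 3 < y then 1/9 else 1) by exact: H3.
  have {}H4 : - (3/2 * y^-1) < (Rg n.+2)^`().[y] / (Rg n.+2).[y] by exact: H4.
  have {}H5 : (Rg n.+2)^`().[y] / (Rg n.+2).[y] < 0 by exact: H5.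
  have hA : y <= altpt n.+2 n.
    apply: le_trans (altpt_ge (leqnn _)); apply: le_trans (ltW hN6) _.
    by rewrite ler_nat leqW.
  have [Y Y3 /andP[]] := @greedy_test_point n y H1 hA H2.
  move=> hY1 hY2; have {hY1 hY2} := le_trans hY1 hY2; apply/negP; rewrite -ltNge.
  exact: test_point_contradiction.
- rewrite ex /xstar; congr (_ / _); apply/eqP; apply: contraT => yn.
  by have := @theta_strict y ltac:(by rewrite hy ltW) yn; rewrite yF ltxx.
Qed.

End DoubleZero.

(** * The partial theta function *)

(** The coefficients of Psi(q, .). *)
Definition pscoef {R : realType} (q : R) (m : nat) : R := q ^+ 'C(m.+1, 2).

Section PartialTheta.
Variable R : realType.
Implicit Types (q x u : R) (z : cplx R).
Local Notation l := (lamstar R).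
Local Notation F := (theta (lamstar R)).
Local Notation Rg := (Rp (@glam R)).

Lemma Psi_cser q : Psi q = cser (pscoef q).
Proof.
apply/funext => z; rewrite /Psi /cser; congr (lim (_ @ \oo)).
by apply/funext => n; rewrite ceval_psum /series /= big_mkord.
Qed.

Lemma pscoefE q m : pscoef q m = 1 * (- q) ^+ m * thcoef q m.
Proof.
have s : (-1) ^+ m * (-1) ^+ m = 1 :> R by rewrite -exprD addnn -signr_odd odd_double.
rewrite /pscoef /thcoef binS bin1 exprD (exprNn q) -[LHS]mul1r -{1}s.
by move: ((-1) ^+ m) (q ^+ m) (q ^+ _) => a b c; ring.
Qed.

Lemma dcoef_scale (a b : R) (c : nat -> R) :
  dcoef (fun m => b * a ^+ m * c m) =1 (fun m => (b * a) * a ^+ m * dcoef c m).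
Proof. by move=> m; rewrite /dcoef exprS; ring. Qed.

Lemma superdec_pscoef q : 0 <= q <= 1/3 -> superdec (pscoef q).
Proof.
move=> hq; apply: (superdec_le (superdec_thcoef hq)) => m.
rewrite pscoefE mul1r normrM ler_piMl // normrX normrN ger0_norm ?exprn_ile1 //; lra.
Qed.

(** Psi(q, z) = theta_q(- q z). *)
Lemma Psi_theta q z : 0 <= q <= 1/3 -> Psi q z = cser (thcoef q) (toC (- q) * z).
Proof.
move=> hq; rewrite Psi_cser (eq_cser (pscoefE q)) cser_scale ?rmorph1 ?mul1r //.
exact: superdec_thcoef.
Qed.

Lemma Psi_real q x : 0 <= q <= 1/3 -> Psi q (toC x) = toC (theta q (- q * x)).
Proof.
move=> hq; rewrite Psi_theta // -rmorphM cser_toC ?theta_rser //.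
exact: superdec_thcoef.
Qed.

Lemma Psi_derive1 q x : 0 <= q <= 1/3 ->
  ((Psi q)^`())%classic (toC x) = toC (- q * theta1 q (- q * x)).
Proof.
move=> hq; have st := superdec_thcoef hq.
rewrite Psi_cser cser_derive1; last exact: superdec_pscoef.
have e : dcoef (pscoef q) =1 (fun m => (1 * - q) * (- q) ^+ m * dcoef (thcoef q) m).
  by move=> m; rewrite -dcoef_scale /dcoef pscoefE.
rewrite (eq_cser e) cser_scale; last exact: superdec_dcoef.
by rewrite -rmorphM cser_toC -?rmorphM ?mul1r //; exact: superdec_dcoef.
Qed.

Lemma Psi_derive2 q x : 0 <= q <= 1/3 ->
  ((Psi q)^`(2))%classic (toC x) = toC (q ^+ 2 * rser (dcoef (dcoef (thcoef q))) (- q * x)).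
Proof.
move=> hq; have st := superdec_thcoef hq.
rewrite Psi_cser cser_derive2; last exact: superdec_pscoef.
have e : dcoef (dcoef (pscoef q)) =1
    (fun m => (1 * - q * - q) * (- q) ^+ m * dcoef (dcoef (thcoef q)) m).
  by move=> m; rewrite -dcoef_scale /dcoef !pscoefE exprS; ring.
have sd : superdec (dcoef (dcoef (thcoef q))) by do 2! apply: superdec_dcoef.
rewrite (eq_cser e) cser_scale // -rmorphM cser_toC // -rmorphM.
by congr (toC (_ * _)); ring.
Qed.

(** The double zero of Psi(l, .). *)
Definition ustar : R := - (xstar R / l).

Lemma ustar_xstar : - l * ustar = xstar R.
Proof.
rewrite /ustar mulrNN mulrCA divff ?mulr1 //; apply: lt0r_neq0.
by have := lamstar_bounds R; lra.
Qed.

Lemma double_zero_unique : unique (fun u : R => double_zero (Psi l) (toC u)) ustar.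
Proof.
have hl3 := lamstar13 R; have hl := lamstar_bounds R.
have l0 : l != 0 by apply: lt0r_neq0; lra.
have [F0 T0] := xstar_double R; split.
  split.
  - by rewrite Psi_real // ustar_xstar F0 rmorph0.
  - by rewrite Psi_derive1 // ustar_xstar T0 mulr0 rmorph0.
  - rewrite Psi_derive2 // ustar_xstar; apply/eqP.
    by rewrite toC_eq0 mulf_neq0 ?sqrf_eq0 // xstar_deriv2.
move=> u [h1 h2 _].
have {}h1 : F (- l * u) = 0 by apply: toC_inj; rewrite -Psi_real // h1 rmorph0.
have {}h2 : theta1 l (- l * u) = 0.
  have : - l * theta1 l (- l * u) = 0 by apply: toC_inj; rewrite -Psi_derive1 // h2 rmorph0.
  by move/eqP; rewrite mulf_eq0 oppr_eq0 (negbTE l0) => /eqP.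
have e := theta_double_unique h1 h2.
by apply: (mulfI l0); apply/eqP; rewrite -eqr_opp -!mulNr ustar_xstar e.
Qed.

Lemma greedy_cvg_disk M e : 0 <= M -> 0 < e -> exists N, forall n, (N <= n)%N ->
  forall z, cabs z <= M -> cabs (cser (thcoef l) z - ceval (Rg n) z) < e.
Proof.
move=> M0 e0; have hl3 := lamstar13 R.
apply: (@tannery R _ _ _ M e (@superdec_base R)) => // [i m|m|m].
- by rewrite -/(base3 R m) base3_norm; apply: coef_Rp_bound; exact: glam13.
- exact: thcoef_le.
- exact: coef_greedy_cvg.
Qed.

Lemma greedy_root_gt0 n z : ceval (Rg n.+1) z = 0 -> 0 < z.
Proof.
move=> h; have [x ex] := real_toC (@hyperbolic_greedy R n z h).
move: h; rewrite ex ceval_toC => /eqP; rewrite toC_eq0 => /eqP h.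
rewrite -(rmorph0 (@toC R)) toC_lt ltNge; apply/negP => x0.
have := @Rp_ge1 R (@glam R) n.+1 x (fun j => (andP (glam13 R j)).1) x0.
by rewrite h; lra.
Qed.

(** The greedy polynomials, suitably scaled, approximate Psi(l, .). *)
Lemma LPplus_lamstar : LPplus (Psi l).
Proof.
have hl3 := lamstar13 R; have hl := lamstar_bounds R.
exists (fun n => Rg n.+1 \Po (- l *: 'X)); split => [n z|].
  rewrite ceval_scale => /greedy_root_gt0.
  have ln : toC (- l) < 0 by rewrite -(rmorph0 (@toC R)) toC_lt; lra.
  by rewrite nmulr_rgt0.
apply: family_compact_disks => M e M0 e0.
have [N hN] := @greedy_cvg_disk M e M0 e0.
exists N => n hn z hz; rewrite Psi_theta // ceval_scale; apply: hN; first exact: leqW.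
apply: le_trans hz; rewrite cabsM cabs_toC normrN ler_piMl ?cabs_ge0 // ger0_norm; lra.
Qed.

End PartialTheta.

(** * Necessary conditions for membership in the Laguerre-Polya class *)

Section LaguerrePolya.
Variable R : realType.
Implicit Types (q x y e h : R) (z : cplx R) (G p : {poly R}).

(** A cubic polynomial function with constant term 1. *)
Definition cubic q1 q2 q3 x : R := 1 + q1 * x + q2 * x ^+ 2 + q3 * x ^+ 3.

(** For a polynomial with nonnegative coefficients the terms of order at least 4 are
    dominated by their values at 1/2. *)
Lemma quartic_remainder G x : (forall m, 0 <= G`_m) -> G`_0 = 1 -> 0 <= x <= 1/2 ->
  `|G.[x] - cubic G`_1 G`_2 G`_3 x| <= 16 * G.[1/2] * x ^+ 4.
Proof.
move=> G0 G1 hx.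
have E y : G.[y] = cubic G`_1 G`_2 G`_3 y + y ^+ 4 * \sum_(i < size G) G`_(i + 4)%N * y ^+ i.
  have sz : (size G <= (size G).+4)%N by rewrite -addn4 leq_addr.
  rewrite (horner_coef_wide _ sz).
  rewrite 4!big_ord_recl /= /bump /= G1 expr0 mulr1 !add1n !addrA expr1 /cubic.
  congr (_ + _); rewrite mulr_sumr; apply: eq_bigr => i _.
  by rewrite !add1n -addn4 exprD; ring.
have S0 y : 0 <= y -> 0 <= \sum_(i < size G) G`_(i + 4)%N * y ^+ i.
  by move=> y0; apply: sumr_ge0 => i _; rewrite mulr_ge0 ?exprn_ge0.
rewrite {1}E addrC addKr ger0_norm; last by rewrite mulr_ge0 ?exprn_ge0 ?S0 //; lra.
rewrite mulrC; apply: ler_wpM2r; first by rewrite exprn_ge0 //; lra.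
have le : \sum_(i < size G) G`_(i + 4)%N * x ^+ i <= \sum_(i < size G) G`_(i + 4)%N * (1/2) ^+ i.
  by apply: ler_sum => i _; rewrite ler_wpM2l // lerXn2r ?nnegrE //; lra.
apply: le_trans le _; rewrite E.
have c0 : 0 <= cubic G`_1 G`_2 G`_3 (1/2).
  by rewrite /cubic !addr_ge0 ?mulr_ge0 ?exprn_ge0 //; lra.
have : (1/2 : R) ^+ 4 = 1/16 by field.
by move=> ->; lra.
Qed.

(** The coefficients of a cubic without constant term are small when its values at
    h, 2 h and 3 h are: they are given by interpolation. *)
Lemma cubic_small D h (a b c : R) (P := fun x => a * x + b * x ^+ 2 + c * x ^+ 3) :
  1 <= D -> 0 < h <= 1 ->
  `|P h| <= D * h ^+ 4 -> `|P (2 * h)| <= D * h ^+ 4 -> `|P (3 * h)| <= D * h ^+ 4 ->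
  [/\ `|a| <= 5 * D * h, `|b| <= 5 * D * h & `|c| <= 5 * D * h].
Proof.
move=> D1 /andP[h0 h1] P1 P2 P3.
have e1 : a * h = 3 * P h - 3/2 * P (2 * h) + 1/3 * P (3 * h) by rewrite /P; field.
have e2 : b * h ^+ 2 = - (5/2) * P h + 2 * P (2 * h) - 1/2 * P (3 * h) by rewrite /P; field.
have e3 : c * h ^+ 3 = 1/2 * P h - 1/2 * P (2 * h) + 1/6 * P (3 * h) by rewrite /P; field.
have fin (u : R) k : (k <= 3)%N -> `|u * h ^+ k| <= 5 * (D * h ^+ 4) -> `|u| <= 5 * D * h.
  move=> hk; rewrite normrM [`|h ^+ k|]ger0_norm; last by rewrite exprn_ge0 // ltW.
  have -> : h ^+ 4 = h ^+ (4 - k) * h ^+ k by rewrite -exprD subnK // leqW.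
  rewrite !mulrA ler_pM2r ?exprn_gt0 // => hu; apply: le_trans hu _.
  rewrite ler_pM2l; last by rewrite mulr_gt0 //; exact: lt_le_trans D1.
  rewrite -[leRHS]expr1; apply: ler_wiXn2l => //; first exact: ltW.
  by rewrite subn_gt0.
have := P1; rewrite ler_norml => /andP[p1 p1'].
have := P2; rewrite ler_norml => /andP[p2 p2'].
have := P3; rewrite ler_norml => /andP[p3 p3'].
have X0 : 0 <= D * h ^+ 4 by apply: mulr_ge0; rewrite ?exprn_ge0 ?(le_trans _ D1) ?ltW.
move: e1 e2 e3 p1 p1' p2 p2' p3 p3' X0 fin; clear.
move: (P h) (P (2 * h)) (P (3 * h)) (D * h ^+ 4) => u1 u2 u3 X e1 e2 e3 p1 p1' p2 p2' p3 p3' X0 fin.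
split.
- by apply: (fin _ 1%N); rewrite // expr1 e1 ler_norml; clear -p1 p1' p2 p2' p3 p3' X0; apply/andP; split; lra.
- by apply: (fin _ 2%N); rewrite // e2 ler_norml; clear -p1 p1' p2 p2' p3 p3' X0; apply/andP; split; lra.
- by apply: (fin _ 3%N); rewrite // e3 ler_norml; clear -p1 p1' p2 p2' p3 p3' X0; apply/andP; split; lra.
Qed.

(** For polynomials with nonnegative coefficients, pointwise convergence near 0
    implies convergence of the coefficients of low order. *)
Lemma coef_cvg_of_values (G : nat -> {poly R}) (psi : R -> R) q1 q2 q3 K :
  (forall n m, 0 <= (G n)`_m) -> (forall n, (G n)`_0 = 1) ->
  (forall x, 0 <= x <= 1/2 -> (fun n => (G n).[x]) @ \oo --> psi x) ->
  (forall x, 0 <= x <= 1/2 -> `|psi x - cubic q1 q2 q3 x| <= K * x ^+ 4) ->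
  [/\ (fun n => (G n)`_1) @ \oo --> q1, (fun n => (G n)`_2) @ \oo --> q2 &
      (fun n => (G n)`_3) @ \oo --> q3].
Proof.
move=> G0 G1 cG hpsi.
have K0 : 0 <= K.
  have := hpsi (1/2) ltac:(lra); have -> : (1/2 : R) ^+ 4 = 1/16 by field.
  by have := normr_ge0 (psi (1/2) - cubic q1 q2 q3 (1/2)); lra.
have B0 : 0 <= psi (1/2).
  have c0 : (fun=> 0 : R) @ \oo --> (0 : R) by exact: cvg_cst.
  apply: (le_cvg c0 (cG (1/2) ltac:(lra))) => n.
  by rewrite horner_coef sumr_ge0 // => i _; rewrite mulr_ge0 ?exprn_ge0 //; lra.
pose D := 1 + 81 * (K + 16 * (psi (1/2) + 1)).
have D1 : 1 <= D by rewrite /D; lra.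
suff key e : 0 < e -> \forall n \near \oo, [/\ `|(G n)`_1 - q1| < e, `|(G n)`_2 - q2| < e & `|(G n)`_3 - q3| < e].
  by split; apply/cvgrPdist_lt => e e0; have [N _ hN] := key e e0; exists N => // n /hN[] ? ? ?; rewrite distrC.
move=> e0; (* the remainders are of order h^4, so that the coefficients are known up to order h *)
pose h := Num.min (1/6) (e / (6 * D)).
have h0 : 0 < h.
  by rewrite lt_min; apply/andP; split; [lra|rewrite divr_gt0 //; lra].
have h6 : h <= 1/6 by rewrite ge_min lexx.
have he : 6 * D * h <= e.
  have : h <= e / (6 * D) by rewrite ge_min lexx orbT.
  by rewrite ler_pdivlMr; lra.
have h4 : 0 < h ^+ 4 by rewrite exprn_gt0.
have near_val x : 0 <= x <= 1/2 -> \forall n \near \oo, `|psi x - (G n).[x]| < h ^+ 4.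
  by move=> hx; have /cvgrPdist_lt := cG x hx; apply.
have [N1 _ H1] := near_val h ltac:(lra).
have [N2 _ H2] := near_val (2 * h) ltac:(lra).
have [N3 _ H3] := near_val (3 * h) ltac:(lra).
have hh : 0 <= (1/2 : R) <= 1/2 by lra.
have p1 : psi (1/2) < psi (1/2) + 1 by lra.
have [N4 _ H4] := cvgr_lt _ (cG _ hh) _ p1.
exists (N1 + N2 + N3 + N4)%N => // n /= hn.
have [n1 n2 n3 n4] : [/\ N1 <= n, N2 <= n, N3 <= n & N4 <= n]%N by move: hn; clear; split; lia.
have {}H1 := H1 n n1; have {}H2 := H2 n n2; have {}H3 := H3 n n3.
have {}H4 : (G n).[1/2] < psi (1/2) + 1 by exact: H4.
set a := (G n)`_1 - q1; set b := (G n)`_2 - q2; set c := (G n)`_3 - q3.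
pose P x := a * x + b * x ^+ 2 + c * x ^+ 3.
have hP x : 0 <= x <= 3 * h -> `|psi x - (G n).[x]| < h ^+ 4 -> `|P x| <= D * h ^+ 4.
  move=> hx h1; have x2 : 0 <= x <= 1/2 by clear -hx h6; lra.
  have x4 : x ^+ 4 <= 81 * h ^+ 4.
    have -> : 81 * h ^+ 4 = (3 * h) ^+ 4 by ring.
    by clear -hx h0; rewrite lerXn2r ?nnegrE //; lra.
  have := quartic_remainder (G0 n) (G1 n) x2; have := hpsi x x2.
  have -> : P x = (psi x - cubic q1 q2 q3 x) - (psi x - (G n).[x]) - ((G n).[x] - cubic (G n)`_1 (G n)`_2 (G n)`_3 x).
    by rewrite /P /cubic /a /b /c; ring.
  move=> h2 h3; apply: le_trans (ler_normB _ _) _; apply: le_trans (lerD (ler_normB _ _) h3) _.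
  have h5 : 16 * (G n).[1/2] * x ^+ 4 <= 16 * (psi (1/2) + 1) * (81 * h ^+ 4).
    have g0 : 0 <= (G n).[1/2].
      by rewrite horner_coef sumr_ge0 // => i _; rewrite mulr_ge0 ?exprn_ge0 //; lra.
    by clear -g0 H4 x4 x2; apply: ler_pM => //; rewrite ?exprn_ge0 //; lra.
  have h7 : K * x ^+ 4 <= K * (81 * h ^+ 4) by rewrite ler_wpM2l.
  move: h1 h2 h5 h7; rewrite /D; clear.
  by move: `|_| `|_| (_ * _ * x ^+ 4) (h ^+ 4) (K * x ^+ 4) (psi (1/2)) => s1 s2 s3 s4 s5 s6; lra.
have P1 : `|P h| <= D * h ^+ 4 by apply: hP => //; clear -h0; lra.
have P2 : `|P (2 * h)| <= D * h ^+ 4 by apply: hP => //; clear -h0; lra.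
have P3 : `|P (3 * h)| <= D * h ^+ 4 by apply: hP => //; clear -h0; lra.
have hle1 : 0 < h <= 1 by clear -h0 h6; lra.
have [k1 k2 k3] := cubic_small D1 hle1 P1 P2 P3.
have he5 : 5 * D * h < e.
  apply: lt_le_trans he; rewrite ltr_pM2r // ltr_pM2r; last exact: lt_le_trans D1.
  by clear; lra.
by split; apply: le_lt_trans he5.
Qed.

(** A polynomial with negative roots, divided by its constant term, has nonnegative
    coefficients; with the sign of the variable changed it has positive roots. *)
Lemma negative_rooted_normal p (G := p.[0]^-1 *: p) (f := G \Po (-1 *: 'X)) : negative_rooted p ->
  [/\ p.[0] != 0, G`_0 = 1, forall m, 0 <= G`_m, hyperbolic f & forall x, x <= 0 -> f.[x] != 0].
Proof.
move=> hp; have p0 : p.[0] != 0.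
  apply/eqP => e; have := hp (toC 0); rewrite ceval_toC e rmorph0 => /(_ erefl).
  by rewrite ltxx.
have rG z : ceval G z = 0 -> z < 0.
  rewrite /G cevalZ => /eqP; rewrite mulf_eq0 toC_eq0 invr_eq0 (negbTE p0) /= => /eqP.
  exact: hp.
have G0 : G`_0 = 1 by rewrite /G coefZ -horner_coef0 mulVf.
have hG : hyperbolic G by move=> z /rG; exact: ltr0_real.
have rr x : G.[x] = 0 -> x < 0.
  by move=> e; rewrite -toC_lt rmorph0; apply: rG; rewrite ceval_toC e rmorph0.
split => //.
- have [ys ey] := hyperbolic_factor hG G0.
  have yneg y : y \in ys -> y <= 0.
    move=> hy; rewrite leNgt; apply/negP => y0.
    suff /rr : G.[y^-1] = 0 by rewrite invr_lt0 => /(lt_trans y0); rewrite ltxx.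
    apply/eqP; rewrite ey horner_prod prodf_seq_eq0; apply/hasP; exists y => //=.
    by rewrite hornerD hornerN hornerZ hornerX hornerC mulfV ?subrr // gt_eqF.
  rewrite ey; elim: ys yneg {ey} => [|y ys IH] hys m.
    by rewrite big_nil coef1 ler0n.
  rewrite big_cons mulrBl mul1r -scalerAl coefB coefZ coefXM.
  have y0 : y <= 0 by apply: hys; exact: mem_head.
  have {}IH k : 0 <= (\prod_(j <- ys) (1 - j *: 'X))`_k.
    by apply: IH => u hu; apply: hys; rewrite inE hu orbT.
  by rewrite subr_ge0; apply: le_trans (IH m); rewrite mulr_le0_ge0 //; case: eqP.
- move=> z; rewrite /f ceval_scale => /hG; rewrite rmorphN rmorph1 mulN1r.
  by rewrite realN.
- move=> x x0; apply/eqP; have eX : (-1 *: 'X).[x] = - x by rewrite hornerZ hornerX mulN1r.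
  rewrite /f horner_comp eX => /rr.
  by rewrite oppr_lt0 ltNge x0.
Qed.

(** Third order expansion of Psi(q, .) at 0, valid for all q in (0, 1). *)
Lemma Psi_cubic q : 0 < q < 1 -> exists K, forall x, 0 <= x <= 1/2 ->
  cabs (Psi q (toC x) - toC (cubic q (q ^+ 3) (q ^+ 6) x)) <= K * x ^+ 4.
Proof.
move=> hq.
have cle m x : 0 <= x <= 1/2 -> `|pscoef q m| * cabs (toC x) ^+ m <= 1 * (2^-1) ^+ m.
  move=> hx; rewrite cabs_toC ger0_norm; last by rewrite exprn_ge0 //; lra.
  apply: ler_pM; rewrite ?exprn_ge0 ?exprn_ile1 //; try lra.
  by rewrite lerXn2r ?nnegrE // ger0_norm; lra.
have tail x n : 0 <= x <= 1/2 -> cabs (Psi q (toC x) - toC (psum (pscoef q) n).[x]) <= 4 * (2^-1) ^+ n.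
  move=> hx; have [_ h] := @cser_cvg R (pscoef q) (toC x) 1 (fun m => cle m x hx).
  by have := h n; rewrite ceval_toC -Psi_cser mulr1.
exists (16 * (cabs (Psi q (toC (1/2))) + 4)) => x hx.
apply/ler_addgt0Pr => e e0; have [N hN] := @geo_small R 4 e e0.
pose n := (N + 4)%N; set P := psum (pscoef q) n.
have P0 m : 0 <= P`_m by rewrite coef_poly; case: ifP => // _; rewrite exprn_ge0 //; lra.
have Pm m : (m < 4)%N -> P`_m = q ^+ 'C(m.+1, 2).
  by move=> hm; rewrite coef_poly ifT // (leq_trans hm) // leq_addl.
have := quartic_remainder P0 _ hx; rewrite !Pm // expr1 => /(_ erefl) h1.
have hh : 0 <= (1/2 : R) <= 1/2 by lra.
have h2 : P.[1/2] <= cabs (Psi q (toC (1/2))) + 4.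
  have h3 : cabs (toC P.[1/2]) <= cabs (Psi q (toC (1/2))) + 4.
    have -> : toC P.[1/2] = Psi q (toC (1/2)) - (Psi q (toC (1/2)) - toC P.[1/2]) by rewrite opprB addrC subrK.
    apply: le_trans (cabsD _ _) _; rewrite lerD2l cabsN; apply: le_trans (tail _ n hh) _.
    by rewrite ler_piMr // exprn_ile1 //; lra.
  by apply: le_trans h3; rewrite cabs_toC ler_norm.
have -> : Psi q (toC x) - toC (cubic q (q ^+ 3) (q ^+ 6) x) =
  (Psi q (toC x) - toC P.[x]) + toC (P.[x] - cubic q (q ^+ 3) (q ^+ 6) x).
  by rewrite rmorphB addrA subrK.
apply: le_trans (cabsD _ _) _; rewrite addrC; apply: lerD.
  rewrite cabs_toC; apply: le_trans h1 _; rewrite ler_wpM2r ?exprn_ge0 //; lra.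
apply: le_trans (tail x n hx) _; apply: le_trans hN; rewrite ler_pM2l //.
by rewrite ler_wiXn2l ?leq_addr //; lra.
Qed.

Lemma toC_segment_compact a b : compact (@toC R @` `[a, b]).
Proof.
apply: continuous_compact; last exact: segment_compact.
by apply: continuous_subspaceT; exact: toC_continuous.
Qed.

(** If Psi(q, .) belongs to the Laguerre-Polya class then q is in [touching].  The low
    order coefficients of the approximating polynomials converge to q, q^3, q^6.
    In the limit the inequality p2^2 <= p1 p3 of the power sums becomes
    q (1 - q) (1 - 3 q) >= 0, so q <= 1/3, and the bound p1 / p2 of the smallest root
    becomes 1 / (q (1 - 2 q)) <= 1 / q^2. *)
Lemma LPplus_touching q : 0 < q < 1 -> LPplus (Psi q) -> touching q.
Proof.
move=> hq [p [hp /family_compactP cv]].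
pose psi x := complex.Re (Psi q (toC x)).
have psiP x : (fun n => (p n).[x]) @ \oo --> psi x /\ Psi q (toC x) = toC (psi x).
  apply: cplx_cvg_toC; apply/cplx_cvgP/cvgrPdist_lt => e e0.
  have [N hN] := cv [set toC x] e (@compact_set1 _ (toC x)) e0.
  exists N => // n hn; rewrite sub0r normrN ger0_norm ?cabs_ge0 // -ceval_toC.
  exact: (hN n hn).
have [K hK] := Psi_cubic hq.
have hpsi x : 0 <= x <= 1/2 -> `|psi x - cubic q (q ^+ 3) (q ^+ 6) x| <= K * x ^+ 4.
  by move=> hx; have := hK x hx; rewrite (psiP x).2 -rmorphB cabs_toC.
have psi0 : psi 0 = 1.
  have := hpsi 0 ltac:(lra); rewrite /cubic !expr0n /= !mulr0 !addr0 normr_le0 subr_eq0.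
  by move/eqP.
pose G n := (p n).[0]^-1 *: p n.
have normG n := negative_rooted_normal (hp n); rewrite -/(G _) in normG.
have cG x : 0 <= x <= 1/2 -> (fun n => (G n).[x]) @ \oo --> psi x.
  move=> _; have -> : (fun n => (G n).[x]) = (fun n => (p n).[0]^-1 * (p n).[x]).
    by apply/funext => n; rewrite hornerZ.
  have ci : (fun n => (p n).[0]^-1) @ \oo --> (1 : R).
    have c0 : (fun n => (p n).[0]^-1) @ \oo --> (psi 0)^-1.
      by apply: cvgV; [rewrite psi0 oner_neq0|exact: (psiP 0).1].
    by move: c0; rewrite psi0 invr1.
  by rewrite -[psi x]mul1r; apply: cvgM => //; exact: (psiP x).1.
have [c1 c2 c3] := @coef_cvg_of_values G psi q (q ^+ 3) (q ^+ 6) K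
   (fun n => let: And5 _ _ h _ _ := normG n in h) (fun n => let: And5 _ h _ _ _ := normG n in h) cG hpsi.
have q0 : 0 < q by case/andP: hq.
pose f n := G n \Po (-1 *: 'X).
have f1 n : - (f n)`_1 = (G n)`_1 by rewrite coef_comp_scale expr1 mulN1r opprK.
have f2 n : (f n)`_2 = (G n)`_2 by rewrite coef_comp_scale expr2 mulrNN mulr1 mul1r.
have f3 n : - (f n)`_3 = (G n)`_3.
  by rewrite coef_comp_scale !exprS expr0; move: (_`_3) => a; ring.
have f0 n : (f n)`_0 = 1 by have [_ h _ _ _] := normG n; rewrite coef_comp_scale expr0 mul1r.
have low n : 0 < (G n)`_1 ->
  ((G n)`_1 ^+ 2 - 2 * (G n)`_2) ^+ 2 <= (G n)`_1 * ((G n)`_1 ^+ 3 - 3 * (G n)`_1 * (G n)`_2 + 3 * (G n)`_3) /\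
  (0 < (G n)`_1 ^+ 2 - 2 * (G n)`_2 -> exists2 x, (f n).[x] = 0 & 0 < x /\ x * ((G n)`_1 ^+ 2 - 2 * (G n)`_2) <= (G n)`_1).
  have [_ _ _ hf nr] := normG n; rewrite -f1 -f2 -f3 => g0.
  exact: hyperbolic_low_coef.
have [N1 _ H1] := cvgr_gt _ c1 _ q0.
have cD : (fun n => (G n)`_1 ^+ 2 - 2 * (G n)`_2) @ \oo --> q ^+ 2 - 2 * q ^+ 3.
  by apply: cvgB; [exact: cvg_pow|apply: cvgMr].
have q13 : q <= 1/3.
  have cL := @cvg_pow R _ _ 2%N cD.
  have cR : (fun n => (G n)`_1 * ((G n)`_1 ^+ 3 - 3 * (G n)`_1 * (G n)`_2 + 3 * (G n)`_3)) @ \oo -->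
     q * (q ^+ 3 - 3 * q * q ^+ 3 + 3 * q ^+ 6).
    apply: cvgM => //; apply: cvgD; last exact: cvgMr.
    by apply: cvgB; [exact: cvg_pow|apply: cvgM => //; exact: cvgMr].
  have hle : (q ^+ 2 - 2 * q ^+ 3) ^+ 2 <= q * (q ^+ 3 - 3 * q * q ^+ 3 + 3 * q ^+ 6).
    rewrite -(cvg_lim _ cL) // -(cvg_lim _ cR) //; apply: ler_lim.
    - by apply/cvg_ex; eexists; exact: cL.
    - by apply/cvg_ex; eexists; exact: cR.
    - by exists N1 => // n hn; have [] := low n (H1 n hn).
  have : 0 <= q ^+ 5 * (1 - q) * (1 - 3 * q) by move: hle; rewrite -subr_ge0; congr (_ <= _); ring.
  rewrite pmulr_rge0 ?subr_ge0; first by lra.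
  by rewrite mulr_gt0 ?exprn_gt0 // subr_gt0; case/andP: hq.
have q13' : 0 <= q <= 1/3 by rewrite q13 ltW.
split => //.
have [t0 ht0 hmax] := theta_max q13'; exists t0 => //.
(* the values t theta(t) at the approximate zeros t are nearly q *)
have approx e : 0 < e -> exists2 t, 0 <= t <= 1 + e & `|q - t * theta q t| < e.
  move=> e0; have q2 : 0 < q ^+ 2 by rewrite exprn_gt0.
  have Dl : 0 < q ^+ 2 - 2 * q ^+ 3.
    have -> : q ^+ 2 - 2 * q ^+ 3 = q ^+ 2 * (1 - 2 * q) by ring.
    by rewrite mulr_gt0 //; lra.
  have cu : (fun n => q ^+ 2 * ((G n)`_1 / ((G n)`_1 ^+ 2 - 2 * (G n)`_2))) @ \oo -->
      q ^+ 2 * (q / (q ^+ 2 - 2 * q ^+ 3)).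
    by apply: cvgMr; apply: cvgM => //; apply: cvgV => //; exact: lt0r_neq0.
  have ul : q ^+ 2 * (q / (q ^+ 2 - 2 * q ^+ 3)) < 1 + e.
    have -> : q ^+ 2 * (q / (q ^+ 2 - 2 * q ^+ 3)) = q / (1 - 2 * q).
      by field; rewrite !lt0r_neq0 //; lra.
    by apply: (@le_lt_trans _ _ 1); rewrite ?ltrDl // ler_pdivrMr; lra.
  have [N2 _ H2] := cvgr_lt _ cu _ ul.
  have [N3 _ H3] := cvgr_gt _ cD _ Dl.
  have [N4 H4] := cv _ e (@toC_segment_compact (- ((1 + e) / q ^+ 2)) 0) e0.
  have [n [n1 n2 n3 n4]] : exists n, [/\ N1 <= n, N2 <= n, N3 <= n & N4 <= n]%N.
    by clear; exists (N1 + N2 + N3 + N4)%N; split; lia.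
  have {}H2 : q ^+ 2 * ((G n)`_1 / ((G n)`_1 ^+ 2 - 2 * (G n)`_2)) < 1 + e := H2 n n2.
  have [_ /(_ (H3 n n3))[x fx [x0 hx]]] := low n (H1 n n1).
  have {}H3 : 0 < (G n)`_1 ^+ 2 - 2 * (G n)`_2 := H3 n n3.
  have hx1 : q ^+ 2 * x <= 1 + e.
    by apply: le_trans (ltW H2); rewrite ler_wpM2l ?(ltW q2) // ler_pdivlMr.
  have px : (p n).[- x] = 0.
    have eX : (-1 *: 'X).[x] = - x by rewrite hornerZ hornerX mulN1r.
    move: fx; rewrite /f horner_comp eX hornerZ => /eqP; rewrite mulf_eq0 invr_eq0.
    by have [h _ _ _ _] := normG n; rewrite (negbTE h) => /eqP.
  have hK4 : (@toC R @` `[(- ((1 + e) / q ^+ 2)), 0]) (toC (- x)).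
    exists (- x) => //=; rewrite in_itv /= oppr_le0 (ltW x0) andbT lerN2.
    by rewrite ler_pdivlMr // mulrC.
  have := H4 n n4 _ hK4; rewrite ceval_toC px rmorph0 subr0 Psi_real // cabs_toC mulrNN.
  rewrite theta_rec // => hth; exists (q * (q * x)).
    by rewrite mulrA -expr2 hx1 andbT mulr_ge0 ?exprn_ge0 // ltW.
  have -> : q - q * (q * x) * theta q (q * (q * x)) = q * (1 - q * x * theta q (q * (q * x))) by ring.
  rewrite normrM; apply: le_lt_trans hth; rewrite ler_piMl // ger0_norm; last exact: ltW.
  by clear -q13; lra.
have [C C0 hC] := theta_taylor1 1 q13'.
have th1 : theta q 1 <= 1 by have /andP[] := @theta_bound R q 1 q13' ltac:(by rewrite ler01 lexx).
have m1 : theta q 1 <= t0 * theta q t0 by have := hmax 1; rewrite mul1r; apply; rewrite ler01 lexx.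
set m := t0 * theta q t0 in m1 hmax *.
pose A := `|theta1 q 1| + C.
have A0 : 0 <= A by rewrite addr_ge0.
apply/ler_addgt0Pr => e e0.
pose d := Num.min 1 (e / (2 + 2 * A)).
have A2 : 0 < 2 + 2 * A by clear -A0; lra.
have d0 : 0 < d by rewrite lt_min ltr01 divr_gt0.
have d1 : d <= 1 by rewrite ge_min lexx.
have de : d * (2 + 2 * A) <= e by rewrite -ler_pdivlMr // /d ge_min lexx orbT.
have [t /andP[t1 t2]] := approx d d0.
rewrite ltr_norml => /andP[_ ht].
suff : t * theta q t <= m + d * (1 + 2 * A) by move: de ht; clear; lra.
have dA : 0 <= d * (1 + 2 * A) by rewrite mulr_ge0 ?ltW //; clear -A0; lra.
have [t3|t3] := leP t 1.
  by apply: le_trans (hmax t _) _; rewrite ?t1 // lerDl.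
have et1 : 1 + (t - 1) = t by rewrite addrC subrK.
have ht1 : `|t - 1| <= 1 by rewrite ger0_norm; clear -t2 d1 t3; lra.
have := hC (t - 1) ht1; rewrite et1.
rewrite ler_norml => /andP[_ h1].
set s := t - 1 in h1.
have s0 : 0 < s by rewrite /s subr_gt0.
have sd : s <= d by rewrite /s; clear -t2; lra.
have h2 : s * theta1 q 1 <= s * `|theta1 q 1| by rewrite ler_pM2l // ler_norm.
have h3 : C * s ^+ 2 <= s * C.
  by rewrite mulrC ler_wpM2r // expr2 ler_piMl ?(ltW s0) //; clear -sd d1; lra.
have h4 : theta q t <= theta q 1 + s * A by rewrite /A; move: h1 h2 h3; clear; lra.
have et : t = 1 + s by rewrite /s addrC subrK.
have h5 : t * theta q t <= t * (theta q 1 + s * A) by rewrite ler_pM2l //; clear -t3; lra.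
apply: le_trans h5 _; rewrite et.
have h6 : s * (1 + 2 * A) <= d * (1 + 2 * A) by rewrite ler_wpM2r //; clear -A0; lra.
have h7 : s * theta q 1 <= s * 1 by rewrite ler_pM2l.
have h8 : s * (s * A) <= 1 * (s * A).
  by rewrite ler_wpM2r ?mulr_ge0 ?(ltW s0) //; clear -sd d1; lra.
by move: h6 h7 h8 m1; clear; lra.
Qed.

Lemma lamstar_maximum : is_maximum [set q : R | 0 < q < 1 /\ LPplus (Psi q)] (lamstar R).
Proof.
have hl := lamstar_bounds R; split.
  by split; [lra|exact: LPplus_lamstar].
move=> q [hq hL]; apply: ub_le_sup; last exact: LPplus_touching hL.
by exists (13/42) => x; exact: touching_ub.
Qed.

End LaguerrePolya.

(** * The scaled reverted polynomials *)

Section ScaledReverted.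
Variable R : realType.
Implicit Types (x : R) (z : cplx R) (p : {poly R}).
Local Notation l := (lamstar R).
Local Notation Rg := (Rp (@glam R)).
Local Notation g := (@gcoef R).

Lemma poly_ext_horner p p' : (forall x, p.[x] = p'.[x]) -> p = p'.
Proof.
move=> h; apply/eqP; rewrite -subr_eq0; apply: contraT => n0.
have := @max_poly_roots R (p - p') [seq i%:R | i <- iota 0 (size (p - p'))] n0.
rewrite size_map size_iota ltnn => h2; apply: h2.
  by apply/allP => x _; rewrite /root hornerD hornerN h subrr.
by rewrite map_inj_uniq ?iota_uniq //; move=> i j /eqP; rewrite eqr_nat => /eqP.
Qed.

(** The reverted polynomials are rescaled greedy R_k. *)
Lemma P_E k : P_ R k.+1 = g k.+1 *: (Rg k.+1 \Po (- (g k / g k.+1) *: 'X)).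
Proof.
apply: poly_ext_horner => x; apply: toC_inj.
rewrite -!ceval_toC cevalZ ceval_scale (@ceval_wide _ _ k.+2) ?size_poly //.
have gp j : (j <= k.+1)%N -> 0 < g j by move=> _; exact: gcoef_gt0.
have ez : - toC x * toC (g k / g k.+1) = toC (- (g k / g k.+1)) * toC x.
  by rewrite rmorphN !mulNr mulrC.
have := ratio_reverse (- toC x) gp; rewrite opprK Rp_ratio_gcoef ez => <-.
apply: eq_bigr => i _; rewrite coef_poly ltn_ord p_E coef_gpoly ?leq_subr //.
Qed.

(** The double root of the reverted polynomial corresponds to rho. *)
Lemma zeta_E n : zeta_ R n.+2 = - (rho n.+2 * (g n.+2 / g n.+1)).
Proof.
have g1 := gcoef_gt0 R n.+1; have g2 := gcoef_gt0 R n.+2.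
set b := - (g n.+1 / g n.+2).
have b0 : b != 0 by rewrite oppr_eq0 mulf_neq0 ?invr_eq0 ?gt_eqF.
set zt := - (_ * _).
have zb : b * zt = rho n.+2 by rewrite /b /zt; field; rewrite !gt_eqF.
have [c [rs [c0 srs hrs e]]] := greedy_factor R n.
have sc r : ('X - r%:P) \Po (b *: 'X) = b *: ('X - (r / b)%:P).
  rewrite comp_polyB comp_polyX comp_polyC scalerBr; congr (_ - _).
  by rewrite -mul_polyC -polyCM mulrC divfK.
pose rs' := [seq r / b | r <- rs].
have [c' c'0 eP] : exists2 c', c' != 0 & P_ R n.+2 = c'%:P * (('X - zt%:P) ^+ 2 * \prod_(r <- rs') ('X - r%:P)).
  exists (g n.+2 * c * b ^+ 2 * b ^+ size rs).
    by do 3?[apply: mulf_neq0]; rewrite ?expf_neq0 // gt_eqF.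
  rewrite P_E e linearZ /= rmorphM rmorphXn /= sc.
  rewrite -zb [b * zt]mulrC mulfK // exprZn.
  rewrite rmorph_prod /= (eq_bigr _ (fun r _ => sc r)) big_map.
  have -> : \prod_(i <- rs) (b *: ('X - (i / b)%:P)) = b ^+ size rs *: \prod_(i <- rs) ('X - (i / b)%:P).
    elim: (rs) => [|r s IH]; first by rewrite !big_nil expr0 scale1r.
    by rewrite !big_cons IH /= exprS -scalerAl -scalerAr scalerA.
  by rewrite -scalerAl -scalerAr !scalerA mul_polyC.
have mono j k : (j < k)%N -> (k < n)%N -> rs`_j < rs`_k.
  move=> jk kn; have /andP[_ h1] := hrs j (ltn_trans jk kn); have /andP[h2 _] := hrs k kn.
  apply: lt_trans (lt_le_trans h1 _) h2; apply: altpt_mono => //.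
  by rewrite !ltnS ltnW.
have urs : uniq rs'.
  rewrite map_inj_uniq; last by move=> x y /(divIf b0).
  apply/(uniqP 0) => i j; rewrite !inE srs => hi hj eij.
  case: (ltngtP i j) => // h; first by have := mono _ _ h hj; rewrite eij ltxx.
  by have := mono _ _ h hi; rewrite eij ltxx.
have nz : zt \notin rs'.
  apply/mapP => -[r hr ez].
  have er : r = rho n.+2 by rewrite -zb ez mulrC divfK.
  have hk : (index r rs < n)%N by rewrite -srs index_mem.
  have /andP[h1 _] := hrs _ hk; rewrite nth_index // er in h1.
  have h2 := @altpt_mono R n.+2 0 (index r rs) isT ltac:(by rewrite !ltnS ltnW).
  have := rho_lt_altpt R n; rewrite er in h2; move=> h3.
  by have := lt_trans h3 (le_lt_trans h2 h1); rewrite ltxx.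
have prodn : \prod_(r <- rs') ('X - r%:P) != 0 by rewrite monic_neq0 // monic_prod_XsubC.
have mE (z : R) : mup z (P_ R n.+2) = ((if zt == z then 2 else 0) + count_mem z rs')%N.
  rewrite eP mupMr; last by rewrite rootC.
  rewrite mupM ?prodn ?expf_neq0 ?polyXsubC_eq0 // mup_XsubCX mu_prod_XsubC //.
have key (z : R) : mup z (P_ R n.+2) = 2%N <-> z = zt.
  rewrite mE count_uniq_mem //; split => [|->]; last by rewrite eqxx (negbTE nz).
  by case: eqP => // _; case: (_ \in _).
rewrite /zeta_; case: xgetP => [y _ /key//|/(_ zt)[]].
exact/key.
Qed.

Lemma ceval_Ptilde n z : ceval (Ptilde_ R n.+2) z = ceval (Rg n.+2) (toC (- rho n.+2) * z).
Proof.
have g1 := gcoef_gt0 R n.+1; have g2 := gcoef_gt0 R n.+2.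
have P0 : (P_ R n.+2).[0] = g n.+2.
  rewrite horner_coef0 coef_poly subn0 p_E coef_gpoly //.
rewrite /Ptilde_ P0 cevalZ ceval_scale P_E cevalZ ceval_scale mulrA -rmorphM mulVf ?gt_eqF //.
rewrite rmorph1 mul1r mulrA -rmorphM zeta_E opprK; congr (ceval _ (toC _ * z)).
by field; rewrite !gt_eqF.
Qed.

(** The scaled reverted polynomials converge uniformly on compact sets. *)
Lemma Ptilde_cvg : {family compact, (fun i => ceval (Ptilde_ R i)) @ \oo -->
  (fun x : cplx R => Psi l (- toC (ustar R) * x))}.
Proof.
have hl3 := lamstar13 R.
have E z : Psi l (- toC (ustar R) * z) = cser (thcoef l) (toC (- xstar R) * z).
  rewrite Psi_theta // mulrA -rmorphN -rmorphM -(ustar_xstar R); congr (cser _ (toC _ * z)); ring.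
have x1 := xstar_ge1 R.
have x4 : xstar R <= 4.
  have c4 : (fun=> 4 : R) @ \oo --> (4 : R) by exact: cvg_cst.
  by apply: (le_cvg (@rho_cvg R) c4) => k; exact: rho_le4.
apply: family_compact_disks => M e M0 e0.
pose P i := Rg i.+2 \Po (- rho i.+2 *: 'X).
pose c m := 1 * (- xstar R) ^+ m * thcoef l m.
pose B m := 4 ^+ m * base3 R m.
have sB : superdec B by exact: superdec_scale (@superdec_base R).
have hP i m : `|(P i)`_m| <= `|B m|.
  rewrite coef_comp_scale normrM [leRHS]normrM; apply: ler_pM => //.
    have r1 := rho_ge1 R i.+1; have r4 := rho_le4 R i.+1.
    by rewrite !normrX normrN lerXn2r ?nnegrE // !ger0_norm //; lra.
  by rewrite base3_norm; apply: coef_Rp_bound; exact: glam13.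
have hc m : `|c m| <= `|B m|.
  rewrite /c mul1r normrM [leRHS]normrM; apply: ler_pM => //; last exact: thcoef_le.
  by rewrite !normrX normrN lerXn2r ?nnegrE // !ger0_norm //; lra.
have hcv m : (fun i => (P i)`_m) @ \oo --> c m.
  under eq_fun do rewrite coef_comp_scale.
  rewrite /c mul1r; apply: cvgM.
    by apply: cvg_pow; apply: cvgN; exact: rho_cvg.
  rewrite (cvg_shiftS (fun i => (Rg i.+1)`_m)) (cvg_shiftS (fun i => (Rg i)`_m)).
  exact: coef_greedy_cvg.
have [N hN] := tannery sB hP hc hcv M0 e0.
exists N.+2 => -[|[|n]] // hn z hz; rewrite E ceval_Ptilde -ceval_scale.
have := hN n hn z hz; rewrite cser_scale ?rmorph1 ?mul1r //; exact: superdec_thcoef.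
Qed.

End ScaledReverted.

Unset Implicit Arguments.

Theorem theorem4 (R : realType) :
  exists qt : R,
    [/\ is_maximum [set q : R | 0 < q < 1 /\ LPplus (Psi q)] qt,
        @m_ R @ \oo --> qt^-1 &
        exists ut : R,
          unique (fun u : R => double_zero (Psi qt) (toC u)) ut /\
          {family compact, (fun i : nat => ceval (Ptilde_ R i)) @ \oo -->
             (fun x : cplx R => Psi qt (- toC ut * x))}].
Proof.
exists (lamstar R); split; [exact: lamstar_maximum|exact: m_cvg|].
exists (ustar R); split; [exact: double_zero_unique|exact: Ptilde_cvg].
Qed.
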